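(* Let $(\mathcal E,D)$ be an unbounded $(A,B)$-bimodule. Then all inclusions $\mathcal A_{i+1}\to\mathcal A_i$ of its Sobolev subalgebras are spectral invariant (i.e. $\mathrm{Sp}_{\mathcal A_{i+1}}(a)=\mathrm{Sp}_{\mathcal A_i}(a)$ for all $a\in\mathcal A_{i+1}$), and hence the $\mathcal A_i$ are stable under holomorphic functional calculus in $A$.
   Context: All $C^*$-algebras are separable and $\mathbb Z/2$-graded (possibly trivially); $C^*$-modules are countably generated graded right Hilbert modules; $\gamma$ is the grading operator. An $(A,B)$-bimodule is a $C^*$-$B$-module with a graded *-homomorphism $A\to\mathrm{End}^*_B(\mathcal E)$ into the adjointable operators (elements of $A$ are identified with operators). A closed densely defined operator $D$ is regular if $D^*$ is densely defined and $1+D^*D$ has dense range. Commutators are graded, $[D,T]=DT-\gamma T\gamma D$ for odd $D$; ''$[D,T]\in\mathrm{End}^*$'' means $T$ preserves $\mathrm{Dom}\,D$ and $[D,T]$ extends to an adjointable operator. An unbounded $(A,B)$-bimodule ($KK$-cycle) is an $(A,B)$-bimodule $\mathcal E$ with an odd selfadjoint regular operator $D$ such that for all $a$ in a dense subalgebra of $A$: $a\,\mathrm{Dom}D\subset\mathrm{Dom}D$, $[D,a]$ extends to an element of $\mathrm{End}^*_B(\mathcal E)$, and $a(1+D^2)^{-1/2}$ is compact. Sobolev subalgebras. $\mathcal E^{\oplus 2^i}$ is graded by $\gamma_0=\gamma$, $\gamma_{i+1}=\gamma_i\oplus(-\gamma_i)$; $D$ acts diagonally. $p_{i+1}=\begin{pmatrix}(1+D^2)^{-1}&D(1+D^2)^{-1}\\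 D(1+D^2)^{-1}&D^2(1+D^2)^{-1}\end{pmatrix}$ on $\mathcal E^{\oplus 2^i}\oplus\mathcal E^{\oplus 2^i}$ (the projection onto the graph of $D$); block-diagonal amplifications are denoted by the same symbol; $p^\perp=1-p$; $p_0,p_0^\perp$ are omitted. Put $\mathcal A_0=A$, $\pi_0(a)=\theta_0(a)=a$, and inductively $\mathcal A_{i+1}=\{a\in\mathcal A_i:[D,\theta_i(a)]\in\mathrm{End}^*_B(\mathcal E^{\oplus2^i})\}$, $\pi_{i+1}(a)=\begin{pmatrix}\theta_i(a)&0\\ [D,\theta_i(a)]&\gamma_i\theta_i(a)\gamma_i\end{pmatrix}$, $\theta_{i+1}(a)=p_{i+1}p_i\pi_{i+1}(a)p_ip_{i+1}+p_{i+1}^\perp p_i^\perp\pi_{i+1}(a)p_i^\perp p_{i+1}^\perp$. $\mathcal A_i$ is normed by $\|a\|_i=\|\bigoplus_{j\le i}\pi_j(a)\|$. Spectra in nonunital algebras are taken in unitizations.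
   Formalization: Spectral invariance is proved in full with a unit always adjoined to every 𝒜_i; with unitizations taken only for nonunital algebras, it is proved assuming that a unit of 𝒜_{i+1}, if any, is a unit of 𝒜_i, without which the claim is false. *)

(* Defs.v *)
From HB Require Import structures.
From mathcomp Require Import all_boot all_order all_algebra.
From mathcomp Require Import complex.
From mathcomp Require Import all_classical all_reals all_analysis.

Set Implicit Arguments.
Unset Strict Implicit.
Unset Printing Implicit Defensive.

Import Order.TTheory GRing.Theory Num.Theory.
Import numFieldNormedType.Exports.
Local Open Scope classical_set_scope.
Local Open Scope ring_scope.

(* The scalars are R[i]; only R[i]^o carries the topological structures, hence
   the switches between the two below. Norms take their values in R[i].

   Algebras are not necessarily unital; [cgr] is the grading automorphism. *)
Record gradedCStar (R : realType) := GradedCStar {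
  cstar_car :> completeNormedModType R[i];
  cmul : cstar_car -> cstar_car -> cstar_car;
  cadj : cstar_car -> cstar_car;
  cgr : cstar_car -> cstar_car;
  cmulA : forall a b c, cmul a (cmul b c) = cmul (cmul a b) c;
  cmulPl : forall (l : R[i]) a b c,
    cmul (l *: a + b) c = l *: cmul a c + cmul b c;
  cmulPr : forall (l : R[i]) a b c,
    cmul c (l *: a + b) = l *: cmul c a + cmul c b;
  cnormM : forall a b, `|cmul a b| <= `|a| * `|b|;
  cadjK : forall a, cadj (cadj a) = a;
  cadjP : forall (l : R[i]) a b, cadj (l *: a + b) = (l^*)%C *: cadj a + cadj b;
  cadjM : forall a b, cadj (cmul a b) = cmul (cadj b) (cadj a);
  cstarE : forall a, `|cmul (cadj a) a| = `|a| ^+ 2;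
  cgrK : forall a, cgr (cgr a) = a;
  cgrP : forall (l : R[i]) a b, cgr (l *: a + b) = l *: cgr a + cgr b;
  cgrM : forall a b, cgr (cmul a b) = cmul (cgr a) (cgr b);
  cgr_adj : forall a, cgr (cadj a) = cadj (cgr a)
}.

Definition separable (R : realType) (A : gradedCStar R) : Prop :=
  exists s : nat -> A, dense (range s).

(* Graded right Hilbert module: [hip] is conjugate linear in its first
   argument, [hgr] is the grading operator gamma. *)
Record hilbertModule (R : realType) (B : gradedCStar R) := HilbertModule {
  hm_car :> completeNormedModType R[i];
  hact : hm_car -> B -> hm_car;
  hip : hm_car -> hm_car -> B;
  hgr : hm_car -> hm_car;
  hactPl : forall (l : R[i]) x y b,
    hact (l *: x + y) b = l *: hact x b + hact y b;
  hactPr : forall (l : R[i]) x b c,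
    hact x (l *: b + c) = l *: hact x b + hact x c;
  hactA : forall x b c, hact (hact x b) c = hact x (cmul b c);
  hipP : forall (l : R[i]) x y z, hip x (l *: y + z) = l *: hip x y + hip x z;
  hip_act : forall x y b, hip x (hact y b) = cmul (hip x y) b;
  hipC : forall x y, hip y x = cadj (hip x y);
  hip_ge0 : forall x, exists c : B, hip x x = cmul (cadj c) c;
  hnormE : forall x, `|x| ^+ 2 = `|hip x x|;
  hgrK : forall x, hgr (hgr x) = x;
  hgrP : forall (l : R[i]) x y, hgr (l *: x + y) = l *: hgr x + hgr y;
  hgr_act : forall x b, hgr (hact x b) = hact (hgr x) (cgr b);
  hgr_ip : forall x y, hip (hgr x) (hgr y) = cgr (hip x y)
}.

Definition countably_generated (R : realType) (B : gradedCStar R)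
    (E : hilbertModule B) : Prop :=
  exists x : nat -> E,
    dense [set y : E | exists n (b : nat -> B), y = \sum_(k < n) hact (x k) (b k)].

Section SumModules.
Context {R : realType} {B : gradedCStar R}.
Variable E : hilbertModule B.

(* E^(+2^i), built by doubling: E^(+2^i.+1) = E^(+2^i) (+) E^(+2^i). *)
Fixpoint hpow (i : nat) : lmodType R[i] :=
  if i is j.+1 then (hpow j * hpow j)%type else E.

Fixpoint ipn (i : nat) : hpow i -> hpow i -> B :=
  match i return hpow i -> hpow i -> B with
  | 0 => @hip R B E
  | j.+1 => fun x y => @ipn j x.1 y.1 + @ipn j x.2 y.2
  end.

Fixpoint grn (i : nat) : hpow i -> hpow i :=
  match i return hpow i -> hpow i with
  | 0 => @hgr R B E
  | j.+1 => fun x => (@grn j x.1, - @grn j x.2)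
  end.

Fixpoint diagn (f : E -> E) (i : nat) : hpow i -> hpow i :=
  match i return hpow i -> hpow i with
  | 0 => f
  | j.+1 => fun x => (@diagn f j x.1, @diagn f j x.2)
  end.

Fixpoint domn (S : set E) (i : nat) : set (hpow i) :=
  match i return set (hpow i) with
  | 0 => S
  | j.+1 => [set x | @domn S j x.1 /\ @domn S j x.2]
  end.

(* Adjointability forces linearity, B-linearity and boundedness. *)
Definition is_adjoint (i : nat) (T T' : hpow i -> hpow i) : Prop :=
  forall x y, ipn (T x) y = ipn x (T' y).

Definition adjointable (i : nat) (T : hpow i -> hpow i) : Prop :=
  exists T', is_adjoint T T'.

Definition positive_op (S : E -> E) : Prop :=
  exists T T' : E -> E, @is_adjoint 0 T T' /\ forall x, S x = T' (T x).

(* Operator-norm closure of the span of the maps z |-> x<y,z>. *)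
Definition compact_op (T : E -> E) : Prop :=
  @adjointable 0 T /\
  forall e : R[i], 0 < e -> exists s : seq (E * E),
    forall z : E, `|T z - \sum_(p <- s) hact p.1 (hip p.2 z)| <= e * `|z|.

End SumModules.

Arguments is_adjoint {R B} E i T T'.
Arguments adjointable {R B} E i T.

(* An operator is a domain together with a map, only meaningful on the domain. *)
Record partialOp (T : Type) := PartialOp { pdom : set T; papp :> T -> T }.

Section Unbounded.
Context {R : realType} {B : gradedCStar R} {E : hilbertModule B}.
Variable D : partialOp E.

Definition module_operator : Prop :=
  [/\ pdom D 0,
      forall (l : R[i]) x y, pdom D x -> pdom D y ->
        pdom D (l *: x + y) /\ D (l *: x + y) = l *: D x + D y
    & forall x b, pdom D x -> pdom D (hact x b) /\ D (hact x b) = hact (D x) b].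

Definition pgraph : set (E * E) := [set z | pdom D z.1 /\ z.2 = D z.1].

Definition adj_graph : set (E * E) :=
  [set z | forall x, pdom D x -> hip (D x) z.1 = hip x z.2].

Definition regular_op : Prop :=
  [/\ module_operator, closed pgraph, dense (pdom D),
      dense [set y | exists z, adj_graph (y, z)]
    & dense [set w | exists x z, [/\ pdom D x, adj_graph (D x, z) & w = x + z]]].

Definition selfadjoint_op : Prop := adj_graph = pgraph.

Definition odd_op : Prop :=
  forall x, pdom D x -> pdom D (hgr x) /\ D (hgr x) = - hgr (D x).

(* (1 + D^2)^-1 : for D selfadjoint regular there is exactly one such y. *)
Definition resolvent (x : E) : E :=
  xget 0 [set y | [/\ pdom D y, pdom D (D y) & y + D (D y) = x]].

(* S is an adjointable extension of the graded commutator [D, T]. *)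
Definition comm_ext (i : nat) (T S : hpow E i -> hpow E i) : Prop :=
  adjointable E i S /\
  forall x, domn (pdom D) x ->
    S x = diagn D (T x) - grn (T (grn (diagn D x))).

(* "[D, T] is in End^*" *)
Definition comm_bounded (i : nat) (T : hpow E i -> hpow E i) : Prop :=
  (forall x, domn (pdom D) x -> domn (pdom D) (T x)) /\ exists S, comm_ext T S.

Definition comm (i : nat) (T : hpow E i -> hpow E i) : hpow E i -> hpow E i :=
  xget (fun _ => 0) [set S | comm_ext T S].

(* p_i acting on E^(+2^i); p_0 is the identity because p_0 is to be omitted. *)
Definition graph_proj (i : nat) : hpow E i -> hpow E i :=
  match i return hpow E i -> hpow E i with
  | 0 => id
  | j.+1 => fun z =>
      let r := diagn resolvent (i := j) in
      let Dr := diagn (fun x => D (resolvent x)) (i := j) in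
      let D2r := diagn (fun x => D (D (resolvent x))) (i := j) in
      (r z.1 + Dr z.2, Dr z.1 + D2r z.2)
  end.

(* 1 - p_i, except for i = 0, where it is to be omitted as well. *)
Definition graph_projC (i : nat) : hpow E i -> hpow E i :=
  match i return hpow E i -> hpow E i with
  | 0 => id
  | j.+1 => fun z => z - graph_proj (i := j.+1) z
  end.

Definition dbl (i : nat) (T : hpow E i -> hpow E i) :
    hpow E i.+1 -> hpow E i.+1 :=
  fun z => (T z.1, T z.2).

End Unbounded.

Arguments resolvent {R B E} D x.
Arguments comm_bounded {R B E} D i T.
Arguments comm {R B E} D i T.
Arguments graph_proj {R B E} D i.
Arguments graph_projC {R B E} D i.

Section Sobolev.
Context {R : realType} {A B : gradedCStar R} {E : hilbertModule B}.
Variable phi : A -> E -> E.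

Definition bimodule : Prop :=
  [/\ forall (l : R[i]) a b x, phi (l *: a + b) x = l *: phi a x + phi b x,
      forall a b x, phi (cmul a b) x = phi a (phi b x),
      forall a, is_adjoint E 0 (phi a) (phi (cadj a))
    & forall a x, hgr (phi a (hgr x)) = phi (cgr a) x].

Definition subalgebra (S : set A) : Prop :=
  [/\ S 0, forall (l : R[i]) a b, S a -> S b -> S (l *: a + b)
    & forall a b, S a -> S b -> S (cmul a b)].

Variable D : partialOp E.

Definition unbounded_bimodule : Prop :=
  [/\ bimodule, odd_op D, selfadjoint_op D, regular_op D
    & exists S : set A, [/\ subalgebra S, dense S &
        forall a, S a -> comm_bounded D 0 (phi a) /\
          exists Q : E -> E, (* Q = (1 + D^2)^-1/2 *)
            [/\ positive_op Q, forall x, Q (Q x) = resolvent D x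
              & compact_op (fun x => phi a (Q x))]]].

(* pi_{i+1}, as a function of T = theta_i(a). *)
Definition pi_step (i : nat) (T : hpow E i -> hpow E i) :
    hpow E i.+1 -> hpow E i.+1 :=
  fun z => (T z.1, comm D i T z.1 + grn (T (grn z.2))).

(* [theta i a] is meaningful for a in [sobolev i]. *)
Fixpoint theta (i : nat) (a : A) : hpow E i -> hpow E i :=
  match i return hpow E i -> hpow E i with
  | 0 => phi a
  | j.+1 => fun z =>
      let p := graph_proj D j.+1 in let q := dbl (graph_proj D j) in
      let p' := graph_projC D j.+1 in let q' := dbl (graph_projC D j) in
      let P := pi_step (@theta j a) in
      p (q (P (q (p z)))) + p' (q' (P (q' (p' z))))
  end.

Fixpoint sobolev (i : nat) : set A :=
  if i is j.+1 then
    [set a | sobolev j a /\ comm_bounded D j (theta (i := j) a)]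
  else setT.

End Sobolev.

Section Spectrum.
Context {R : realType}.
Implicit Type V : normedModType R[i].

Definition inverse_of V (mul : V -> V -> V) (one x y : V) : Prop :=
  mul x y = one /\ mul y x = one.

(* Spectrum of a in the algebra P (a subalgebra of V) with unit [one]. *)
Definition unital_spectrum V (mul : V -> V -> V) (one : V) (P : set V) (a : V) :
    set R[i] :=
  [set l | ~ exists b, P b /\ inverse_of mul one (a - l *: one) b].

(* [contour_integral G F v]: the integral of F along the cycle
   G_0 + ... + G_(m-1) is v, as a limit of Riemann-Stieltjes sums. *)
Definition contour_integral V (m : nat) (G : 'I_m -> R -> R[i])
    (F : R[i] -> V) (v : V) : Prop :=
  (fun n : nat => \sum_(j < m) \sum_(k < n)
     (G j (k.+1%:R / n%:R) - G j (k%:R / n%:R)) *: F (G j (k%:R / n%:R)))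
  @ \oo --> v.

Definition two_pi_i : R[i] := Complex 0 (2 * pi).

(* G is a cycle of rectifiable closed curves (with Lipschitz parametrizations
   over [0, 1]) in U minus K, of index 1 around K and 0 around the complement
   of U. *)
Definition surrounds (m : nat) (G : 'I_m -> R -> R[i]) (K U : set R[i]) : Prop :=
  [/\ forall j, exists L : R, forall s t : R, 0 <= s <= 1 -> 0 <= t <= 1 ->
        `|G j s - G j t| <= (L * `|s - t|)%:C%C,
      forall j, G j 0 = G j 1,
      forall j (t : R), 0 <= t <= 1 -> U (G j t) /\ ~ K (G j t),
      forall z, K z ->
        contour_integral G (fun w => (w - z)^-1 : R[i]^o) two_pi_i
    & forall z, ~ U z -> contour_integral G (fun w => (w - z)^-1 : R[i]^o) 0].

(* [b] is the value f(a) of the holomorphic functional calculus in V, for f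
   holomorphic on a neighbourhood U of the spectrum of a. *)
Definition holo_calc V (mul : V -> V -> V) (one a : V) (f : R[i] -> R[i])
    (b : V) : Prop :=
  let K := unital_spectrum mul one setT a in
  exists (U : set R[i]) (m : nat) (G : 'I_m -> R -> R[i]) (res : R[i] -> V),
    [/\ open (U : set R[i]^o) /\ K `<=` U,
        forall z, U z -> derivable (f : R[i]^o -> R[i]^o) z 1,
        surrounds G K U,
        forall j (t : R), 0 <= t <= 1 ->
          inverse_of mul one (G j t *: one - a) (res (G j t))
      & contour_integral G (fun w => f w *: res w) (two_pi_i *: b)].

Variable A : gradedCStar R.

(* The unitization A (+) C, always adjoining a new unit. *)
Definition uni_mul (z w : (A * R[i]^o)%type) : (A * R[i]^o)%type :=
  (cmul z.1 w.1 + z.2 *: w.1 + w.2 *: z.1, z.2 * w.2).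

Definition uni_one : (A * R[i]^o)%type := (0, 1).

Definition uni_set (S : set A) : set (A * R[i]^o) := [set z | S z.1].

(* The zero algebra counts as nonunital. *)
Definition is_unit (S : set A) (e : A) : Prop :=
  [/\ S e, e != 0 & forall x, S x -> cmul e x = x /\ cmul x e = x].

Definition spectrum_plus (S : set A) (a : A) : set R[i] :=
  unital_spectrum uni_mul uni_one (uni_set S) (a, 0).

(* In S itself if S has a unit, in its unitization otherwise. *)
Definition spectrum (S : set A) (a : A) : set R[i] :=
  [set l | (exists e, is_unit S e /\ unital_spectrum (@cmul R A) e S a l) \/
           (~ (exists e, is_unit S e) /\ spectrum_plus S a l)].

(* Stability of S under the holomorphic functional calculus of A: in the
   unitization of A, and, when S contains a unit of A, in A itself. If
   f(0) = 0, the value of f in the unitization has zero scalar part. *)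
Definition holo_stable (S : set A) : Prop :=
  (forall a f b, S a -> holo_calc uni_mul uni_one (a, 0) f b -> uni_set S b) /\
  (forall e a f b, is_unit setT e -> S e -> S a ->
     holo_calc (@cmul R A) e a f b -> S b).

End Spectrum.

(* Main.v *)
(* Everything takes place at the level of operators on E^(+2^i). Call an adjointable
   operator T Lipschitz if it preserves Dom D and DT - T'D =: d(T) is adjointable,
   where T' = gamma T gamma. The projection onto the graph of D commutes with D and
   gamma up to amplification, and [[T, 0], [d(T), T']] preserves that graph; hence
   each theta_i is multiplicative on A_i, and a in A_i lies in A_(i+1) iff
   theta_i(a) is Lipschitz.

   Spectral invariance therefore means that a bounded inverse S of a Lipschitz
   operator T is Lipschitz. More generally let S be a group inverse of T, i.e.
   ST = TS, T^2 S = T and S^2 T = S; this also covers units other than 1. With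
   J_n = (1 + e_n^2 D^2)^-1 and e_n -> 0, the operators D [T^3, J_n] tend strongly to 0,
   so for x in Dom D the vectors T J_n S^2 x converge to Sx, their images under D
   converge as well, and D is closed. No density of A_(i+1) in A_i is used.

   For the holomorphic calculus, the matrices [[T, 0], [d(T), T']] of the resolvents
   obey the resolvent identity, hence depend strongly continuously on the spectral
   parameter, and so do their adjoints. Their Riemann sums converge strongly to an
   adjointable operator; its lower left corner is the commutator of D with
   theta_i(f(a)), again because D is closed.

   Neither positivity nor spectral theory in C*-algebras is needed:
   *-homomorphisms are bounded because small selfadjoint elements are means of two
   unitaries, and D +- i/e is handled through |(1 + ieD)x| = |(1 - ieD)x|. *)

(* Why three factors of [T]: with [v = S S x] one has [S x = T v], but [v] need not lie in [Dom D],
   so [T' D J_n v] has no evident limit. Since [T' = S' S' T' T' T'], it is enough to control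
   [T' T' T' D J_n v], hence [D T T T J_n v] and, up to the commutator with [J_n], the vectors
   [J_n D T T T v]. Here [T T T v = T x] lies in [Dom D], whereas [T T v = T S x] involves an
   idempotent that is not known to preserve the domain when [S] is only a group inverse.

   Why [J_n] is even in [D]: [(1 + c D)^-1] passes an odd operator only at the price of turning [c]
   into [-c]. The mean over both signs is insensitive to this, and a general [T] is split into its
   even and odd parts.

   Why two corners enter [theta]: a matrix preserving the graph of [D] is block triangular for
   [p_(i+1)], and each diagonal corner of such matrices is multiplicative by itself. *)
Require Import Defs.
From mathcomp Require Import all_boot all_order all_algebra.
From mathcomp Require Import complex ring lra.
From mathcomp Require Import all_classical all_reals all_analysis.

Set Implicit Arguments.
Unset Strict Implicit.
Unset Printing Implicit Defensive.

Import Order.TTheory GRing.Theory Num.Theory.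
Import numFieldNormedType.Exports.
Import ComplexField.Normc.
Local Open Scope classical_set_scope.
Local Open Scope ring_scope.

(** * Identities in modules *)

Section ModuleReflection.
Context {K : pzRingType} {V : lmodType K}.

Inductive mexp : Type :=
  | MZero | MAtom of nat | MAdd of mexp & mexp | MOpp of mexp | MScale of K & mexp.

Fixpoint meval (env : seq V) (e : mexp) : V :=
  match e with
  | MZero => 0
  | MAtom n => nth 0 env n
  | MAdd a b => meval env a + meval env b
  | MOpp a => - meval env a
  | MScale l a => l *: meval env a
  end.

(** [Nat.eqb] is used because the [cbv] in [module_coef] can then evaluate the test on concrete
    indices. *)
Fixpoint mcoef (e : mexp) (i : nat) : K :=
  match e with
  | MZero => 0
  | MAtom n => if Nat.eqb n i then 1 else 0
  | MAdd a b => mcoef a i + mcoef b i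
  | MOpp a => - mcoef a i
  | MScale l a => l * mcoef a i
  end.

Lemma meval_coef env e :
  meval env e = \sum_(i < size env) mcoef e i *: nth 0 env i.
Proof.
elim: e => [|n|a IHa b IHb|a IHa|l a IHa] /=.
- by rewrite big1// => i _; rewrite scale0r.
- have [nlt|nge] := ltnP n (size env).
    rewrite (bigD1 (Ordinal nlt))//= PeanoNat.Nat.eqb_refl scale1r big1 ?addr0// => i /eqP ni.
    case: PeanoNat.Nat.eqb_spec => [E|_]; last by rewrite scale0r.
    by case: ni; apply: val_inj.
  rewrite nth_default// big1// => i _.
  case: PeanoNat.Nat.eqb_spec => [E|_]; last by rewrite scale0r.
  by move: (ltn_ord i); rewrite -E ltnNge nge.
- by rewrite IHa IHb -big_split; apply: eq_bigr => i _; rewrite scalerDl.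
- by rewrite IHa -sumrN; apply: eq_bigr => i _; rewrite scaleNr.
- by rewrite IHa scaler_sumr; apply: eq_bigr => i _; rewrite scalerA.
Qed.

(** A recursive conjunction instead of a bounded quantifier: it unfolds into one scalar goal per
    atom. *)
Fixpoint all_coef (n : nat) (e1 e2 : mexp) : Prop :=
  if n is m.+1 then mcoef e1 m = mcoef e2 m /\ all_coef m e1 e2 else True.

Lemma meval_eq env e1 e2 :
  all_coef (size env) e1 e2 -> meval env e1 = meval env e2.
Proof.
move=> h; rewrite !meval_coef; apply: eq_bigr => i _; congr (_ *: _).
move: (nat_of_ord i) (ltn_ord i) => k.
elim: (size env) h => // n IH [h h']; rewrite ltnS leq_eqVlt => /predU1P[->//|].
exact: IH.
Qed.

End ModuleReflection.

Ltac m_mem x env :=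
  lazymatch env with
  | nil => constr:(false)
  | x :: _ => constr:(true)
  | _ :: ?l => m_mem x l
  end.

Ltac m_index x env :=
  lazymatch env with
  | x :: _ => constr:(O)
  | _ :: ?l => let n := m_index x l in constr:(S n)
  end.

Ltac m_atoms e env :=
  lazymatch e with
  | @GRing.zero _ => env
  | @GRing.add _ ?a ?b => let env1 := m_atoms a env in m_atoms b env1
  | @GRing.opp _ ?a => m_atoms a env
  | @GRing.scale _ _ _ ?a => m_atoms a env
  | _ => let b := m_mem e env in
         lazymatch b with true => env | false => constr:(e :: env) end
  end.

Ltac m_reify K e env :=
  lazymatch e with
  | @GRing.zero _ => constr:(@MZero K)
  | @GRing.add _ ?a ?b =>
      let x := m_reify K a env in let y := m_reify K b env in constr:(MAdd x y)
  | @GRing.opp _ ?a => let x := m_reify K a env in constr:(MOpp x)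
  | @GRing.scale _ _ ?l ?a =>
      let x := m_reify K a env in constr:(@MScale K l x)
  | _ => let n := m_index e env in constr:(@MAtom K n)
  end.

(* Reduces an identity between linear combinations in the [K]-module [V] to the
   identities between the coefficients. *)
Ltac module_coef K V :=
  lazymatch goal with
  | |- @eq _ ?x ?y =>
      let env0 := m_atoms x (@nil V) in
      let env := m_atoms y env0 in
      let a := m_reify K x env in
      let b := m_reify K y env in
      refine (@meval_eq K V env a b _);
      cbv [all_coef mcoef size Nat.eqb]; repeat split
  end.

Ltac module_over K V := module_coef K V; first [ring | by field].

(** [H] is a relation between scalars, such as [c * c = - 1], modulo which the coefficients are
    compared. *)
Ltac module_with K V H := module_coef K V; first [ring: H | by field: H].

(** * Banach norms with real values *)

Section ComplexModulus.
Context {R : realType}.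
Implicit Types (l : R[i]) (r : R).

Lemma normcR r : normc r%:C%C = `|r|.
Proof. by rewrite /= expr0n /= addr0 sqrtr_sqr. Qed.

Lemma normc_ge0 l : 0 <= normc l.
Proof. by case: l => a b; exact: sqrtr_ge0. Qed.

Definition imag : R[i] := Complex 0 1.

Lemma normc_imag : normc imag = 1.
Proof. by rewrite /= expr0n /= add0r expr1n sqrtr1. Qed.

Lemma conjc_imag : (imag^*)%C = - imag.
Proof. by apply/eqP; rewrite eq_complex /= oppr0 !eqxx. Qed.

Lemma conjcM (k l : R[i]) : ((k * l)^*)%C = (k^*)%C * (l^*)%C.
Proof. exact: rmorphM. Qed.

Lemma conjcN l : ((- l)^*)%C = - (l^*)%C.
Proof. exact: rmorphN. Qed.

Lemma conjcB (k l : R[i]) : ((k - l)^*)%C = (k^*)%C - (l^*)%C.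
Proof. exact: rmorphB. Qed.

Lemma conjcN1 : ((- 1 : R[i])^*)%C = - 1.
Proof. by rewrite conjcN conjc1. Qed.

Lemma normc_conj l : normc (l^*)%C = normc l.
Proof. by case: l => a b /=; rewrite sqrrN. Qed.

Lemma normr_normc l : `|l| = (normc l)%:C%C.
Proof. by []. Qed.

Lemma imag_mul_imag : imag * imag = -1.
Proof. by rewrite -expr2 sqr_i. Qed.

End ComplexModulus.

Section LinearMaps.
Context {R : realType} {V W : lmodType R[i]}.
Variable f : V -> W.
Hypothesis fP : forall (l : R[i]) x y, f (l *: x + y) = l *: f x + f y.

Lemma lin0 : f 0 = 0.
Proof.
have := fP 1 0 0; rewrite !scale1r addr0 => /eqP.
by rewrite -subr_eq subrr => /eqP.
Qed.

Lemma linD x y : f (x + y) = f x + f y.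
Proof. by have := fP 1 x y; rewrite !scale1r. Qed.

Lemma linZ l x : f (l *: x) = l *: f x.
Proof. by have := fP l x 0; rewrite lin0 !addr0. Qed.

Lemma linN x : f (- x) = - f x.
Proof. by rewrite -scaleN1r linZ scaleN1r. Qed.

Lemma linB x y : f (x - y) = f x - f y.
Proof. by rewrite linD linN. Qed.

Lemma lin_sum (I : Type) (r : seq I) (P : pred I) (F : I -> V) :
  f (\sum_(i <- r | P i) F i) = \sum_(i <- r | P i) f (F i).
Proof. by elim/big_rec2: _ => [|i y x _ <-]; rewrite ?lin0 ?linD. Qed.

End LinearMaps.

Section NullSequences.
Context {R : realType}.
Implicit Types (a b : nat -> R).

(** One-sided: this says that the limes superior is at most 0. Thus [null_const] turns an asymptotic
    estimate into an inequality. *)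
Definition null a := forall e : R, 0 < e -> exists N, forall n, (N <= n)%N -> a n < e.

Lemma null_le (C : R) a b : 0 <= C ->
  (forall n, a n <= C * b n) -> null b -> null a.
Proof.
move=> C0 ab nb e e0.
have C1 : 0 < C + 1 by lra.
have [N hN] := nb (e / (C + 1)) (divr_gt0 e0 C1).
exists N => n nN; apply: (le_lt_trans (ab n)).
apply: (@le_lt_trans _ _ (C * (e / (C + 1)))).
  by apply: ler_wpM2l => //; apply/ltW/hN.
by rewrite mulrA ltr_pdivrMr// mulrC ltr_pM2l//; lra.
Qed.

Lemma null_le1 a b : (forall n, a n <= b n) -> null b -> null a.
Proof. by move=> ab; apply: (@null_le 1) => // n; rewrite mul1r. Qed.

Lemma nullD a b : null a -> null b -> null (fun n => a n + b n).
Proof.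
move=> na nb e e0; have e2 : 0 < e / 2 by lra.
have [N hN] := na _ e2; have [M hM] := nb _ e2.
exists (maxn N M) => n; rewrite geq_max => /andP[/hN ? /hM ?]; lra.
Qed.

Lemma null_const (c : R) : null (fun=> c) -> c <= 0.
Proof.
move=> nc; rewrite leNgt; apply/negP => c0.
by have [N /(_ N (leqnn _))] := nc _ c0; rewrite ltxx.
Qed.

Lemma null_cst (c : R) : c <= 0 -> null (fun=> c).
Proof. by move=> c0 e e0; exists 0%N => n _; exact: le_lt_trans e0. Qed.

Lemma null_geometric (C q : R) : 0 <= q -> q < 1 -> null (fun n => C * q ^+ n).
Proof.
move=> q0 q1 e e0.
have /cvgrPdist_lt/(_ _ e0)[N _ hN] : geometric C q n @[n --> \oo] --> 0.
  by apply: cvg_geometric; rewrite ger0_norm.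
exists N => n nN; have := hN n nN.
by rewrite /= sub0r normrN; apply: le_lt_trans; exact: ler_norm.
Qed.

Lemma null_harmonic : null (fun n => (n.+1%:R)^-1).
Proof.
move=> e e0.
have /cvgrPdist_lt/(_ _ e0)[N _ hN] := @cvg_harmonic R.
exists N => n nN; have := hN n nN.
by rewrite /= sub0r normrN; apply: le_lt_trans; exact: ler_norm.
Qed.

End NullSequences.

(** The norm is kept apart from the type because [hpow E i] is only an [lmodType]; real values make
    the estimates accessible to [lra]. *)
Record banach_norm (R : realType) (V : lmodType R[i]) := BanachNorm {
  bnorm :> V -> R;
  bnormD : forall x y, bnorm (x + y) <= bnorm x + bnorm y;
  bnormZ : forall l x, bnorm (l *: x) = normc l * bnorm x;
  bnorm_eq0 : forall x, bnorm x = 0 -> x = 0;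
  bnorm_complete : forall u : nat -> V,
    (forall e, 0 < e -> exists N, forall n m, (N <= n)%N -> (N <= m)%N ->
      bnorm (u n - u m) < e) ->
    exists l, null (fun n => bnorm (u n - l))
}.

Section BanachNormTheory.
Context {R : realType} {V : lmodType R[i]}.
Variable N : banach_norm V.
Implicit Types (u v : nat -> V) (x y : V).

Definition cvs u x := null (fun n => N (u n - x)).

Lemma bnorm0 : N 0 = 0.
Proof. by rewrite -(scale0r 0) bnormZ normc0 mul0r. Qed.

Lemma bnormN x : N (- x) = N x.
Proof. by rewrite -scaleN1r bnormZ normcN normc1 mul1r. Qed.

Lemma bnorm_ge0 x : 0 <= N x.
Proof. by have := bnormD N x (- x); rewrite subrr bnorm0 bnormN; lra. Qed.

Lemma bnormC x y : N (x - y) = N (y - x).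
Proof. by rewrite -bnormN opprB. Qed.

Lemma bnormB x y : N (x - y) <= N x + N y.
Proof. by rewrite -(bnormN y) bnormD. Qed.

Lemma bnorm_dist z x y : N (x - y) <= N (x - z) + N (z - y).
Proof. by rewrite -{1}(subrK z x) -addrA bnormD. Qed.

Lemma bnorm_sum (I : Type) (r : seq I) (P : pred I) (F : I -> V) :
  N (\sum_(i <- r | P i) F i) <= \sum_(i <- r | P i) N (F i).
Proof.
elim/big_rec2: _ => [|i y x _ le]; first by rewrite bnorm0.
by apply: le_trans (bnormD _ _ _) _; rewrite lerD2l.
Qed.

Lemma cvs_cst x : cvs (fun=> x) x.
Proof. by rewrite /cvs subrr bnorm0; exact: null_cst. Qed.

Lemma cvs_ext u v x : u =1 v -> cvs u x -> cvs v x.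
Proof. by move=> /funext ->. Qed.

Lemma cvsD u v x y : cvs u x -> cvs v y -> cvs (fun n => u n + v n) (x + y).
Proof.
move=> ux vy; apply: null_le1 (nullD ux vy) => n.
by rewrite opprD addrACA bnormD.
Qed.

Lemma cvsZ l u x : cvs u x -> cvs (fun n => l *: u n) (l *: x).
Proof.
apply: (@null_le _ (normc l)) => [|n]; first exact: normc_ge0.
by rewrite -scalerBr bnormZ.
Qed.

Lemma cvsN u x : cvs u x -> cvs (fun n => - u n) (- x).
Proof. by move=> /(cvsZ (-1)); under eq_fun do rewrite scaleN1r; rewrite scaleN1r. Qed.

Lemma cvsB u v x y : cvs u x -> cvs v y -> cvs (fun n => u n - v n) (x - y).
Proof. by move=> ux vy; apply: cvsD => //; exact: cvsN. Qed.

Lemma cvs_unique u x y : cvs u x -> cvs u y -> x = y.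
Proof.
move=> ux uy; apply/eqP; rewrite -subr_eq0; apply/eqP/(bnorm_eq0 (b := N)).
apply/eqP; rewrite eq_le bnorm_ge0 andbT; apply: null_const.
apply: null_le1 (nullD ux uy) => n.
by rewrite (le_trans (bnorm_dist (u n) _ _))// bnormC.
Qed.

(** Besides Banach's fixed point theorem this serves the gliding hump argument, which depends on the
    explicit tail bound. *)
Lemma cvs_geometric u (C q : R) : 0 <= q -> q < 1 ->
  (forall n, N (u n.+1 - u n) <= C * q ^+ n) ->
  exists x, cvs u x /\ forall n, N (x - u n) <= C * q ^+ n / (1 - q).
Proof.
move=> q0 q1 hu.
have C0 : 0 <= C by rewrite (le_trans (bnorm_ge0 _) (le_trans (hu 0%N) _))// expr0 mulr1.
have q1' : 0 < 1 - q by lra.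
have step n k : N (u (n + k)%N - u n) <= C * q ^+ n / (1 - q).
  elim: k n => [|k IH] n.
    by rewrite addn0 subrr bnorm0 divr_ge0 ?mulr_ge0 ?exprn_ge0//; exact: ltW.
  rewrite -addSnnS; apply: (le_trans (bnorm_dist (u n.+1) _ _)).
  apply: (le_trans (lerD (IH n.+1) (hu n))).
  rewrite exprS -subr_ge0.
  have -> // : C * q ^+ n / (1 - q) - (C * (q * q ^+ n) / (1 - q) + C * q ^+ n) = 0.
    by field; rewrite gt_eqF.
have nullC : null (fun n => C / (1 - q) * q ^+ n) by exact: null_geometric.
have [|x ux] := @bnorm_complete _ _ N u.
  move=> e e0; have [M hM] := nullC _ e0.
  exists M => n m nM mM.
  wlog nm : n m nM mM / (m <= n)%N => [W|].
    by case/orP: (leq_total n m) => nm; [rewrite bnormC|]; exact: W.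
  apply: le_lt_trans (hM m mM); rewrite -(subnKC nm) (le_trans (step _ _))//.
  by rewrite mulrAC.
exists x; split=> // n; rewrite -subr_le0; apply: null_const.
apply: null_le1 (_ : null (fun k => N (u (n + k)%N - x))); last first.
  move=> e /ux[M hM]; exists M => k kM; apply: hM.
  by rewrite (leq_trans kM)// leq_addl.
move=> k; have := bnorm_dist (u (n + k)%N) x (u n); have := step n k.
by rewrite (bnormC x (u (n + k)%N)); lra.
Qed.

Lemma cvs_le u x (C : R) : (forall n, N (u n) <= C) -> cvs u x -> N x <= C.
Proof.
move=> uC ux; rewrite -subr_le0; apply: null_const; apply: null_le1 ux => n.
by have := bnorm_dist (u n) x 0; have := uC n; rewrite !subr0 bnormC; lra.
Qed.

(** The closed invariant set [P] is where the square root in [half_sqrt] gets its properties from: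
    the norm bound that makes the map contract, selfadjointness and commutation with [h]. *)
Lemma contraction_fixpoint (P : set V) (f : V -> V) (q : R) :
  0 <= q -> q < 1 -> P 0 -> (forall x, P x -> P (f x)) ->
  (forall u x, (forall n, P (u n)) -> cvs u x -> P x) ->
  (forall x y, P x -> P y -> N (f x - f y) <= q * N (x - y)) ->
  exists2 x, P x & f x = x.
Proof.
move=> q0 q1 P0 Pf Pcl hf; pose u n := iter n f 0.
have Pu n : P (u n) by elim: n => //= n; exact: Pf.
have [|x [ux _]] := @cvs_geometric u (N (u 1%N - u 0%N)) q q0 q1.
  elim=> [|n IH]; first by rewrite expr0 mulr1.
  rewrite exprS mulrCA; apply: (le_trans (hf (u n.+1) (u n) _ _)) => //.
  by apply: ler_wpM2l.
have Px : P x by exact: Pcl ux.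
exists x => //; apply: (@cvs_unique (fun n => u n.+1)).
  by apply: null_le ux => [|n]; [exact: q0|exact: hf].
move=> e /ux[M hM]; exists M => n nM; apply: hM; exact: leqW.
Qed.

End BanachNormTheory.

Section CompleteNormed.
Context {R : realType}.
Variable V : completeNormedModType R[i].
Implicit Types (x y : V).

Definition cnorm x : R := complex.Re `|x|.

Lemma cnormE x : `|x| = (cnorm x)%:C%C.
Proof. by rewrite /cnorm RRe_real// ger0_real. Qed.

Lemma cnormD x y : cnorm (x + y) <= cnorm x + cnorm y.
Proof. by have := ler_normD x y; rewrite !cnormE -rmorphD /= lecR. Qed.

Lemma cnormZ l x : cnorm (l *: x) = normc l * cnorm x.
Proof.
by have := normrZ l x; rewrite !cnormE normr_normc -rmorphM => /complexI.
Qed.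

Lemma cnorm_eq0 x : cnorm x = 0 -> x = 0.
Proof. by move=> x0; apply/eqP; rewrite -normr_eq0 cnormE x0. Qed.

Lemma posC_real (e : R[i]) : 0 < e -> exists r : R, 0 < r /\ e = r%:C%C.
Proof.
move=> e0; exists (complex.Re e); have E : (complex.Re e)%:C%C = e.
  by rewrite RRe_real// gtr0_real.
by split=> //; rewrite -ltcR E.
Qed.

Lemma cnorm_cvg (u : nat -> V) x :
  null (fun n => cnorm (u n - x)) <-> u @ \oo --> x.
Proof.
split=> [h|/cvgrPdist_lt h].
  apply/cvgrPdist_lt => e /posC_real[r [r0 ->]].
  have [M hM] := h _ r0.
  by exists M => // n /hM; rewrite /= distrC cnormE ltcR.
move=> e e0; have [|M _ hM] := h e%:C%C; first by rewrite ltcR.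
by exists M => n /hM; rewrite /= distrC cnormE ltcR.
Qed.

Lemma cnorm_complete (u : nat -> V) :
  (forall e, 0 < e -> exists N, forall n m, (N <= n)%N -> (N <= m)%N ->
    cnorm (u n - u m) < e) ->
  exists l, null (fun n => cnorm (u n - l)).
Proof.
move=> cu; suff /cvg_ex[l ul] : cvg (u @ \oo) by exists l; apply/cnorm_cvg.
apply/cauchy_cvgP/cauchy_exP => e /posC_real[r [r0 ->]].
have [M hM] := cu _ r0.
exists (u M), M => // n /= Mn.
by rewrite -ball_normE /= cnormE ltcR; apply: hM.
Qed.

Definition complete_norm := BanachNorm cnormD cnormZ cnorm_eq0 cnorm_complete.

End CompleteNormed.

Section ProductNorm.
Context {R : realType} {V W : lmodType R[i]}.
Variables (N : banach_norm V) (M : banach_norm W).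

(** The sum norm, not the one induced by the inner product: completeness and convergence become
    componentwise, and [ipn_bound] gives continuity of the inner product. *)
Definition pnorm (x : (V * W)%type) : R := N x.1 + M x.2.

Lemma pnormD x y : pnorm (x + y) <= pnorm x + pnorm y.
Proof.
rewrite /pnorm /=; have := bnormD N x.1 y.1; have := bnormD M x.2 y.2; lra.
Qed.

Lemma pnormZ l x : pnorm (l *: x) = normc l * pnorm x.
Proof. by rewrite /pnorm /= !bnormZ mulrDr. Qed.

Lemma pnorm_eq0 x : pnorm x = 0 -> x = 0.
Proof.
rewrite /pnorm => h; have := bnorm_ge0 N x.1; have := bnorm_ge0 M x.2.
case: x h => x y /= h h1 h2.
have /(bnorm_eq0 (b := N)) -> : N x = 0 by lra.
by have /(bnorm_eq0 (b := M)) -> : M y = 0 by lra.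
Qed.

Lemma pnorm_complete (u : nat -> (V * W)%type) :
  (forall e, 0 < e -> exists N, forall n m, (N <= n)%N -> (N <= m)%N ->
    pnorm (u n - u m) < e) ->
  exists l, null (fun n => pnorm (u n - l)).
Proof.
move=> cu.
have [|x hx] := @bnorm_complete _ _ N (fun n => (u n).1).
  move=> e /cu[K hK]; exists K => n m nK mK; apply: le_lt_trans (hK n m nK mK).
  by rewrite /pnorm /= lerDl bnorm_ge0.
have [|y hy] := @bnorm_complete _ _ M (fun n => (u n).2).
  move=> e /cu[K hK]; exists K => n m nK mK; apply: le_lt_trans (hK n m nK mK).
  by rewrite /pnorm /= lerDr bnorm_ge0.
by exists (x, y); apply: nullD.
Qed.

Definition product_norm := BanachNorm pnormD pnormZ pnorm_eq0 pnorm_complete.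

Lemma cvs_pair u x : cvs product_norm u x <->
  cvs N (fun n => (u n).1) x.1 /\ cvs M (fun n => (u n).2) x.2.
Proof.
split=> [h|[h1 h2]]; last exact: nullD.
by split; apply: null_le1 h => n /=; rewrite /pnorm /= ?lerDl ?lerDr bnorm_ge0.
Qed.

End ProductNorm.

Arguments bnorm : simpl never.

(** * Riemann-Stieltjes sums *)

Section RiemannStieltjes.
Context {R : realType} {V : lmodType R[i]}.
Variable N : banach_norm V.
Implicit Types (F : R -> V) (g : R -> R[i]) (G : R -> R[i]).

Definition continuous01 F := forall t, 0 <= t <= 1 -> forall e, 0 < e ->
  exists2 d, 0 < d & forall s, 0 <= s <= 1 -> `|s - t| < d -> N (F s - F t) < e.

Definition lipschitz01 G (L : R) := forall s t, 0 <= s <= 1 -> 0 <= t <= 1 ->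
  normc (G s - G t) <= L * `|s - t|.

Definition rsum G F n : V :=
  \sum_(k < n) (G (k.+1%:R / n%:R) - G (k%:R / n%:R)) *: F (k%:R / n%:R).

Lemma uniformly_continuous01 F : continuous01 F -> forall e, 0 < e ->
  exists2 d, 0 < d & forall s t, 0 <= s <= 1 -> 0 <= t <= 1 -> `|s - t| < d ->
    N (F s - F t) < e.
Proof.
move=> cF e e0.
(* With the moduli [1 / (n + 1)], uniform continuity says that [P n t] holds for all [t] and large
   [n], the form to which compactness as near-covering applies. *)
pose P (n : nat) (t : R) := forall s, 0 <= s <= 1 -> 0 <= t <= 1 ->
  `|s - t| < n.+1%:R^-1 -> N (F s - F t) < e.
have := @segment_compact R 0 1.
move=> /compact_near_coveringP/(_ nat \oo P _)[t /=|n _ hn].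
  rewrite in_itv /= => t01.
  have [d d0 hd] := cF t t01 (e / 2) ltac:(lra).
  have [K hK] := @null_harmonic R (d / 2) ltac:(lra).
  exists (ball t (d / 2), [set n | (K <= n)%N]).
    by split; [apply: nbhsx_ballx; lra|exists K].
  move=> [t' n] /= [tt' nK] s s01 t'01 st'.
  have st2 := lt_trans st' (hK n nK).
  have dt' : `|t' - t| < d / 2 by rewrite distrC; exact: tt'.
  apply: (le_lt_trans (bnorm_dist N (F t) _ _)); rewrite (bnormC _ (F t)).
  have -> : e = e / 2 + e / 2 by lra.
  apply: ltrD; apply: hd => //; last by lra.
  by rewrite (le_lt_trans (ler_distD t' _ _))//; lra.
exists (n.+1%:R^-1); first by rewrite invr_gt0.
move=> s t s01 t01 st; apply: (hn n) => //=.
Qed.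

Lemma in01 (k n : nat) : (k <= n)%N -> 0 <= (k%:R / n%:R : R) <= 1.
Proof.
move=> kn; rewrite divr_ge0//=; case: n kn => [|n] kn; first by rewrite invr0 mulr0.
by rewrite ler_pdivrMr// mul1r ler_nat.
Qed.

(** Sums over [n] and over [m] intervals are compared through [n * m] intervals. In each term the
    weight is a small increment of [G], and the two arguments of [F] are closer than [1 / n]. *)
Lemma rsum_refine G F n m : (0 < n)%N -> (0 < m)%N ->
  rsum G F n - rsum G F (n * m) =
  \sum_(k < n) \sum_(l < m)
    (G ((k * m + l).+1%:R / (n * m)%:R) - G ((k * m + l)%:R / (n * m)%:R))
      *: (F (k%:R / n%:R) - F ((k * m + l)%:R / (n * m)%:R)).
Proof.
move=> n0 m0.
have E (k : nat) : (k%:R / n%:R : R) = (k * m)%:R / (n * m)%:R.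
  by rewrite !natrM; field; rewrite !pnatr_eq0 -!lt0n n0 m0.
have -> : rsum G F (n * m) = \sum_(k < n) \sum_(l < m)
    (G ((k * m + l).+1%:R / (n * m)%:R) - G ((k * m + l)%:R / (n * m)%:R))
      *: F ((k * m + l)%:R / (n * m)%:R).
  rewrite /rsum.
  pose h (i : nat) : V := (G (i.+1%:R / (n * m)%:R) - G (i%:R / (n * m)%:R))
      *: F (i%:R / (n * m)%:R).
  rewrite -[LHS](big_mkord xpredT h) -[RHS](big_mkord xpredT (fun k => \sum_(l < m) h (k * m + l)%N)).
  move: h => h.
  elim: n {n0 E} => [|n IH]; first by rewrite mul0n !big_nil.
  rewrite big_nat_recr//= -IH mulSnr (@big_cat_nat _ _ _ (n * m)%N)//=; last exact: leq_addr.
  congr (_ + _); rewrite -{1}(add0n (n * m)%N) big_addn addKn big_mkord.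
  by apply: eq_bigr => i _; rewrite addnC.
rewrite /rsum -sumrB; apply: eq_bigr => k _.
under [RHS]eq_bigr do rewrite scalerBr.
rewrite sumrB; congr (_ - _); rewrite -scaler_suml; congr (_ *: _).
rewrite (E k) (E k.+1) mulSn.
rewrite -(big_mkord xpredT (fun l => G ((k * m + l).+1%:R / (n * m)%:R) - G ((k * m + l)%:R / (n * m)%:R))).
under eq_bigr do rewrite -addnS.
by rewrite telescope_sumr// addn0 addnC.
Qed.

Lemma rsum_cauchy G L F : 0 <= L -> lipschitz01 G L -> continuous01 F ->
  exists x, cvs N (rsum G F) x.
Proof.
move=> L0 lG cF; apply: bnorm_complete => e e0.
(* The increments of [G] sum up to at most [L]; [L + 1] also covers [L = 0] and leaves a strict
   inequality. *)
have e'0 : 0 < e / (2 * (L + 1)) by apply: divr_gt0; lra.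
have [d d0 hd] := uniformly_continuous01 cF e'0.
have [K hK] := @null_harmonic R d d0.
have key n m : (K < n)%N -> (0 < m)%N ->
    N (rsum G F n - rsum G F (n * m)) < e / 2.
  move=> nK m0; have n0 : (0 < n)%N by exact: leq_trans nK.
  rewrite rsum_refine//.
  apply: (@le_lt_trans _ _ (\sum_(k < n) \sum_(l < m)
      (L / (n * m)%:R) * (e / (2 * (L + 1))))); last first.
    rewrite !sumr_const !card_ord -[ltLHS]mulr_natr -[X in X * _]mulr_natr.
    have -> : L / (n * m)%:R * (e / (2 * (L + 1))) * m%:R * n%:R = e / 2 * (L / (L + 1)).
      rewrite natrM; field.
      by rewrite !pnatr_eq0 -!lt0n n0 m0 gt_eqF//; lra.
    by rewrite gtr_pMr ?ltr_pdivrMr; lra.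
  apply: (le_trans (bnorm_sum _ _ _ _)); apply: ler_sum => k _.
  apply: (le_trans (bnorm_sum _ _ _ _)); apply: ler_sum => l _.
  have kl : (k * m + l < n * m)%N.
    rewrite (@leq_trans (k.+1 * m))//; last by rewrite leq_mul2r ltn_ord orbT.
    by rewrite mulSnr ltn_add2l.
  have nm0 : (0 : R) < (n * m)%:R by rewrite ltr0n muln_gt0 n0.
  rewrite bnormZ; apply: ler_pM => //; rewrite ?normc_ge0 ?bnorm_ge0//.
    apply: (le_trans (lG _ _ _ _)); rewrite ?in01 ?(ltnW kl)//.
    rewrite -mulrBl -natrB// subSnn mul1r ger0_norm// invr_ge0 ltW//.
  apply/ltW/hd; rewrite ?in01 ?(ltnW kl) ?(ltnW (ltn_ord k))//.
  have -> : k%:R / n%:R - (k * m + l)%:R / (n * m)%:R = - (l%:R / m%:R / n%:R) :> R.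
    by rewrite !natrD !natrM; field; rewrite !pnatr_eq0 -!lt0n n0 m0.
  rewrite normrN ger0_norm ?divr_ge0//; apply: (@le_lt_trans _ _ n%:R^-1).
    rewrite ler_pdivrMr ?ltr0n// mulVf ?pnatr_eq0 -?lt0n//.
    by rewrite ler_pdivrMr ?ltr0n// mul1r ler_nat ltnW.
  by move: (hK n.-1); rewrite prednK//; apply; rewrite -ltnS prednK.
exists K.+1 => n m nK mK.
apply: (le_lt_trans (bnorm_dist N (rsum G F (n * m)) _ _)).
have -> : e = e / 2 + e / 2 by lra.
apply: ltrD; first by apply: key => //; exact: leq_trans mK.
by rewrite bnormC mulnC; apply: key => //; exact: leq_trans nK.
Qed.

End RiemannStieltjes.

(** * Boundedness of *-homomorphisms *)

Section CStarAlgebra.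
Context {R : realType} {A : gradedCStar R}.
Implicit Types (a b c h : A) (l : R[i]).

Definition anorm : banach_norm A := complete_norm A.

Lemma cmulDl a b c : cmul (a + b) c = cmul a c + cmul b c.
Proof. exact (@linD R A A (fun x => cmul x c) (fun l a b => cmulPl l a b c) a b). Qed.

Lemma cmulDr a b c : cmul c (a + b) = cmul c a + cmul c b.
Proof. exact (@linD R A A (cmul c) (fun l a b => cmulPr l a b c) a b). Qed.

Lemma cmulZl l a c : cmul (l *: a) c = l *: cmul a c.
Proof. exact (@linZ R A A (fun x => cmul x c) (fun l a b => cmulPl l a b c) l a). Qed.

Lemma cmulZr l a c : cmul c (l *: a) = l *: cmul c a.
Proof. exact (@linZ R A A (cmul c) (fun l a b => cmulPr l a b c) l a). Qed.

Lemma cmulNl a c : cmul (- a) c = - cmul a c.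
Proof. exact (@linN R A A (fun x => cmul x c) (fun l a b => cmulPl l a b c) a). Qed.

Lemma cmulBl a b c : cmul (a - b) c = cmul a c - cmul b c.
Proof. exact (@linB R A A (fun x => cmul x c) (fun l a b => cmulPl l a b c) a b). Qed.

Lemma cmulBr a b c : cmul c (a - b) = cmul c a - cmul c b.
Proof. exact (@linB R A A (cmul c) (fun l a b => cmulPr l a b c) a b). Qed.

Lemma cmul0l c : cmul 0 c = 0.
Proof. exact (@lin0 R A A (fun x => cmul x c) (fun l a b => cmulPl l a b c)). Qed.

Lemma cmul0r c : cmul c 0 = 0.
Proof. exact (@lin0 R A A (cmul c) (fun l a b => cmulPr l a b c)). Qed.

Lemma cadjD a b : cadj (a + b) = cadj a + cadj b.
Proof. by have := cadjP 1 a b; rewrite conjc1 !scale1r. Qed.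
Lemma cadj0 : cadj 0 = 0 :> A.
Proof. by apply: (addrI (cadj 0)); rewrite -cadjD !addr0. Qed.
Lemma cadjZ l a : cadj (l *: a) = (l^*)%C *: cadj a.
Proof. by have := cadjP l a 0; rewrite cadj0 !addr0. Qed.
Lemma cadjN a : cadj (- a) = - cadj a.
Proof. by apply/eqP; rewrite -addr_eq0 -cadjD addNr cadj0. Qed.
Lemma cadjB a b : cadj (a - b) = cadj a - cadj b.
Proof. by rewrite cadjD cadjN. Qed.

Lemma anormM a b : anorm (cmul a b) <= anorm a * anorm b.
Proof. by have := cnormM a b; rewrite !cnormE -rmorphM lecR. Qed.

Lemma anorm_cstar a : anorm (cmul (cadj a) a) = anorm a ^+ 2.
Proof. by have := cstarE a; rewrite !cnormE -rmorphXn => /complexI. Qed.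

Lemma anorm_adj a : anorm (cadj a) = anorm a.
Proof.
wlog suff W : a / anorm a <= anorm (cadj a).
  by apply/eqP; rewrite eq_le -{2}(cadjK a) !W.
have := anorm_cstar a; have := anormM (cadj a) a; have := bnorm_ge0 anorm a.
rewrite le_eqVlt => /predU1P[<-|a0]; first by rewrite bnorm_ge0.
by move=> + E; rewrite E expr2 ler_pM2r.
Qed.

Lemma cvs_cmul (u v : nat -> A) a b : cvs anorm u a -> cvs anorm v b ->
  cvs anorm (fun n => cmul (u n) (v n)) (cmul a b).
Proof.
move=> ua vb; have [K hK] := ua 1 ltr01.
have h1 : null (fun n => anorm (cmul a (v n - b)) ).
  by apply: null_le vb => [|n]; [exact: (bnorm_ge0 anorm a)|exact: anormM].
have h2 : null (fun n => anorm (cmul (u n - a) (v n - b))).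
  move=> e e0; have [M hM] := vb e e0.
  exists (maxn K M) => n; rewrite geq_max => /andP[/hK h /hM h'].
  apply: (le_lt_trans (anormM _ _)); apply: le_lt_trans h'.
  by rewrite ler_piMl ?bnorm_ge0// ltW.
have h3 : null (fun n => anorm (cmul (u n - a) b)).
  by apply: null_le ua => [|n]; [exact: (bnorm_ge0 anorm b)|rewrite mulrC; exact: anormM].
apply: null_le1 (nullD h1 (nullD h2 h3)) => n.
have -> : cmul (u n) (v n) - cmul a b = cmul a (v n - b) +
    (cmul (u n - a) (v n - b) + cmul (u n - a) b).
  have -> : cmul (u n - a) (v n - b) + cmul (u n - a) b = cmul (u n - a) (v n).
    by rewrite -cmulDr; congr (cmul _ _); exact: subrK.
  by rewrite cmulBr cmulBl [RHS]addrC subrKA.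
apply: (le_trans (bnormD _ _ _)); rewrite lerD2l; exact: bnormD.
Qed.

Lemma cvs_cadj (u : nat -> A) a : cvs anorm u a -> cvs anorm (fun n => cadj (u n)) (cadj a).
Proof. by apply: null_le1 => n; rewrite -cadjB anorm_adj. Qed.

(* [1 - s] is a square root of [1 - h^2]. *)
Lemma half_sqrt h : cadj h = h -> anorm h <= 2^-1 ->
  exists s, [/\ cadj s = s, cmul s h = cmul h s & s + s = cmul h h + cmul s s].
Proof.
(* The equation [(1 - s)^2 = 1 - h^2] reads [s = (h^2 + s^2) / 2]. On the ball of radius 1/2 the
   right hand side contracts by 1/2, because [s^2 - t^2 = s (s - t) + (s - t) t]. *)
move=> hh h2; pose f s := (2^-1 : R[i]) *: (cmul h h + cmul s s).
have N2 : normc (2^-1 : R[i]) = 2^-1.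
  have -> : (2^-1 : R[i]) = (2^-1 : R)%:C%C by rewrite fmorphV rmorph_nat.
  by rewrite normcR ger0_norm// invr_ge0.
pose P s := [/\ anorm s <= 2^-1, cadj s = s & cmul s h = cmul h s].
have [||||||s Ps fs] := @contraction_fixpoint _ _ anorm P f 2^-1.
- by lra.
- by lra.
- by split; rewrite ?cmul0l ?cmul0r ?cadj0// bnorm0; lra.
- move=> s [s2 ss sh]; split.
  + rewrite bnormZ N2; have := bnormD anorm (cmul h h) (cmul s s).
    have := anormM h h; have := anormM s s.
    have := ler_pM (bnorm_ge0 anorm h) (bnorm_ge0 anorm h) h2 h2.
    have := ler_pM (bnorm_ge0 anorm s) (bnorm_ge0 anorm s) s2 s2.
    move: (anorm (cmul h h)) (anorm (cmul s s)) (anorm h) (anorm s) => *; lra.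
  + by rewrite cadjZ cadjD !cadjM hh ss conjc_inv conjc_nat.
  + by rewrite cmulZl cmulZr cmulDl cmulDr cmulA -[cmul (cmul s s) h]cmulA sh !cmulA sh.
- move=> u s hu us; split.
  + by apply: cvs_le us => n; case: (hu n).
  + apply: (@cvs_unique _ _ anorm u) => //; apply: cvs_ext (cvs_cadj us) => n; by case: (hu n).
  + apply: (@cvs_unique _ _ anorm (fun n => cmul (u n) h)).
      by apply: cvs_cmul => //; exact: cvs_cst.
    apply: (@cvs_ext _ _ _ (fun n => cmul h (u n))); first by move=> n; case: (hu n).
    by apply: cvs_cmul => //; exact: cvs_cst.
- move=> s t [s2 _ _] [t2 _ _]; rewrite /f -scalerBr bnormZ N2.
  have -> : cmul h h + cmul s s - (cmul h h + cmul t t) = cmul s (s - t) + cmul (s - t) t.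
    by rewrite opprD addrACA subrr add0r cmulBr cmulBl addrA subrK.
  rewrite ler_pM2l ?invr_gt0//.
  have := bnormD anorm (cmul s (s - t)) (cmul (s - t) t).
  have := anormM s (s - t); have := anormM (s - t) t.
  have := ler_wpM2r (bnorm_ge0 anorm (s - t)) s2.
  have := ler_wpM2l (bnorm_ge0 anorm (s - t)) t2.
  move: (anorm (cmul s _)) (anorm (cmul _ t)) (anorm (s - t)) (anorm s) (anorm t) (anorm _) => *; lra.
exists s; case: Ps => _ ss sh; split=> //.
rewrite -{1 2}fs /f -scalerDl; have -> : 2^-1 + 2^-1 = 1 :> R[i] by field.
by rewrite scale1r.
Qed.

End CStarAlgebra.

Section StarActions.
Context {R : realType} {A : gradedCStar R} {X : lmodType R[i]}.
Variables (N : banach_norm X) (rho : A -> X -> X).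
Hypothesis rhoP : forall (l : R[i]) a b x, rho (l *: a + b) x = l *: rho a x + rho b x.
(* For [l] of modulus 1, the hypothesis says that [u + l] is an isometry in the
   unitization. *)
Hypothesis rho_unitary : forall (u : A) (l : R[i]) x,
  cmul (cadj u) u + l *: cadj u + (l^*)%C *: u = 0 -> normc l = 1 ->
  N (rho u x + l *: x) = N x.

Let rho_lin x l a b := rhoP l a b x.

(* With [1 - s] the square root of [1 - h^2], the elements [h +- i(1 - s)] are
   unitary and have mean [h]. *)
Lemma star_action_selfadjoint_half h x : cadj h = h -> anorm h <= 2^-1 ->
  N (rho h x) <= N x.
Proof.
move=> hh /(half_sqrt hh)[s [ss sh s2]].
have U (l : R[i]) : l * l = -1 -> (l^*)%C = - l -> normc l = 1 ->
    N (rho (h - l *: s) x + l *: x) = N x.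
  move=> ll lc l1; apply: rho_unitary => //; rewrite lc.
  rewrite cadjB cadjZ hh ss lc scaleNr opprK.
  have -> : cmul (h + l *: s) (h - l *: s) = cmul h h + cmul s s.
    rewrite cmulDl !cmulBr !cmulZl !cmulZr sh scalerA ll.
    by module_over R[i] A.
  rewrite -s2 scalerDr scalerA ll; module_with R[i] A ll.
have := bnormD N (rho (h - imag *: s) x + imag *: x) (rho (h - (- imag) *: s) x + (- imag) *: x).
rewrite (U imag imag_mul_imag conjc_imag normc_imag) (U (- imag)); last 3 first.
- by rewrite mulrNN imag_mul_imag.
- by rewrite -conjc_imag conjcK conjc_imag opprK.
- by rewrite normcN normc_imag.
rewrite !(@linB R A X (rho^~ x) (rho_lin x)) !(@linZ R A X (rho^~ x) (rho_lin x)).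
set y := rho s x; set z := rho h x.
have -> : z - imag *: y + imag *: x + (z - (- imag) *: y + (- imag) *: x) = 2%:R *: z.
  by module_over R[i] X.
by rewrite bnormZ -(rmorph_nat (real_complex R)) normcR normr_nat; lra.
Qed.

Lemma star_action_selfadjoint h x : cadj h = h -> N (rho h x) <= 2 * anorm h * N x.
Proof.
move=> hh; have := bnorm_ge0 anorm h.
rewrite le_eqVlt => /predU1P[/esym/(bnorm_eq0 (b := anorm)) ->|h0].
  rewrite (@lin0 R A X (rho^~ x) (rho_lin x)) !bnorm0; lra.
pose r := (2 * anorm h)^-1; have r0 : 0 < r by rewrite invr_gt0 mulr_gt0.
have := @star_action_selfadjoint_half (r%:C%C *: h) x.
rewrite cadjZ conjc_real hh bnormZ normcR ger0_norm ?(ltW r0)//.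
have -> : r * anorm h = 2^-1 by rewrite /r; field; rewrite gt_eqF.
move=> /(_ erefl (lexx _)).
rewrite (@linZ R A X (rho^~ x) (rho_lin x)) bnormZ normcR ger0_norm ?(ltW r0)//.
by rewrite /r -ler_pdivlMl ?invr_gt0 ?mulr_gt0// invrK.
Qed.

(** The real and imaginary parts of [a] have norm at most that of [a] and contribute a factor 2
    each. *)
Lemma star_action_bounded a x : N (rho a x) <= 4 * anorm a * N x.
Proof.
pose half : R[i] := (2^-1 : R)%:C%C; pose k : R[i] := Complex 0 2^-1.
have hf : half + half = 1 by rewrite -rmorphD /= -[RHS]complexr0; congr (_ +i* _)%C; lra.
have ki : imag * k = - half.
  by apply/eqP; rewrite eq_complex /= !mul0r mul1r mulr0 sub0r addr0 oppr0 !eqxx.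
have n2 : normc half = 2^-1 by rewrite normcR ger0_norm// invr_ge0.
have n3 : normc k = 2^-1 by rewrite /= expr0n /= add0r sqrtr_sqr ger0_norm// invr_ge0.
pose h1 : A := half *: (a + cadj a); pose h2 : A := k *: (cadj a - a).
have h1s : cadj h1 = h1 by rewrite /h1 cadjZ conjc_real cadjD cadjK addrC.
have h2s : cadj h2 = h2.
  rewrite /h2 cadjZ cadjB cadjK.
  have -> : (k^*)%C = - k by apply/eqP; rewrite eq_complex /= oppr0 !eqxx.
  by module_over R[i] A.
have aE : a = h1 + imag *: h2.
  by rewrite /h1 /h2 scalerA ki; module_with R[i] A hf.
have n1 : anorm h1 <= anorm a.
  by rewrite bnormZ n2; have := bnormD anorm a (cadj a); rewrite anorm_adj; lra.
have n4 : anorm h2 <= anorm a.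
  rewrite bnormZ n3; have := bnormB anorm (cadj a) a; rewrite anorm_adj; lra.
clearbody h1 h2; rewrite {1}aE (@linD R A X (rho^~ x) (rho_lin x)) (@linZ R A X (rho^~ x) (rho_lin x)).
apply: (le_trans (bnormD _ _ _)); rewrite bnormZ normc_imag mul1r.
have e1 := star_action_selfadjoint x h1s; have e2 := star_action_selfadjoint x h2s.
apply: (le_trans (lerD e1 e2)).
have := ler_wpM2r (bnorm_ge0 N x) n1; have := ler_wpM2r (bnorm_ge0 N x) n4.
lra.
Qed.

End StarActions.

(** * Hilbert modules and their finite sums *)

Lemma mul_conjc (R : realType) (l : R[i]) : l * (l^*)%C = ((normc l) ^+ 2)%:C%C.
Proof. by have := sqr_normc l; rewrite normr_normc -rmorphXn. Qed.

(** Left multiplication by [cgr b] is an action in which unitaries are isometric, by the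
    C*-identity. Applied to the vector [cadj (cgr b)] its bound reads [|cgr b|^2 <= 4 |b| |cgr b|],
    and one factor cancels. *)
Lemma cgr_bounded (R : realType) (B : gradedCStar R) (b : B) :
  anorm (cgr b) <= 4 * anorm b.
Proof.
have H (u : B) (l : R[i]) (x : B) :
    cmul (cadj u) u + l *: cadj u + (l^*)%C *: u = 0 -> normc l = 1 ->
    anorm (cmul (cgr u) x + l *: x) = anorm x.
  move=> ul l1; have cg0 : cgr 0 = 0 :> B := lin0 (@cgrP R B).
  have := congr1 (@cgr R B) ul.
  rewrite cg0 !(linD (@cgrP R B)) !(linZ (@cgrP R B)) cgrM cgr_adj => ul'.
  apply/eqP; rewrite -(@eqrXn2 _ 2) ?bnorm_ge0// -!anorm_cstar; apply/eqP; congr (anorm _).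
  move: (cgr u) ul' => v ul'.
  rewrite cadjD cadjM cadjZ cmulDl !cmulDr !cmulZl !cmulZr scalerA.
  rewrite [(l^*)%C * l]mulrC mul_conjc l1 expr1n.
  have := congr1 (fun z => cmul (cadj x) (cmul z x)) ul'.
  rewrite cmul0l cmul0r !cmulDl !cmulZl !cmulDr !cmulZr -!cmulA => E.
  rewrite -[RHS]add0r -E; module_over R[i] B.
have := @star_action_bounded _ B B anorm (fun a x => cmul (cgr a) x) _ H b (cadj (cgr b)).
have cc : anorm (cmul (cgr b) (cadj (cgr b))) = anorm (cgr b) ^+ 2.
  by rewrite -{1}(cadjK (cgr b)) anorm_cstar anorm_adj.
rewrite cc anorm_adj => /(_ _) h.
have {}h : anorm (cgr b) ^+ 2 <= 4 * anorm b * anorm (cgr b).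
  by apply: h => l a c x; rewrite cgrP cmulPl.
have := bnorm_ge0 anorm (cgr b); rewrite le_eqVlt => /predU1P[<-|c0].
  by have := bnorm_ge0 anorm b; lra.
by move: h; rewrite expr2 ler_pM2r.
Qed.

Section HilbertModules.
Context {R : realType} {B : gradedCStar R} {E : hilbertModule B}.
Implicit Types (x y z : E) (l : R[i]).

Definition enorm : banach_norm E := complete_norm E.

Lemma enorm_hip x : enorm x ^+ 2 = anorm (hip x x).
Proof. by have := hnormE x; rewrite !cnormE -rmorphXn => /complexI. Qed.

Lemma hipPl l x y z : hip (l *: x + y) z = (l^*)%C *: hip x z + hip y z.
Proof. by rewrite hipC hipP cadjD cadjZ -!hipC. Qed.

Let hip_lin x l y z := hipP l x y z.

Lemma hipDr x y z : hip x (y + z) = hip x y + hip x z.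
Proof. exact (@linD R E B (@hip R B E x) (hip_lin x) y z). Qed.
Lemma hipZr l x y : hip x (l *: y) = l *: hip x y.
Proof. exact (@linZ R E B (@hip R B E x) (hip_lin x) l y). Qed.
Lemma hip0r x : hip x 0 = 0.
Proof. exact (@lin0 R E B (@hip R B E x) (hip_lin x)). Qed.
Lemma hipDl x y z : hip (x + y) z = hip x z + hip y z.
Proof. by have := hipPl 1 x y z; rewrite conjc1 !scale1r. Qed.
Lemma hip0l x : hip 0 x = 0.
Proof. by rewrite hipC hip0r cadj0. Qed.
Lemma hipZl l x y : hip (l *: x) y = (l^*)%C *: hip x y.
Proof. by rewrite -[l *: x]addr0 hipPl hip0l addr0. Qed.

Lemma hip_nondegenerate x : (forall z, hip x z = 0) -> x = 0.
Proof.
move=> /(_ x) x0; apply: (bnorm_eq0 (b := enorm)); apply/eqP.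
by rewrite -sqrf_eq0 enorm_hip x0 bnorm0.
Qed.

(** Polarization replaces the Cauchy-Schwarz inequality, whose usual proof uses the order of [B];
    each of the four squares has norm at most [2^2]. *)
Lemma hip_unit_bound x y : enorm x = 1 -> enorm y = 1 -> anorm (hip x y) <= 4.
Proof.
move=> x1 y1.
have W (c : R[i]) : normc c = 1 -> anorm (hip (c *: x + y) (c *: x + y)) <= 4.
  move=> c1; rewrite -enorm_hip; have := bnormD enorm (c *: x) y.
  rewrite bnormZ c1 x1 y1 mul1r => h.
  have -> : 4 = 2 ^+ 2 :> R by lra.
  by rewrite ler_pXn2r ?nnegrE ?bnorm_ge0//; lra.
have E4 : 4%:R *: hip x y = hip (1 *: x + y) (1 *: x + y)
   + imag *: hip (imag *: x + y) (imag *: x + y)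
   + (-1) *: hip (- 1 *: x + y) (- 1 *: x + y)
   + (- imag) *: hip (- imag *: x + y) (- imag *: x + y).
  rewrite !hipPl !hipP conjc1 conjc_imag conjcN1.
  have -> : ((- imag : R[i])^*)%C = imag by rewrite -conjc_imag conjcK.
  module_with R[i] B (@imag_mul_imag R).
have i1 := @normc_imag R.
have n1 : normc (-1 : R[i]) = 1 by rewrite normcN normc1.
have n2 : normc (- imag : R[i]) = 1 by rewrite normcN.
have := congr1 (@anorm _ B) E4; rewrite bnormZ.
rewrite -(rmorph_nat (real_complex R)) normcR normr_nat.
have := W 1 (normc1 _); have := W imag i1; have := W (-1) n1; have := W (- imag) n2.
set p := hip (1 *: _ + _) _; set q := hip (imag *: _ + _) _.
set r := hip (-1 *: _ + _) _; set s := hip (- imag *: _ + _) _.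
have := bnormD anorm (p + imag *: q + (-1) *: r) ((- imag) *: s).
have := bnormD anorm (p + imag *: q) ((-1) *: r).
have := bnormD anorm p (imag *: q).
rewrite !bnormZ i1 n1 n2; lra.
Qed.

Lemma hip_bound x y : anorm (hip x y) <= 4 * enorm x * enorm y.
Proof.
have := bnorm_ge0 enorm x; rewrite le_eqVlt => /predU1P[/esym/(bnorm_eq0 (b := enorm)) ->|x0].
  by rewrite hip0l !bnorm0; lra.
have := bnorm_ge0 enorm y; rewrite le_eqVlt => /predU1P[/esym/(bnorm_eq0 (b := enorm)) ->|y0].
  by rewrite hip0r !bnorm0; lra.
have n (z : E) : 0 < enorm z -> enorm (((enorm z)^-1)%:C%C *: z) = 1.
  by move=> z0; rewrite bnormZ normcR ger0_norm ?invr_ge0 ?(ltW z0)// mulVf// gt_eqF.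
have := hip_unit_bound (n x x0) (n y y0).
rewrite hipZl hipZr !bnormZ conjc_real !normcR !ger0_norm ?invr_ge0 ?(ltW x0) ?(ltW y0)//.
by rewrite ler_pdivrMl// ler_pdivrMl// => /le_trans; apply; lra.
Qed.

Lemma hgr_bounded x : enorm (hgr x) <= 2 * enorm x.
Proof.
have := cgr_bounded (hip x x); rewrite -hgr_ip -!enorm_hip.
have -> : 4 * enorm x ^+ 2 = (2 * enorm x) ^+ 2 by rewrite exprMn -natrX.
by rewrite ler_pXn2r// nnegrE ?mulr_ge0 ?bnorm_ge0.
Qed.

(** This starts the induction for the holomorphic calculus: [phi] carries norm limits of Riemann
    sums in [A] to strong limits. *)
Lemma bimodule_bounded (A : gradedCStar R) (phi : A -> E -> E) (a : A) x :
  bimodule phi -> enorm (phi a x) <= 4 * anorm a * enorm x.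
Proof.
case=> phiP phiM phi_adj _; apply: star_action_bounded; first exact: phiP.
move=> u l {}x ul l1.
apply/eqP; rewrite -(@eqrXn2 _ 2) ?bnorm_ge0// !enorm_hip; apply/eqP; congr (anorm _).
have phiD b c z : phi (b + c) z = phi b z + phi c z.
  by have := phiP 1 b c z; rewrite !scale1r.
have phi0 z : phi 0 z = 0 by apply: (addrI (phi 0 z)); rewrite -phiD !addr0.
have phiZ k b z : phi (k *: b) z = k *: phi b z.
  by have := phiP k b 0 z; rewrite phi0 !addr0.
rewrite hipDl !hipDr !hipZl !hipZr scalerA [(l^*)%C * l]mulrC mul_conjc l1 expr1n.
have := congr1 (fun b => hip x (phi b x)) ul.
rewrite phi0 hip0r !phiD !phiZ phiM !hipDr !hipZr => Eq.
have adj y : hip (phi u x) y = hip x (phi (cadj u) y) := phi_adj u x y.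
rewrite !adj -[RHS]add0r -Eq; module_over R[i] B.
Qed.

End HilbertModules.

(** * Uniform boundedness for adjointable operators *)

Section UniformBoundedness.
Context {R : realType} {B : gradedCStar R} {E : hilbertModule B}.

(* Gliding hump: were [T] unbounded, some [y] would make the values
   [<T x_n, y> = <x_n, T' y>] unbounded for a sequence of unit vectors [x_n]. *)
Lemma adjoint_bounded (T T' : E -> E) :
  (forall x y, hip (T x) y = hip x (T' y)) ->
  exists2 C : R, 0 <= C & forall x, enorm (T x) <= C * enorm x.
Proof.
move=> TT'; apply: contrapT => nbd.
have T0 : T 0 = 0.
  by apply: hip_nondegenerate => z; rewrite TT' hip0l.
have TZ l x : T (l *: x) = l *: T x.
  apply/eqP; rewrite -subr_eq0; apply/eqP; apply: hip_nondegenerate => z.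
  by rewrite hipDl -scaleN1r !hipZl !TT' hipZl conjcN1 scaleN1r subrr.
(* The base 9 is matched to the constant 4 of [hip_bound]: the corrections after step [n] have total
   norm at most [9^-n / 8], so they change the [n]-th value by at most half of [t n / 9^n], and more
   than [n / 2] remains. *)
have /choice[x hx] : forall n : nat, exists x : E, enorm x = 1 /\ n%:R * 9 ^+ n < enorm (T x).
  move=> n; apply: contrapT => nx; apply: nbd.
  exists (n%:R * 9 ^+ n); first by rewrite mulr_ge0// exprn_ge0.
  move=> x; have := bnorm_ge0 enorm x.
  rewrite le_eqVlt => /predU1P[/esym/(bnorm_eq0 (b := enorm)) ->|x0].
    by rewrite T0 !bnorm0; lra.
  rewrite leNgt; apply/negP => h; apply: nx.
  exists (((enorm x)^-1)%:C%C *: x); rewrite TZ !bnormZ normcR ger0_norm ?invr_ge0 ?(ltW x0)//.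
  by rewrite mulVf ?gt_eqF// ltr_pdivlMl// mulrC.
pose t n := enorm (T (x n)).
have t0 n : 0 < t n.
  by case: (hx n) => _; apply: le_lt_trans; rewrite mulr_ge0// exprn_ge0.
have p9 n : 0 < 9 ^+ n :> R by rewrite exprn_gt0.
pose xi n := ((9 ^+ n * t n)^-1)%:C%C *: T (x n).
have nxi n : enorm (xi n) = 9^-1 ^+ n.
  rewrite bnormZ normcR ger0_norm ?invr_ge0 ?mulr_ge0 ?ltW//.
  rewrite -/(t n) invfM -mulrA mulVf ?gt_eqF// mulr1 exprVn//.
have hxi n : anorm (hip (T (x n)) (xi n)) = t n / 9 ^+ n.
  rewrite hipZr bnormZ normcR -enorm_hip -/(t n) ger0_norm ?invr_ge0 ?mulr_ge0 ?ltW//.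
  by rewrite invfM expr2 mulrA mulfVK ?gt_eqF// mulrC.
clearbody xi.
(* The values at [y + xi n] and [y - xi n] differ by [2 <T x_n, xi_n>], so one of them has norm at
   least [t n / 9^n]. *)
pose step n (y : E) := if t n / 9 ^+ n <= anorm (hip (T (x n)) (y + xi n))
  then y + xi n else y - xi n.
have hstep n y : t n / 9 ^+ n <= anorm (hip (T (x n)) (step n y)).
  rewrite /step; case: ifPn => //; rewrite -ltNge => lt.
  have E2 : 2%:R *: hip (T (x n)) (xi n) =
      hip (T (x n)) (y + xi n) + (- 1) *: hip (T (x n)) (y - xi n).
    rewrite -(scaleN1r (xi n)) !hipDr hipZr; module_over R[i] B.
  have := congr1 (@anorm _ B) E2; rewrite bnormZ hxi -(rmorph_nat (real_complex R)) normcR normr_nat.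
  have := bnormD anorm (hip (T (x n)) (y + xi n)) (-1 *: hip (T (x n)) (y - xi n)).
  by rewrite bnormZ normcN normc1; lra.
pose y := fix y n : E := if n is m.+1 then step m (y m) else 0.
have [||n|z [_ hz]] := @cvs_geometric _ _ (@enorm _ _ E) y 1 9^-1.
- by lra.
- by lra.
- rewrite -[y n.+1]/(step n (y n)) /step mul1r; case: ifP => _.
    by rewrite addrAC subrr add0r nxi.
  by rewrite addrAC subrr add0r bnormN nxi.
have [n hn] : exists n : nat, 8 * enorm (T' z) < n%:R.
  by exists (Num.truncn (8 * enorm (T' z))).+1; exact: truncnS_gt.
have [xn1 hxn] := hx n.
have := hip_bound (x n) (T' z); rewrite -TT' xn1 mulr1 => h1.
have := hstep n (y n); rewrite -[step n _]/(y n.+1) => h2.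
have h3 := hz n.+1.
have := bnormD anorm (hip (T (x n)) z) (hip (T (x n)) (y n.+1 - z)).
rewrite -hipDr addrC subrK => h4.
have := hip_bound (T (x n)) (y n.+1 - z); rewrite bnormC -/(t n) => h5.
have h6 : 4 * t n * enorm (z - y n.+1) <= 2^-1 * (t n / 9 ^+ n).
  apply: (@le_trans _ _ (4 * t n * (1 * 9^-1 ^+ n.+1 / (1 - 9^-1)))).
    by rewrite ler_pM2l// mulr_gt0.
  rewrite exprS exprVn le_eqVlt; apply/orP; left; apply/eqP.
  by field; rewrite gt_eqF.
have h7 : n%:R < t n / 9 ^+ n by rewrite ltr_pdivlMr.
by clear -h1 h2 h4 h5 h6 h7 hn; lra.
Qed.

End UniformBoundedness.

(** * Inner products, gradings and adjointable operators on finite sums *)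

Section SumModule.
Context {R : realType} {B : gradedCStar R}.
Variable E : hilbertModule B.
Implicit Types (i : nat) (l : R[i]).

Fixpoint hnorm i : banach_norm (hpow E i) :=
  match i return banach_norm (hpow E i) with
  | 0 => enorm
  | j.+1 => product_norm (hnorm j) (hnorm j)
  end.

Lemma hnormS i x : hnorm i.+1 x = hnorm i x.1 + hnorm i x.2.
Proof. by []. Qed.

Lemma ipnP i l (x y z : hpow E i) : ipn x (l *: y + z) = l *: ipn x y + ipn x z.
Proof.
elim: i x y z => [|i IH] x y z /=; first exact: hipP.
by rewrite !IH scalerDr addrACA.
Qed.

Lemma ipnC i (x y : hpow E i) : ipn y x = cadj (ipn x y).
Proof.
elim: i x y => [|i IH] x y /=; first exact: hipC.
by rewrite cadjD -!IH.
Qed.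

Lemma ipnPl i l (x y z : hpow E i) :
  ipn (l *: x + y) z = (l^*)%C *: ipn x z + ipn y z.
Proof. by rewrite ipnC ipnP cadjD cadjZ -!ipnC. Qed.

Let ipn_lin i x l y z := @ipnP i l x y z.

Lemma ipnDr i (x y z : hpow E i) : ipn x (y + z) = ipn x y + ipn x z.
Proof. exact (@linD R (hpow E i) B (@ipn R B E i x) (@ipn_lin i x) y z). Qed.
Lemma ipnZr i l (x y : hpow E i) : ipn x (l *: y) = l *: ipn x y.
Proof. exact (@linZ R (hpow E i) B (@ipn R B E i x) (@ipn_lin i x) l y). Qed.
Lemma ipnBr i (x y z : hpow E i) : ipn x (y - z) = ipn x y - ipn x z.
Proof. exact (@linB R (hpow E i) B (@ipn R B E i x) (@ipn_lin i x) y z). Qed.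
Lemma ipn0r i (x : hpow E i) : ipn x 0 = 0.
Proof. exact (@lin0 R (hpow E i) B (@ipn R B E i x) (@ipn_lin i x)). Qed.
Lemma ipnBl i (x y z : hpow E i) : ipn (x - y) z = ipn x z - ipn y z.
Proof. by rewrite ipnC ipnBr cadjB -!ipnC. Qed.
Lemma ipn0l i (x : hpow E i) : ipn 0 x = 0.
Proof. by rewrite ipnC ipn0r cadj0. Qed.
Lemma ipnZl i l (x y : hpow E i) : ipn (l *: x) y = (l^*)%C *: ipn x y.
Proof. by rewrite -[l *: x]addr0 ipnPl ipn0l addr0. Qed.
Lemma ipnDl i (x y z : hpow E i) : ipn (x + y) z = ipn x z + ipn y z.
Proof. by have := ipnPl 1 x y z; rewrite conjc1 !scale1r. Qed.
Lemma ipnNr i (x y : hpow E i) : ipn x (- y) = - ipn x y.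
Proof. exact (@linN R (hpow E i) B (@ipn R B E i x) (@ipn_lin i x) y). Qed.
Lemma ipnNl i (x y : hpow E i) : ipn (- x) y = - ipn x y.
Proof. by rewrite ipnC ipnNr cadjN -!ipnC. Qed.

Lemma ipn_nondegenerate i (x : hpow E i) : (forall z, ipn x z = 0) -> x = 0.
Proof.
elim: i x => [|i IH] x /= h; first exact: hip_nondegenerate.
case: x h => x y h; congr pair; apply: IH => z.
  by have := h (z, 0); rewrite /= ipn0r addr0.
by have := h (0, z); rewrite /= ipn0r add0r.
Qed.

Lemma ipn_inj i (x y : hpow E i) : (forall z, ipn x z = ipn y z) -> x = y.
Proof.
move=> h; apply/eqP; rewrite -subr_eq0; apply/eqP; apply: ipn_nondegenerate => z.
by rewrite ipnBl h subrr.
Qed.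

Lemma ipn_injr i (x y : hpow E i) : (forall z, ipn z x = ipn z y) -> x = y.
Proof. by move=> h; apply: ipn_inj => z; rewrite ipnC h -ipnC. Qed.

Lemma ipn_bound i (x y : hpow E i) :
  anorm (ipn x y) <= 4 * hnorm i x * hnorm i y.
Proof.
elim: i x y => [|i IH] x y /=; first exact: hip_bound.
apply: (le_trans (bnormD _ _ _)); apply: (le_trans (lerD (IH _ _) (IH _ _))).
rewrite !hnormS; have := bnorm_ge0 (hnorm i) x.1; have := bnorm_ge0 (hnorm i) y.1.
have := bnorm_ge0 (hnorm i) x.2; have := bnorm_ge0 (hnorm i) y.2.
move: (hnorm i _) (hnorm i _) (hnorm i _) (hnorm i _) => a b c d a0 b0 c0 d0.
have := mulr_ge0 b0 c0; have := mulr_ge0 d0 a0; have := mulr_ge0 d0 c0; have := mulr_ge0 b0 a0.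
by nra.
Qed.

Lemma cvs_ipnl i (u : nat -> hpow E i) x y : cvs (hnorm i) u x ->
  cvs anorm (fun n => ipn (u n) y) (ipn x y).
Proof.
apply: (@null_le _ (4 * hnorm i y)) => [|n]; first by rewrite mulr_ge0 ?bnorm_ge0.
by rewrite -ipnBl (le_trans (ipn_bound _ _))// mulrAC.
Qed.

Lemma cvs_ipnr i (u : nat -> hpow E i) x y : cvs (hnorm i) u x ->
  cvs anorm (fun n => ipn y (u n)) (ipn y x).
Proof.
move=> /(cvs_ipnl y)/cvs_cadj; rewrite -ipnC; apply: cvs_ext => n.
by rewrite -ipnC.
Qed.

Lemma grnP i l (x y : hpow E i) : grn (l *: x + y) = l *: grn x + grn y.
Proof.
elim: i x y => [|i IH] x y /=; first exact: hgrP.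
by rewrite !IH opprD -scalerN.
Qed.

Lemma grnK i : involutive (@grn R B E i).
Proof.
elim: i => [|i IH] x /=; first exact: hgrK.
rewrite IH; case: x => x y /=; congr pair.
by rewrite (linN (@grnP i)) opprK IH.
Qed.

Lemma grn_ip i (x y : hpow E i) : ipn (grn x) (grn y) = cgr (ipn x y).
Proof.
elim: i x y => [|i IH] x y /=; first exact: hgr_ip.
by rewrite ipnNr ipnNl opprK !IH (linD (@cgrP R B)).
Qed.

Lemma grn_bounded i (x : hpow E i) : hnorm i (grn x) <= 2 * hnorm i x.
Proof.
elim: i x => [|i IH] x; first exact: hgr_bounded.
by rewrite !hnormS /= bnormN mulrDr lerD.
Qed.

Lemma cvs_grn i (u : nat -> hpow E i) x : cvs (hnorm i) u x ->
  cvs (hnorm i) (fun n => grn (u n)) (grn x).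
Proof.
by apply: (@null_le _ 2) => // n; rewrite -(linB (@grnP i)) grn_bounded.
Qed.

Lemma is_adjoint_sym i (T T' : hpow E i -> hpow E i) :
  is_adjoint E i T T' -> is_adjoint E i T' T.
Proof. by move=> h x y; rewrite ipnC -h -ipnC. Qed.

Lemma is_adjointP i (T T' : hpow E i -> hpow E i) : is_adjoint E i T T' ->
  forall l x y, T (l *: x + y) = l *: T x + T y.
Proof.
by move=> h l x y; apply: ipn_inj => z; rewrite ipnPl !h ipnPl.
Qed.

Lemma adjointableP i (T : hpow E i -> hpow E i) : adjointable E i T ->
  forall l x y, T (l *: x + y) = l *: T x + T y.
Proof. by case=> T' /is_adjointP. Qed.

Lemma is_adjoint_id i : is_adjoint E i id id.
Proof. by []. Qed.

Lemma is_adjoint_comp i (S S' T T' : hpow E i -> hpow E i) :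
  is_adjoint E i S S' -> is_adjoint E i T T' ->
  is_adjoint E i (fun x => S (T x)) (fun x => T' (S' x)).
Proof. by move=> hS hT x y; rewrite hS hT. Qed.

Lemma is_adjoint_lin i l (S S' T T' : hpow E i -> hpow E i) :
  is_adjoint E i S S' -> is_adjoint E i T T' ->
  is_adjoint E i (fun x => l *: S x + T x) (fun x => (l^*)%C *: S' x + T' x).
Proof. by move=> hS hT x y; rewrite ipnPl ipnP hS hT. Qed.

Lemma is_adjoint_grn i (T T' : hpow E i -> hpow E i) : is_adjoint E i T T' ->
  is_adjoint E i (fun x => grn (T (grn x))) (fun x => grn (T' (grn x))).
Proof. by move=> h x y; rewrite -{1}(grnK y) grn_ip h -{2}(grnK x) grn_ip. Qed.

Lemma adjointable_id i : adjointable E i id.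
Proof. by exists id. Qed.

Lemma adjointable_comp i (S T : hpow E i -> hpow E i) :
  adjointable E i S -> adjointable E i T -> adjointable E i (fun x => S (T x)).
Proof. by move=> [S' hS] [T' hT]; eexists; apply: is_adjoint_comp; eassumption. Qed.

Lemma adjointable_lin i l (S T : hpow E i -> hpow E i) :
  adjointable E i S -> adjointable E i T -> adjointable E i (fun x => l *: S x + T x).
Proof. by move=> [S' hS] [T' hT]; eexists; apply: is_adjoint_lin; eassumption. Qed.

Lemma adjointable_add i (S T : hpow E i -> hpow E i) :
  adjointable E i S -> adjointable E i T -> adjointable E i (fun x => S x + T x).
Proof.
by move=> hS hT; have := adjointable_lin 1 hS hT; under eq_fun do rewrite scale1r.
Qed.

Lemma adjointable_scale i l (S : hpow E i -> hpow E i) :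
  adjointable E i S -> adjointable E i (fun x => l *: S x).
Proof. by move=> [S' hS]; exists (fun x => (l^*)%C *: S' x) => x y; rewrite ipnZl ipnZr hS. Qed.

Lemma adjointable_sub i (S T : hpow E i -> hpow E i) :
  adjointable E i S -> adjointable E i T -> adjointable E i (fun x => S x - T x).
Proof.
move=> hS hT; have := adjointable_lin (-1) hT hS.
by under eq_fun do rewrite scaleN1r addrC.
Qed.

Lemma adjointable_grn i (T : hpow E i -> hpow E i) :
  adjointable E i T -> adjointable E i (fun x => grn (T (grn x))).
Proof. by move=> [T' hT]; eexists; apply: is_adjoint_grn; eassumption. Qed.

(** The gliding hump is run on [E] only; on a doubled module the four matrix entries are
    adjointable, with the transposed entries of the adjoint. *)
Lemma adjointable_bounded i (T : hpow E i -> hpow E i) : adjointable E i T ->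
  exists2 C : R, 0 <= C & forall x, hnorm i (T x) <= C * hnorm i x.
Proof.
elim: i T => [|i IH] T [T' TT']; first exact: adjoint_bounded TT'.
have TP := is_adjointP TT'.
have b11 : adjointable E i (fun x => (T (x, 0)).1).
  exists (fun x => (T' (x, 0)).1) => x y; have := TT' (x, 0) (y, 0).
  by rewrite /= ipn0r ipn0l !addr0.
have b12 : adjointable E i (fun x => (T (x, 0)).2).
  exists (fun x => (T' (0, x)).1) => x y; have := TT' (x, 0) (0, y).
  by rewrite /= ipn0r ipn0l !addr0 !add0r.
have b21 : adjointable E i (fun x => (T (0, x)).1).
  exists (fun x => (T' (x, 0)).2) => x y; have := TT' (0, x) (y, 0).
  by rewrite /= ipn0r ipn0l !addr0 !add0r.
have b22 : adjointable E i (fun x => (T (0, x)).2).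
  exists (fun x => (T' (0, x)).2) => x y; have := TT' (0, x) (0, y).
  by rewrite /= ipn0r ipn0l !add0r.
have [C1 C10 h1] := IH _ b11; have [C2 C20 h2] := IH _ b12.
have [C3 C30 h3] := IH _ b21; have [C4 C40 h4] := IH _ b22.
exists (C1 + C2 + C3 + C4) => [|[x y]]; first by rewrite !addr_ge0.
have -> : T (x, y) = T (x, 0) + T (0, y).
  by rewrite -(linD TP) /=; congr (T _); congr pair; rewrite ?addr0 ?add0r.
apply: (le_trans (bnormD _ _ _)); rewrite !hnormS /=.
have := h1 x; have := h2 x; have := h3 y; have := h4 y.
have := bnorm_ge0 (hnorm i) x; have := bnorm_ge0 (hnorm i) y.
move: (hnorm i _) (hnorm i _) (hnorm i _) (hnorm i _) (hnorm i x) (hnorm i y) => *; nra.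
Qed.

Lemma cvs_adjointable i (T : hpow E i -> hpow E i) (u : nat -> hpow E i) x :
  adjointable E i T -> cvs (hnorm i) u x ->
  cvs (hnorm i) (fun n => T (u n)) (T x).
Proof.
move=> aT; have [C C0 hC] := adjointable_bounded aT.
by apply: (null_le C0) => n; rewrite -(linB (adjointableP aT)).
Qed.

End SumModule.

(** * Selfadjoint regular operators *)

Lemma dense_approx (R : realType) (V : completeNormedModType R[i]) (S : set V) :
  dense S -> forall x (e : R), 0 < e -> exists2 y, S y & complete_norm V (x - y) < e.
Proof.
move=> dS x e e0.
have e0' : 0 < e%:C%C by rewrite ltcR.
have [||y [xy Sy]] := dS (ball x e%:C%C).
- by exists x; exact: ballxx.
- exact: ball_open.
- by exists y => //; move: xy; rewrite -ball_normE /= cnormE ltcR.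
Qed.

Section SelfadjointRegular.
Context {R : realType} {B : gradedCStar R} {E : hilbertModule B}.
Variable D : partialOp E.
Hypotheses (saD : selfadjoint_op D) (regD : regular_op D).
Implicit Types (x y z : E) (c l : R[i]).

Lemma dom_lin l x y : pdom D x -> pdom D y ->
  pdom D (l *: x + y) /\ D (l *: x + y) = l *: D x + D y.
Proof. by case: regD => [[_ h _] _ _ _ _]; exact: h. Qed.

Lemma dom0 : pdom D 0. Proof. by case: regD => [[]]. Qed.

Lemma D0 : D 0 = 0.
Proof.
have [_] := dom_lin 1 dom0 dom0; rewrite !scale1r addr0 => /eqP.
by rewrite -subr_eq subrr => /eqP.
Qed.

Lemma domD x y : pdom D x -> pdom D y -> pdom D (x + y).
Proof. by move=> hx hy; have [] := dom_lin 1 hx hy; rewrite scale1r. Qed.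

Lemma DD x y : pdom D x -> pdom D y -> D (x + y) = D x + D y.
Proof. by move=> hx hy; have [_] := dom_lin 1 hx hy; rewrite !scale1r. Qed.

Lemma domZ l x : pdom D x -> pdom D (l *: x).
Proof. by move=> hx; have [] := dom_lin l hx dom0; rewrite addr0. Qed.

Lemma DZ l x : pdom D x -> D (l *: x) = l *: D x.
Proof. by move=> hx; have [_] := dom_lin l hx dom0; rewrite D0 !addr0. Qed.

Lemma domB x y : pdom D x -> pdom D y -> pdom D (x - y).
Proof. by move=> hx hy; rewrite -scaleN1r; apply: domD => //; exact: domZ. Qed.

Lemma DB x y : pdom D x -> pdom D y -> D (x - y) = D x - D y.
Proof.
move=> hx hy; have := domZ (-1) hy; have := DZ (-1) hy.
by rewrite !scaleN1r => DN hN; rewrite DD// DN.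
Qed.

Lemma D_selfadjoint y z :
  (forall x, pdom D x -> hip (D x) y = hip x z) -> pdom D y /\ D y = z.
Proof.
move=> h; have : adj_graph D (y, z) by [].
by rewrite saD => -[/= hy ->].
Qed.

Lemma D_symmetric x y : pdom D x -> pdom D y -> hip (D x) y = hip x (D y).
Proof.
move=> hx hy; have : pgraph D (y, D y) by [].
by rewrite -saD => /(_ x hx).
Qed.

(** Adjoints are closed, since the defining equation survives limits. *)
Lemma D_closed (u : nat -> E) y z : (forall n, pdom D (u n)) ->
  cvs enorm u y -> cvs enorm (fun n => D (u n)) z -> pdom D y /\ D y = z.
Proof.
move=> hu uy uz; apply: D_selfadjoint => x hx.
apply: (@cvs_unique _ _ anorm (fun n => hip (D x) (u n))).
  exact: (@cvs_ipnr _ _ E 0).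
by under eq_fun do rewrite D_symmetric//; exact: (@cvs_ipnr _ _ E 0).
Qed.

Lemma imaginary_shift_norm c x : (c^*)%C = - c -> pdom D x ->
  enorm (x + c *: D x) = enorm (x - c *: D x).
Proof.
move=> cc hx; apply/eqP; rewrite -(@eqrXn2 _ 2) ?bnorm_ge0// !enorm_hip; apply/eqP.
congr (anorm _); rewrite -scaleNr !hipDl !hipDr !hipZl !hipZr conjcN cc (D_symmetric hx hx).
by module_over R[i] B.
Qed.

(* [x] and [c D x] are half the sum and half the difference of [(1 + cD) x] and
   [(1 - cD) x], which have the same norm. This avoids the order of [B]. *)
Lemma imaginary_shift_bound c x : (c^*)%C = - c -> pdom D x ->
  enorm x <= enorm (x + c *: D x) /\ normc c * enorm (D x) <= enorm (x + c *: D x).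
Proof.
move=> cc hx; have E1 := imaginary_shift_norm cc hx.
have n2 : normc (2%:R : R[i]) = 2 by rewrite -(rmorph_nat (real_complex R)) normcR normr_nat.
have h1 : 2%:R *: x = (x + c *: D x) + (x - c *: D x) by module_over R[i] E.
have h2 : 2%:R *: (c *: D x) = (x + c *: D x) - (x - c *: D x) by module_over R[i] E.
have := congr1 (@enorm _ _ E) h1; have := congr1 (@enorm _ _ E) h2.
have := bnormD enorm (x + c *: D x) (x - c *: D x).
have := bnormB enorm (x + c *: D x) (x - c *: D x).
rewrite !bnormZ n2 -E1; move: (enorm x) (normc c * _) => *; split; lra.
Qed.

Definition shift_onto c := forall y, exists2 x, pdom D x & x + c *: D x = y.

(** For [c = i] or [c = -i] one has [(1 + cD)(1 - cD) = 1 + D^2], which has dense range by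
    regularity. The range of [1 + cD] is closed because [imaginary_shift_bound] makes both [u n] and
    [D (u n)] Cauchy. *)
Lemma shift_onto_unit c : (c^*)%C = - c -> c * c = - 1 -> shift_onto c.
Proof.
move=> cc c2 y.
have dr : dense [set w | exists x z, [/\ pdom D x, adj_graph D (D x, z) & w = x + z]].
  by case: regD.
have /choice[u hu] : forall n : nat, exists u, pdom D u /\ enorm (y - (u + c *: D u)) < n.+1%:R^-1.
  move=> n; have [|w [x [z [hx]]]] := dense_approx dr y (e := n.+1%:R^-1).
    by rewrite invr_gt0.
  rewrite saD => -[/= hDx ->] -> h.
  have h' := domZ (- c) hDx.
  exists (x + (- c) *: D x); split; first exact: domD.
  rewrite DD// DZ//.
  suff -> : x + - c *: D x + c *: (D x + - c *: D (D x)) = x + D (D x) by [].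
  by module_with R[i] E c2.
pose w n := u n + c *: D (u n).
have wy : cvs enorm w y.
  by apply: null_le1 (@null_harmonic R) => n; rewrite bnormC ltW//; case: (hu n).
have c1 : normc c = 1.
  have := mul_conjc c; rewrite cc mulrN c2 opprK => /esym/complexI/eqP.
  by rewrite sqrp_eq1 ?normc_ge0// => /eqP.
have cau (v : nat -> E) : (forall n m, enorm (v n - v m) <= enorm (w n - w m)) ->
    exists x, cvs enorm v x.
  move=> hv; apply: bnorm_complete => e e0.
  have [K hK] := wy _ (divr_gt0 e0 (ltr0Sn _ 1)).
  exists K => n m /hK hn /hK hm; apply: (le_lt_trans (hv n m)).
  by apply: (le_lt_trans (bnorm_dist _ y _ _)); rewrite (bnormC _ y); lra.
have wB n m : [/\ pdom D (u n - u m), D (u n - u m) = D (u n) - D (u m) &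
    (u n - u m) + c *: D (u n - u m) = w n - w m].
  have [hn _] := hu n; have [hm _] := hu m.
  rewrite DB//; split=> //; first exact: domB.
  by rewrite /w; module_over R[i] E.
have [x ux] : exists x, cvs enorm u x.
  by apply: cau => n m; have [h _ <-] := wB n m; exact: (imaginary_shift_bound cc h).1.
have [z uz] : exists z, cvs enorm (fun n => D (u n)) z.
  apply: cau => n m; have [h <- <-] := wB n m.
  by have := (imaginary_shift_bound cc h).2; rewrite c1 mul1r.
have [hx Dx] := D_closed (fun n => (hu n).1) ux uz.
exists x => //; apply: (@cvs_unique _ _ enorm w) => //.
by rewrite Dx; apply: cvsD => //; exact: cvsZ.
Qed.

(* With the factor 2/3 the equation becomes a fixed point problem for a map that
   contracts distances by 1/2. *)
Lemma shift_onto_scale c : (c^*)%C = - c -> shift_onto c ->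
  shift_onto ((2 / 3 : R)%:C%C * c).
Proof.
move=> cc sc y; pose k : R[i] := (2 / 3 : R)%:C%C; pose k' : R[i] := (3 / 2 : R)%:C%C.
pose h : R[i] := (1 / 2 : R)%:C%C.
have kk : k * k' = 1 by rewrite /k /k' -rmorphM /= -[RHS]complexr0; congr (_ +i* _)%C; lra.
have kh : (1 - k) * k' = h.
  by rewrite /k /k' /h -[1](rmorph1 (real_complex R)) -rmorphB -rmorphM /=; congr (_ +i* _)%C; lra.
have /choice[M hM] : forall z, exists x, pdom D x /\ x + c *: D x = z.
  by move=> z; have [x hx E1] := sc z; exists x.
have MB z w : enorm (M z - M w) <= enorm (z - w).
  have [hz E1] := hM z; have [hw E2] := hM w.
  have := (imaginary_shift_bound cc (domB hz hw)).1; rewrite DB//.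
  suff -> : M z - M w + c *: (D (M z) - D (M w)) = z - w by [].
  by rewrite -[in RHS]E1 -[in RHS]E2; module_over R[i] E.
(* With [z = (1 + cD) x], so that [x = M z], the equation [x + k c D x = y] becomes
   [k z + (1 - k) M z = y], that is [z = k' y - h M z]. *)
have [||||||x _ fx] := @contraction_fixpoint _ _ (@enorm _ _ E) setT
    (fun z => k' *: y - h *: M z) (1 / 2).
- by lra.
- by lra.
- by [].
- by [].
- by [].
- move=> a b _ _.
  have -> : k' *: y - h *: M a - (k' *: y - h *: M b) = h *: (M b - M a) by module_over R[i] E.
  rewrite bnormZ normcR ger0_norm; last by lra.
  by rewrite ler_pM2l ?(bnormC _ a)//; lra.
have [hx E1] := hM x; exists (M x) => //.
have h1 : k *: x = y - (1 - k) *: M x.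
  rewrite -{1}fx -kh; rewrite scalerBr !scalerA kk scale1r.
  by congr (_ - _ *: _); rewrite mulrCA kk mulr1.
rewrite -/k; apply: (@eq_trans _ _ (k *: (M x + c *: D (M x)) + (1 - k) *: M x)).
  by module_over R[i] E.
by rewrite E1 h1 subrK.
Qed.

End SelfadjointRegular.

Section Resolvents.
Context {R : realType} {B : gradedCStar R} {E : hilbertModule B}.
Variable D : partialOp E.
Hypotheses (saD : selfadjoint_op D) (regD : regular_op D).
Implicit Types (x y z : E) (c l : R[i]).

Definition skew_onto c := (c^*)%C = - c /\ shift_onto D c.

(** The numbers [i e_n] with [e_n = (2/3)^n]: starting from [c = i], [shift_onto_scale] passes from
    each one to the next. *)
Definition eps (n : nat) : R[i] := ((2 / 3 : R) ^+ n)%:C%C * imag.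

Lemma epsN_skew_onto n : skew_onto (eps n) /\ skew_onto (- eps n).
Proof.
have sc n' : ((eps n')^*)%C = - eps n'.
  by rewrite /eps conjcM conjc_real conjc_imag mulrN.
have scN n' : ((- eps n')^*)%C = - - eps n' by rewrite conjcN sc.
elim: n => [|n [[_ IH1] [_ IH2]]].
  by split; split => //; apply: shift_onto_unit => //;
    rewrite /eps expr0 mul1r ?mulrNN imag_mul_imag.
have E1 : eps n.+1 = (2 / 3 : R)%:C%C * eps n by rewrite /eps exprS rmorphM mulrA.
split; split => //; first by rewrite E1; exact: shift_onto_scale.
by rewrite E1 -mulrN; exact: shift_onto_scale.
Qed.

Definition shift_inv c x : E := xget 0 [set y | pdom D y /\ y + c *: D y = x].

Lemma shift_invP c x : skew_onto c ->
  pdom D (shift_inv c x) /\ shift_inv c x + c *: D (shift_inv c x) = x.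
Proof.
move=> [_ /(_ x)[y hy Ey]]; rewrite /shift_inv.
by case: xgetP => [z _ //|/(_ y)[]].
Qed.

Lemma shift_inv_uniq c y : skew_onto c -> pdom D y -> shift_inv c (y + c *: D y) = y.
Proof.
move=> sc hy; have [hz Ez] := shift_invP (y + c *: D y) sc.
set z := shift_inv _ _ in hz Ez *.
apply/eqP; rewrite -subr_eq0; apply/eqP/(bnorm_eq0 (b := enorm)).
apply/eqP; rewrite eq_le bnorm_ge0 andbT.
have := (imaginary_shift_bound saD sc.1 (domB regD hz hy)).1.
rewrite (DB regD)//.
have -> : z - y + c *: (D z - D y) = (z + c *: D z) - (y + c *: D y) by module_over R[i] E.
by rewrite Ez subrr bnorm0.
Qed.

Lemma shift_inv_bound c x : skew_onto c -> enorm (shift_inv c x) <= enorm x.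
Proof.
move=> sc; have [hz Ez] := shift_invP x sc.
by have := (imaginary_shift_bound saD sc.1 hz).1; rewrite Ez.
Qed.

Lemma shift_inv_lin c : skew_onto c -> forall l x y,
  shift_inv c (l *: x + y) = l *: shift_inv c x + shift_inv c y.
Proof.
move=> sc l x y; have [hx Ex] := shift_invP x sc; have [hy Ey] := shift_invP y sc.
rewrite -{1}Ex -{1}Ey; have [h Dh] := dom_lin regD l hx hy.
rewrite -[RHS](shift_inv_uniq sc h) Dh; congr (shift_inv c _).
by module_over R[i] E.
Qed.

Lemma shift_inv_D c x : skew_onto c -> pdom D x ->
  D (shift_inv c x) = shift_inv c (D x).
Proof.
move=> sc hx; have [hy Ey] := shift_invP x sc.
set y := shift_inv c x in hy Ey *.
case: (eqVneq c 0) => [c0|c0].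
  rewrite c0 scale0r addr0 in Ey; rewrite Ey.
  have [h] := shift_invP (D x) sc; by rewrite c0 scale0r addr0 => ->.
have hDy : pdom D (D y).
  have -> : D y = c^-1 *: (x - y) by rewrite -Ey addrAC subrr add0r scalerA mulVf// scale1r.
  by apply: domZ => //; exact: domB.
rewrite -[LHS](shift_inv_uniq sc hDy); congr (shift_inv c _).
by rewrite -[in RHS]Ey (DD regD) ?(DZ regD)//; exact: domZ.
Qed.

(* Convergence on the domain follows from [(1 + cD)^-1 x - x = - c (1 + cD)^-1 D x],
   and the operators are uniformly bounded. *)
Lemma shift_inv_cvs (s : R[i]) x : normc s = 1 ->
  (forall n, skew_onto (s * eps n)) ->
  cvs enorm (fun n => shift_inv (s * eps n) x) x.
Proof.
move=> s1 sc e e0; have dD : dense (pdom D) by case: regD.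
have e3 : 0 < e / 3 by lra.
have [y hy xy] := dense_approx dD x e3.
have nul : null (fun n => enorm (D y) * (2 / 3 : R) ^+ n).
  by apply: null_geometric; lra.
have [K hK] := nul _ e3; exists K => n /hK hn.
set c := s * eps n; have hc : skew_onto c := sc n.
have [hz Ez] := shift_invP y hc.
have E1 : enorm (shift_inv c y - y) <= enorm (D y) * (2 / 3 : R) ^+ n.
  rewrite -{2}Ez opprD addrA subrr add0r bnormN bnormZ shift_inv_D//.
  rewrite normcM s1 mul1r normcM normc_imag mulr1 normcR ger0_norm ?exprn_ge0//.
  by rewrite mulrC ler_wpM2r ?exprn_ge0 ?shift_inv_bound//.
have E2 : enorm (shift_inv c x - shift_inv c y) <= enorm (x - y).
  by rewrite -(linB (shift_inv_lin hc)) shift_inv_bound.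
have := bnorm_dist enorm (shift_inv c y) (shift_inv c x) x.
have := bnorm_dist enorm y (shift_inv c y) x; rewrite (bnormC _ y x).
rewrite -/enorm in xy; lra.
Qed.

Lemma skew_onto_imag : skew_onto imag /\ skew_onto (- imag).
Proof. by have := epsN_skew_onto 0; rewrite /eps expr0 mul1r. Qed.

(** The factorization [1 + D^2 = (1 - iD)(1 + iD)] leaves one solution only, which identifies the
    value chosen by [xget]. *)
Lemma resolvent_uniq x y : pdom D y -> pdom D (D y) -> y + D (D y) = x ->
  resolvent D x = y.
Proof.
move=> hy hDy Ey; have [s1 s2] := skew_onto_imag.
have W z : pdom D z -> pdom D (D z) -> z + D (D z) = x ->
    z = shift_inv imag (shift_inv (- imag) x).
  move=> hz hDz Ez; have hw : pdom D (z + imag *: D z) by apply: domD => //; exact: domZ.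
  have Ew : (z + imag *: D z) + (- imag) *: D (z + imag *: D z) = x.
    rewrite (DD regD)// ?(DZ regD)//; last exact: domZ.
    by rewrite -Ez; module_with R[i] E (@imag_mul_imag R).
  by rewrite -Ew shift_inv_uniq// shift_inv_uniq.
rewrite /resolvent; case: xgetP => [z _ [hz hDz Ez]|/(_ y)[]//].
by rewrite (W z)// (W y).
Qed.

Lemma resolventP x : [/\ pdom D (resolvent D x), pdom D (D (resolvent D x))
  & resolvent D x + D (D (resolvent D x)) = x].
Proof.
have [s1 s2] := skew_onto_imag.
have [hw Ew] := shift_invP x s2; set w := shift_inv _ x in hw Ew.
have [hy Ey] := shift_invP w s1; set y := shift_inv _ w in hy Ey.
have Dy : D y = (- imag) *: (w - y).
  by rewrite -Ey; module_with R[i] E (@imag_mul_imag R).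
have hDy : pdom D (D y) by rewrite Dy; apply: domZ => //; exact: domB.
have E1 : y + D (D y) = x.
  rewrite Dy (DZ regD) ?(DB regD)//; last exact: domB.
  rewrite -[RHS]Ew -[X in _ = X + _]Ey.
  by module_with R[i] E (@imag_mul_imag R).
have -> : resolvent D x = y by exact: resolvent_uniq.
by split.
Qed.

Lemma D2_resolvent x : D (D (resolvent D x)) = x - resolvent D x.
Proof. by have [_ _ {2}<-] := resolventP x; rewrite addrAC subrr add0r. Qed.

Lemma resolvent_lin l x y :
  resolvent D (l *: x + y) = l *: resolvent D x + resolvent D y.
Proof.
have [hx hDx Ex] := resolventP x; have [hy hDy Ey] := resolventP y.
have [h1 E1] := dom_lin regD l hx hy; have [h2 E2] := dom_lin regD l hDx hDy.
apply: resolvent_uniq; rewrite ?E1//.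
by rewrite E2 -{3}Ex -{3}Ey; module_over R[i] E.
Qed.

Lemma resolvent_D x : pdom D x -> resolvent D (D x) = D (resolvent D x).
Proof.
move=> hx; have [hy hDy Ey] := resolventP x.
have h : pdom D (D (D (resolvent D x))) by rewrite D2_resolvent; exact: domB.
by apply: resolvent_uniq => //; rewrite -(DD regD)// Ey.
Qed.

Definition Dresolvent x := D (resolvent D x).

Lemma Dresolvent_lin l x y :
  Dresolvent (l *: x + y) = l *: Dresolvent x + Dresolvent y.
Proof.
rewrite /Dresolvent resolvent_lin; have [hx _ _] := resolventP x.
by have [hy _ _] := resolventP y; have [] := dom_lin regD l hx hy.
Qed.

Lemma resolvent_adjoint : is_adjoint E 0 (resolvent D) (resolvent D).
Proof.
move=> x y /=; have [hx hDx Ex] := resolventP x; have [hy hDy Ey] := resolventP y.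
rewrite -{1}Ey -{2}Ex hipDr hipDl; congr (_ + _).
by rewrite -(D_symmetric saD hx hDy) (D_symmetric saD hDx hy).
Qed.

Lemma Dresolvent_adjoint : is_adjoint E 0 Dresolvent Dresolvent.
Proof.
move=> x y /=; rewrite /Dresolvent.
have [hx hDx Ex] := resolventP x; have [hy hDy Ey] := resolventP y.
rewrite -{1}Ey -{2}Ex hipDr hipDl (D_symmetric saD hx hy); congr (_ + _).
by rewrite (D_symmetric saD hDx hDy).
Qed.

Lemma resolvent_Dresolvent x : resolvent D (Dresolvent x) = Dresolvent (resolvent D x).
Proof. by rewrite /Dresolvent resolvent_D//; case: (resolventP x). Qed.

Lemma Dresolvent2 x : Dresolvent (Dresolvent x) = resolvent D x - resolvent D (resolvent D x).
Proof. by rewrite {1}/Dresolvent resolvent_Dresolvent D2_resolvent. Qed.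

Hypothesis oddD : odd_op D.

Lemma resolvent_hgr x : resolvent D (hgr x) = hgr (resolvent D x).
Proof.
have [hx hDx Ex] := resolventP x.
have [h1 E1] := oddD hx; have [h2 E2] := oddD hDx.
have h3 : pdom D (- hgr (D (resolvent D x))) by rewrite -scaleN1r; exact: domZ.
apply: resolvent_uniq; rewrite ?E1//.
by rewrite -scaleN1r (DZ regD)// E2 scaleN1r opprK -(linD (@hgrP R B E)) Ex.
Qed.

Lemma Dresolvent_hgr x : Dresolvent (hgr x) = - hgr (Dresolvent x).
Proof. by rewrite /Dresolvent resolvent_hgr; have [hx _ _] := resolventP x; case: (oddD hx). Qed.

End Resolvents.

(** * Diagonal amplifications of operators *)

Section Diagonal.
Context {R : realType} {B : gradedCStar R} {E : hilbertModule B}.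
Implicit Types (i : nat) (f g : E -> E) (S : set E) (l : R[i]).

Lemma diagn_comp f g i (x : hpow E i) : diagn f (diagn g x) = diagn (fun y => f (g y)) x.
Proof. by elim: i x => //= i IH x; rewrite !IH. Qed.

Lemma diagn_ext f g i (x : hpow E i) : f =1 g -> diagn f x = diagn g x.
Proof. by move=> /funext ->. Qed.

Lemma diagn_ext_dom f g S i (x : hpow E i) :
  (forall y, S y -> f y = g y) -> domn S x -> diagn f x = diagn g x.
Proof.
move=> fg; elim: i x => [|i IH] x /=; first exact: fg.
by move=> [h1 h2]; rewrite !IH.
Qed.

Lemma domn_diagn f S i (x : hpow E i) : (forall y, S (f y)) -> domn S (diagn f x).
Proof. by move=> Sf; elim: i x => //= i IH x; split. Qed.

Lemma diagn_lin f i : (forall l x y, f (l *: x + y) = l *: f x + f y) ->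
  forall l (x y : hpow E i), diagn f (l *: x + y) = l *: diagn f x + diagn f y.
Proof. by move=> fP; elim: i => //= i IH l x y; rewrite !IH. Qed.

Lemma diagn_adjoint f g i : is_adjoint E 0 f g -> is_adjoint E i (diagn f (i := i)) (diagn g (i := i)).
Proof. by move=> fg; elim: i => //= i IH x y /=; rewrite !IH. Qed.

Lemma diagn_grn f s i (x : hpow E i) :
  (forall l x y, f (l *: x + y) = l *: f x + f y) ->
  (forall y, f (hgr y) = s *: hgr (f y)) ->
  diagn f (grn x) = s *: grn (diagn f x).
Proof.
move=> fP fh; elim: i x => [|i IH] x //=.
by rewrite (linN (diagn_lin fP)) !IH -scalerN.
Qed.

Lemma diagn_cvs (f : nat -> E -> E) i (x : hpow E i) :
  (forall y, cvs enorm (fun n => f n y) y) ->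
  cvs (hnorm E i) (fun n => diagn (f n) x) x.
Proof.
move=> hf; elim: i x => [|i IH] x; first exact: hf.
by apply/cvs_pair; split; exact: IH.
Qed.

Lemma diagn_bound f (C : R) i (x : hpow E i) :
  (forall y, enorm (f y) <= C * enorm y) ->
  hnorm E i (diagn f x) <= C * hnorm E i x.
Proof.
move=> hf; elim: i x => [|i IH] x; first exact: hf.
by rewrite !hnormS /= mulrDr lerD.
Qed.

End Diagonal.

Section DiagonalOperator.
Context {R : realType} {B : gradedCStar R} {E : hilbertModule B}.
Variable D : partialOp E.
Hypotheses (saD : selfadjoint_op D) (regD : regular_op D) (oddD : odd_op D).
Implicit Types (l c : R[i]) (i : nat).

Lemma domn_lin i l (x y : hpow E i) : domn (pdom D) x -> domn (pdom D) y ->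
  domn (pdom D) (l *: x + y) /\ diagn D (l *: x + y) = l *: diagn D x + diagn D y.
Proof.
elim: i x y => [|i IH] x y /=; first exact: (dom_lin regD).
move=> [hx1 hx2] [hy1 hy2]; have [h1 ->] := IH _ _ hx1 hy1.
by have [h2 ->] := IH _ _ hx2 hy2.
Qed.

Lemma domn0 i : domn (pdom D) (0 : hpow E i).
Proof. by elim: i => [|i IH] /=; first exact: (dom0 regD). Qed.

Lemma diagnD0 i : diagn D (0 : hpow E i) = 0.
Proof. by elim: i => [|i IH] /=; [exact: (D0 regD)|rewrite IH]. Qed.

Lemma domnD i (x y : hpow E i) : domn (pdom D) x -> domn (pdom D) y -> domn (pdom D) (x + y).
Proof. by move=> hx hy; have [] := domn_lin 1 hx hy; rewrite scale1r. Qed.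

Lemma diagnDD i (x y : hpow E i) : domn (pdom D) x -> domn (pdom D) y ->
  diagn D (x + y) = diagn D x + diagn D y.
Proof. by move=> hx hy; have [_] := domn_lin 1 hx hy; rewrite !scale1r. Qed.

Lemma domnZ i l (x : hpow E i) : domn (pdom D) x -> domn (pdom D) (l *: x).
Proof. by move=> hx; have [] := domn_lin l hx (domn0 i); rewrite addr0. Qed.

Lemma diagnDZ i l (x : hpow E i) : domn (pdom D) x -> diagn D (l *: x) = l *: diagn D x.
Proof. by move=> hx; have [_] := domn_lin l hx (domn0 i); rewrite diagnD0 !addr0. Qed.

Lemma domnN i (x : hpow E i) : domn (pdom D) x -> domn (pdom D) (- x).
Proof. by rewrite -scaleN1r; exact: domnZ. Qed.

Lemma diagnDN i (x : hpow E i) : domn (pdom D) x -> diagn D (- x) = - diagn D x.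
Proof. by rewrite -scaleN1r => hx; rewrite diagnDZ// scaleN1r. Qed.

Lemma domnB i (x y : hpow E i) : domn (pdom D) x -> domn (pdom D) y -> domn (pdom D) (x - y).
Proof. by move=> hx hy; apply: domnD => //; exact: domnN. Qed.

Lemma diagnDB i (x y : hpow E i) : domn (pdom D) x -> domn (pdom D) y ->
  diagn D (x - y) = diagn D x - diagn D y.
Proof. by move=> hx hy; rewrite diagnDD ?diagnDN//; exact: domnN. Qed.

Lemma diagnD_selfadjoint i (y z : hpow E i) :
  (forall x, domn (pdom D) x -> ipn (diagn D x) y = ipn x z) ->
  domn (pdom D) y /\ diagn D y = z.
Proof.
elim: i y z => [|i IH] y z /=; first exact: (D_selfadjoint saD).
move=> h; have [|h1 E1] := IH y.1 z.1.
  move=> x hx; have := h (x, 0) (conj hx (domn0 i)).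
  by rewrite /= diagnD0 !ipn0l !addr0.
have [|h2 E2] := IH y.2 z.2.
  move=> x hx; have := h (0, x) (conj (domn0 i) hx).
  by rewrite /= diagnD0 !ipn0l !add0r.
by rewrite E1 E2; case: z {h E1 E2}.
Qed.

Lemma diagnD_symmetric i (x y : hpow E i) : domn (pdom D) x -> domn (pdom D) y ->
  ipn (diagn D x) y = ipn x (diagn D y).
Proof.
elim: i x y => [|i IH] x y /=; first exact: (D_symmetric saD).
by move=> [h1 h2] [h3 h4]; rewrite !IH.
Qed.

Lemma diagnD_closed i (u : nat -> hpow E i) y z : (forall n, domn (pdom D) (u n)) ->
  cvs (hnorm E i) u y -> cvs (hnorm E i) (fun n => diagn D (u n)) z ->
  domn (pdom D) y /\ diagn D y = z.
Proof.
move=> hu uy uz; apply: diagnD_selfadjoint => x hx.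
apply: (@cvs_unique _ _ anorm (fun n => ipn (diagn D x) (u n))).
  exact: cvs_ipnr.
by under eq_fun do rewrite diagnD_symmetric//; exact: cvs_ipnr.
Qed.

Lemma diagnD_odd i (x : hpow E i) : domn (pdom D) x ->
  domn (pdom D) (grn x) /\ diagn D (grn x) = - grn (diagn D x).
Proof.
elim: i x => [|i IH] x /=; first exact: oddD.
move=> [h1 h2]; have [h3 ->] := IH _ h1; have [h4 E4] := IH _ h2.
rewrite diagnDN// E4; split=> //; split=> //; exact: domnN.
Qed.

Lemma domn_dense i (x : hpow E i) (e : R) : 0 < e ->
  exists2 y, domn (pdom D) y & hnorm E i (x - y) < e.
Proof.
elim: i x e => [|i IH] x e e0.
  by apply: (dense_approx _ x e0); case: regD.
have e2 : 0 < e / 2 by lra.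
have [y hy h1] := IH x.1 _ e2; have [z hz h2] := IH x.2 _ e2.
by exists (y, z) => //; rewrite hnormS /=; lra.
Qed.

Lemma domn_separating i (x : hpow E i) :
  (forall y, domn (pdom D) y -> ipn y x = 0) -> x = 0.
Proof.
move=> h; apply: (@ipn_injr _ _ _ i) => z; rewrite ipn0r.
have /choice[u hu] : forall n : nat, exists y, domn (pdom D) y /\ hnorm E i (z - y) < n.+1%:R^-1.
  move=> n; have n0 : 0 < n.+1%:R^-1 :> R by rewrite invr_gt0.
  by have [y hy h1] := domn_dense z n0; exists y.
have uz : cvs (hnorm E i) u z.
  by apply: null_le1 (@null_harmonic R) => n; rewrite bnormC ltW//; case: (hu n).
apply: (cvs_unique (cvs_ipnl x uz)).
apply: (@cvs_ext _ _ _ (fun=> 0)); last exact: cvs_cst.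
by move=> n; rewrite h//; case: (hu n).
Qed.

(** The adjoints agree because [Dom D] separates vectors, hence so do the operators. This makes the
    extension of a commutator unique. *)
Lemma adjointable_eq_dom i (S T : hpow E i -> hpow E i) :
  adjointable E i S -> adjointable E i T ->
  (forall x, domn (pdom D) x -> S x = T x) -> S = T.
Proof.
move=> [S' hS] [T' hT] ST.
have E' : S' = T'.
  apply/funext => y; apply/eqP; rewrite -subr_eq0; apply/eqP/domn_separating => x hx.
  by rewrite ipnBr -hS -hT ST// subrr.
by apply/funext => x; apply: ipn_inj => y; rewrite hS hT E'.
Qed.

(** The mean of [(1 + i e_n D)^-1] and [(1 - i e_n D)^-1], which is [J_n = (1 + e_n^2 D^2)^-1]; its
    range lies in [Dom D]. *)
Definition dom_approx (n : nat) : E -> E := fun x =>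
  (2^-1 : R[i]) *: (shift_inv D (eps n) x + shift_inv D (- eps n) x).

Let sinv i c : hpow E i -> hpow E i := diagn (shift_inv D c) (i := i).

Lemma diagn_shift_invP i c (x : hpow E i) : skew_onto D c ->
  domn (pdom D) (sinv c x) /\ sinv c x + c *: diagn D (sinv c x) = x.
Proof.
move=> sc; elim: i x => [|i IH] x; first exact: shift_invP.
have [h1 E1] := IH x.1; have [h2 E2] := IH x.2.
by split=> //; rewrite [RHS]surjective_pairing; exact: (f_equal2 pair E1 E2).
Qed.

Lemma diagn_shift_inv_uniq i c (y : hpow E i) : skew_onto D c -> domn (pdom D) y ->
  sinv c (y + c *: diagn D y) = y.
Proof.
move=> sc; elim: i y => [|i IH] y; first exact: shift_inv_uniq.
by move=> [h1 h2]; rewrite /sinv /= -!/(sinv _ _) !IH//; case: y {h1 h2}.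
Qed.

End DiagonalOperator.

(** * Operators with bounded commutator *)

Section LipschitzOperators.
Context {R : realType} {B : gradedCStar R} {E : hilbertModule B}.
Variable D : partialOp E.
Hypotheses (saD : selfadjoint_op D) (regD : regular_op D) (oddD : odd_op D).
Variable i : nat.
Local Notation H := (hpow E i).
Local Notation dom := (@domn R B E (pdom D) i).
Local Notation Di := (@diagn R B E D i).
Local Notation N := (hnorm E i).
Implicit Types (T S delta : H -> H) (x y u v : H) (l c s : R[i]).

(** The commutator is an explicit argument, so that formulas for it can be proved before they are
    identified with the choice made by [comm]. *)
Definition lip T delta :=
  [/\ adjointable E i T, forall x, dom x -> dom (T x) & comm_ext D T delta].

Definition twist T : H -> H := fun x => grn (T (grn x)).

Lemma twistK T : twist (twist T) = T.
Proof. by apply/funext => x; rewrite /twist !grnK. Qed.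

Lemma twist_lin T : adjointable E i T ->
  forall l x y, twist T (l *: x + y) = l *: twist T x + twist T y.
Proof. by move=> aT; exact/adjointableP/adjointable_grn. Qed.

Lemma lip_diagn T delta x : lip T delta -> dom x -> Di (T x) = twist T (Di x) + delta x.
Proof. by case=> _ _ [_ h] hx; rewrite h// addrC subrK. Qed.

Lemma lip_intro T delta : adjointable E i T -> adjointable E i delta ->
  (forall x, dom x -> dom (T x) /\ Di (T x) = twist T (Di x) + delta x) ->
  lip T delta.
Proof.
move=> aT ad h; split=> // [x /h[]//|]; split=> // x /h[_ ->].
by rewrite /twist addrAC subrr add0r.
Qed.

Lemma lip_uniq T d1 d2 : lip T d1 -> lip T d2 -> d1 = d2.
Proof.
move=> [_ _ [a1 h1]] [_ _ [a2 h2]]; apply: (adjointable_eq_dom regD a1 a2) => x hx.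
by rewrite h1// h2.
Qed.

(** The Leibniz rule of the graded commutator: [D T S = (T' D + dT) S = T' (S' D + dS) + dT S]. *)
Lemma lip_comp T S dT dS : lip T dT -> lip S dS ->
  lip (fun x => T (S x)) (fun x => dT (S x) + twist T (dS x)).
Proof.
move=> hT hS; have [aT pT [adT _]] := hT; have [aS pS [adS _]] := hS.
apply: lip_intro => [||x hx].
- exact: adjointable_comp.
- apply: adjointable_add; apply: adjointable_comp => //; exact: adjointable_grn.
split; first by apply: pT; exact: pS.
rewrite (lip_diagn hT) ?(lip_diagn hS)//; last exact: pS.
rewrite (linD (twist_lin aT)) -addrA; congr (_ + _); last exact: addrC.
by rewrite /twist grnK.
Qed.

Lemma lip_lin l T S dT dS : lip T dT -> lip S dS ->
  lip (fun x => l *: T x + S x) (fun x => l *: dT x + dS x).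
Proof.
move=> hT hS; have [aT pT [adT _]] := hT; have [aS pS [adS _]] := hS.
apply: lip_intro => [||x hx]; try exact: adjointable_lin.
have [h ->] := domn_lin regD l (pT _ hx) (pS _ hx); split=> //.
by rewrite (lip_diagn hT)// (lip_diagn hS)// /twist grnP scalerDr addrACA.
Qed.

Lemma lip_id : lip id (fun=> 0).
Proof.
apply: lip_intro => [||x hx]; first exact: adjointable_id.
  by exists (fun=> 0) => x y; rewrite ipn0l ipn0r.
by rewrite /twist grnK addr0.
Qed.

Lemma lip_twist T delta : lip T delta -> lip (twist T) (fun x => - twist delta x).
Proof.
move=> hT; have [aT pT [ad _]] := hT; apply: lip_intro => [||x hx].
- exact: adjointable_grn.
- have := adjointable_scale (-1) (adjointable_grn ad).
  by under eq_fun do rewrite scaleN1r.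
rewrite twistK {1 2}/twist; have [hg Dg] := diagnD_odd regD oddD hx.
have [h ->] := diagnD_odd regD oddD (pT _ hg); split=> //.
rewrite (lip_diagn hT)// Dg /twist (linD (@grnP R B E i)) opprD; congr (_ - _).
rewrite grnK !(linN (@grnP R B E i)) grnK (linN (adjointableP aT)) opprK //.
Qed.

Local Notation sinv := (fun c => @diagn R B E (shift_inv D c) i).
Local Notation appr := (fun n => @diagn R B E (dom_approx D n) i).

Definition sgn s := s = 1 \/ s = -1.

Lemma sgn_skew s n : sgn s -> skew_onto D (s * eps n).
Proof.
have [h1 h2] := epsN_skew_onto saD regD n.
by case=> ->; rewrite ?mul1r ?mulN1r.
Qed.

Lemma sgn_norm s : sgn s -> normc s = 1.
Proof. by case=> ->; rewrite ?normcN normc1. Qed.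

Lemma sinv_lin c : skew_onto D c -> forall l x y,
  sinv c (l *: x + y) = l *: sinv c x + sinv c y.
Proof. by move=> sc; apply: diagn_lin; exact: shift_inv_lin. Qed.

Lemma sinv_cvs s (v : nat -> H) x : sgn s -> cvs N v x ->
  cvs N (fun n => sinv (s * eps n) (v n)) x.
Proof.
move=> hs vx; have sk n := sgn_skew n hs.
have h1 : cvs N (fun n => sinv (s * eps n) x) x.
  by apply: diagn_cvs => y; apply: shift_inv_cvs => //; exact: sgn_norm.
have h2 : cvs N (fun n => sinv (s * eps n) (v n - x)) 0.
  apply: null_le1 vx => n; rewrite subr0 -[leRHS]mul1r.
  by apply: diagn_bound => y; rewrite mul1r; exact: shift_inv_bound.
have := cvsD h2 h1; rewrite add0r; apply: cvs_ext => n.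
by rewrite -(linD (sinv_lin (sk n))) subrK.
Qed.

(** For [s = -1] the two summands change places. The sign is there to match [graded_lip_sinv], where
    the shift by [s * s' * eps n] becomes that by [s' * eps n]. *)
Lemma apprE s n x : sgn s ->
  appr n x = (2^-1 : R[i]) *: (sinv (s * eps n) x + sinv (s * -1 * eps n) x).
Proof.
have h : appr n x = (2^-1 : R[i]) *: (sinv (eps n) x + sinv (- eps n) x).
  elim: i x => [|j IH] x //=; rewrite !IH //.
by case=> ->; rewrite ?mul1r ?mulrNN ?mul1r ?mulN1r h// addrC.
Qed.

Lemma appr_dom n x : dom (appr n x).
Proof.
have s1 : sgn 1 by left. have s2 : sgn (1 * -1) by right; rewrite mul1r.
rewrite (apprE n x s1); apply: domnZ => //; apply: domnD => //;
  by apply: (diagn_shift_invP _ _).1 => //; exact: sgn_skew.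
Qed.

Lemma appr_cvs (v : nat -> H) x : cvs N v x -> cvs N (fun n => appr n (v n)) x.
Proof.
move=> vx; have s1 : sgn 1 by left. have s2 : sgn (1 * -1) by right; rewrite mul1r.
have := cvsZ (2^-1) (cvsD (sinv_cvs s1 vx) (sinv_cvs s2 vx)).
have -> : (2^-1 : R[i]) *: (x + x) = x by cbv beta; module_over R[i] (hpow E i).
by apply: cvs_ext => n; rewrite -apprE.
Qed.

Lemma appr_lin n l x y : appr n (l *: x + y) = l *: appr n x + appr n y.
Proof.
have [h1 h2] := epsN_skew_onto saD regD n; apply: diagn_lin => k a b.
rewrite /dom_approx (shift_inv_lin saD regD h1) (shift_inv_lin saD regD h2).
by module_over R[i] E.
Qed.

Lemma appr_D n x : dom x -> Di (appr n x) = appr n (Di x).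
Proof.
have [h1 h2] := epsN_skew_onto saD regD n.
move=> hx; rewrite !diagn_comp; apply: diagn_ext_dom hx => y hy.
have [k1 _] := shift_invP y h1; have [k2 _] := shift_invP y h2.
rewrite /dom_approx (DZ regD) ?(DD regD)//; last exact: domD.
by congr (_ *: (_ + _)); exact: shift_inv_D.
Qed.

(** Strong convergence of [D [T, J_n]] to 0 at every [u], also outside [Dom D]; it is applied at
    [u = S S x]. *)
Definition commutes_asymptotically T := forall u,
  (forall n, dom (T (appr n u) - appr n (T u))) /\
  cvs N (fun n => Di (T (appr n u) - appr n (T u))) 0.

(* From [D T = s T D + delta] one gets
   [T (1 + s c D)^-1 - (1 + c D)^-1 T = c (1 + c D)^-1 delta (1 + s c D)^-1]. *)
Lemma graded_lip_sinv s s' T delta u : sgn s -> sgn s' ->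
  adjointable E i T -> adjointable E i delta ->
  (forall x, dom x -> dom (T x) /\ Di (T x) = s *: T (Di x) + delta x) ->
  (forall n, dom (T (sinv (s * s' * eps n) u) - sinv (s' * eps n) (T u))) /\
  cvs N (fun n => Di (T (sinv (s * s' * eps n) u) - sinv (s' * eps n) (T u))) 0.
Proof.
move=> hs hs' aT ad h.
have hss : sgn (s * s').
  by case: hs hs' => -> [] ->; rewrite ?mul1r ?mulr1 ?mulrNN ?mul1r; [left|right|right|left].
have ss1 : s * s = 1 by case: hs => ->; rewrite ?mulrNN mul1r.
pose v n := sinv (s * s' * eps n) u.
have vu : cvs N v u by apply: sinv_cvs => //; exact: cvs_cst.
have dv : cvs N (fun n => delta (v n)) (delta u) by exact: cvs_adjointable.
have W n : T (v n) - sinv (s' * eps n) (T u) = (s' * eps n) *: sinv (s' * eps n) (delta (v n)).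
  have [hv Ev] := diagn_shift_invP u (sgn_skew n hss); rewrite -/(v n) in hv Ev.
  have [hTv ETv] := h _ hv.
  rewrite -{1}(diagn_shift_inv_uniq saD regD (sgn_skew n hs') hTv) ETv.
  have -> : T (v n) + (s' * eps n) *: (s *: T (Di (v n)) + delta (v n)) =
      (s' * eps n) *: delta (v n) + T u.
    rewrite -[in RHS]Ev (linD (adjointableP aT)) (linZ (adjointableP aT)).
    by cbv beta; module_over R[i] (hpow E i).
  by rewrite sinv_lin ?addrK//; exact: sgn_skew.
have hd n : dom (T (v n) - sinv (s' * eps n) (T u)).
  rewrite W; apply: domnZ => //.
  by apply: (diagn_shift_invP _ _).1 => //; exact: sgn_skew.
(* The factor [c] absorbs the unbounded [D]: [c D (1 + cD)^-1 w = w - (1 + cD)^-1 w], a difference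
   of sequences with the same limit. *)
split=> //; have := cvsB dv (sinv_cvs hs' dv); rewrite subrr; apply: cvs_ext => n.
rewrite -/(v n) W.
have [hw Ew] := diagn_shift_invP (delta (v n)) (sgn_skew n hs').
by rewrite (diagnDZ regD)// -{1}Ew addrAC subrr add0r.
Qed.

Lemma graded_lip_asymptotic s T delta : sgn s ->
  adjointable E i T -> adjointable E i delta ->
  (forall x, dom x -> dom (T x) /\ Di (T x) = s *: T (Di x) + delta x) ->
  commutes_asymptotically T.
Proof.
move=> hs aT ad h u; have s1 : sgn 1 by left. have s2 : sgn (-1) by right.
have [h1 c1] := graded_lip_sinv u hs s1 aT ad h.
have [h2 c2] := graded_lip_sinv u hs s2 aT ad h.
have W n : T (appr n u) - appr n (T u) =
   (2^-1 : R[i]) *: ((T (sinv (s * 1 * eps n) u) - sinv (1 * eps n) (T u)) +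
     (T (sinv (s * -1 * eps n) u) - sinv (-1 * eps n) (T u))).
  rewrite (apprE n u hs) (apprE n (T u) s1) mul1r mulr1.
  rewrite (linZ (adjointableP aT)) (linD (adjointableP aT)).
  by rewrite -scalerBr opprD addrACA mul1r.
have hd n := domnD regD (h1 n) (h2 n).
split=> [n|]; first by rewrite W; exact: domnZ.
have := cvsZ (2^-1) (cvsD c1 c2); rewrite addr0 scaler0; apply: cvs_ext => n.
by rewrite W (diagnDZ regD) ?(diagnDD regD (h1 n) (h2 n)).
Qed.

Lemma commutes_asymptotically_add T S : commutes_asymptotically T ->
  commutes_asymptotically S -> commutes_asymptotically (fun x => T x + S x).
Proof.
move=> hT hS u; have [h1 c1] := hT u; have [h2 c2] := hS u.
have W n : T (appr n u) + S (appr n u) - appr n (T u + S u) =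
    (T (appr n u) - appr n (T u)) + (S (appr n u) - appr n (S u)).
  by rewrite (linD (appr_lin n)) opprD addrACA.
split=> [n|]; first by rewrite W; exact: domnD.
have := cvsD c1 c2; rewrite addr0; apply: cvs_ext => n.
by rewrite W (diagnDD regD (h1 n) (h2 n)).
Qed.

(** The even part [(T + T') / 2] commutes with [D] and the odd part [(T - T') / 2] anticommutes with
    it, up to adjointable operators. *)
Lemma lip_asymptotic T delta : lip T delta -> commutes_asymptotically T.
Proof.
move=> hT; have hW := lip_twist hT.
have [aT pT [ad _]] := hT; have [aW pW [ad' _]] := hW.
have ET : T = (fun x => (2^-1 : R[i]) *: (T x + twist T x) + (2^-1 : R[i]) *: (T x - twist T x)).
  by apply/funext => x; module_over R[i] (hpow E i).
rewrite ET; apply: commutes_asymptotically_add.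
- apply: (@graded_lip_asymptotic 1 _ (fun x => (2^-1 : R[i]) *: (delta x + - twist delta x))).
  + by left.
  + by apply: adjointable_scale; exact: adjointable_add.
  + by apply: adjointable_scale; exact: adjointable_add.
  + move=> x hx; have h1 := pT _ hx; have h2 := pW _ hx.
    split; first by apply: domnZ => //; exact: domnD.
    rewrite (diagnDZ regD) ?(diagnDD regD)//; last exact: domnD.
    rewrite (lip_diagn hT)// (lip_diagn hW)// twistK.
    by cbv beta; module_over R[i] (hpow E i).
- apply: (@graded_lip_asymptotic (-1) _ (fun x => (2^-1 : R[i]) *: (delta x - - twist delta x))).
  + by right.
  + by apply: adjointable_scale; exact: adjointable_sub.
  + by apply: adjointable_scale; exact: adjointable_sub.
  + move=> x hx; have h1 := pT _ hx; have h2 := pW _ hx.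
    split; first by apply: domnZ => //; exact: domnB.
    rewrite (diagnDZ regD) ?(diagnDB regD)//; last exact: domnB.
    rewrite (lip_diagn hT)// (lip_diagn hW)// twistK.
    by cbv beta; module_over R[i] (hpow E i).
Qed.

(* [S x] is the limit of [T J_n S^2 x] with [J_n] the approximate units, and
   [T = S^2 T^3] lets [D] pass through [J_n] up to [[D, T^3]]. *)
Lemma lip_group_inverse T S delta : lip T delta -> adjointable E i S ->
  (forall x, T (S x) = S (T x)) -> (forall x, T (T (S x)) = T x) ->
  (forall x, S (S (T x)) = S x) -> exists delta', lip S delta'.
Proof.
move=> hT aS TS TTS SST.
have hN := lip_comp hT (lip_comp hT hT).
set d3 := (fun x => delta _ + _) in hN.
have [aT pT [ad _]] := hT; have [_ _ [ad3 _]] := hN.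
have aS' : adjointable E i (twist S) by exact: adjointable_grn.
(* Read off the limit below, [S' S' (D T x - d3 v) + delta v] with [v = S S x], by means of
   [D T x = T' D x + delta x] and [S' S' T' = S']. *)
exists (fun x => twist S (twist S (delta x - d3 (S (S x)))) + delta (S (S x))).
apply: lip_intro => //.
  apply: adjointable_add; last first.
    by apply: adjointable_comp => //; exact: adjointable_comp.
  apply: (adjointable_comp aS'); apply: (adjointable_comp aS').
  apply: adjointable_sub => //.
  by apply: adjointable_comp => //; exact: adjointable_comp.
move=> x hx; pose v := S (S x); pose y n := T (appr n v).
have cv : cvs N (fun n => appr n v) v by apply: appr_cvs; exact: cvs_cst.
have hy n : dom (y n) by apply: pT; exact: appr_dom.
have yS : cvs N y (S x).
  have -> : S x = T v by rewrite /v TS TS SST.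
  exact: cvs_adjointable.
have [hc cc] := lip_asymptotic hN v.
have Nv : T (T (T v)) = T x by rewrite /v TTS TTS.
rewrite Nv in hc cc.
have SSTTT z : twist S (twist S (twist T (twist T (twist T z)))) = twist T z.
  by rewrite /twist !grnK SST -!TS TTS.
(* [D T J_n v = T' D J_n v + delta J_n v]. Here [T' = S' S' T' T' T'] and
   [T' T' T' D = D T T T - d3]; inserting [J_n T x], where [T x = T T T v], leaves only convergent
   terms. *)
have Dy n : Di (y n) = twist S (twist S
    (Di (T (T (T (appr n v))) - appr n (T x)) + appr n (Di (T x)) - d3 (appr n v)))
    + delta (appr n v).
  rewrite /y (lip_diagn hT (appr_dom n v)); congr (_ + _); rewrite -SSTTT; congr (twist S (twist S _)).
  have hNa : dom (T (T (T (appr n v)))) by exact: (pT _ (pT _ (pT _ (appr_dom n v)))).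
  have hTx := appr_dom n (T x).
  rewrite (diagnDB regD hNa hTx) (appr_D n (pT _ hx)).
  rewrite (lip_diagn hN (appr_dom n v)) subrK addrK.
  by rewrite /twist !grnK.
have lim : cvs N (fun n => Di (y n))
    (twist S (twist S (0 + Di (T x) - d3 v)) + delta v).
  have c1 := cvsB (cvsD cc (appr_cvs (cvs_cst N (Di (T x))))) (cvs_adjointable ad3 cv).
  have c2 := cvs_adjointable aS' (cvs_adjointable aS' c1).
  by apply: cvs_ext (cvsD c2 (cvs_adjointable ad cv)) => n; rewrite Dy.
have [h ->] := diagnD_closed saD regD hy yS lim.
split=> //; rewrite add0r (lip_diagn hT)// [RHS]addrA -/v; congr (_ + _).
have L a b : twist S (twist S (a + b)) = twist S (twist S a) + twist S (twist S b).
  by rewrite !(linD (twist_lin aS)).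
rewrite -addrA [LHS]L; congr (_ + _).
by rewrite /twist !grnK SST.
Qed.

End LipschitzOperators.

(** * Sobolev algebras *)

Section GraphProjection.
Context {R : realType} {B : gradedCStar R} {E : hilbertModule B}.
Variable D : partialOp E.
Hypotheses (saD : selfadjoint_op D) (regD : regular_op D) (oddD : odd_op D).
Implicit Types (j : nat) (l : R[i]).

Definition res j : hpow E j -> hpow E j := diagn (resolvent D) (i := j).
Definition Dres j : hpow E j -> hpow E j := diagn (Dresolvent D) (i := j).

Lemma res_lin j l (x y : hpow E j) : res (l *: x + y) = l *: res x + res y.
Proof. by apply: diagn_lin; exact: resolvent_lin. Qed.

Lemma Dres_lin j l (x y : hpow E j) : Dres (l *: x + y) = l *: Dres x + Dres y.
Proof. by apply: diagn_lin; exact: Dresolvent_lin. Qed.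

Lemma res_adj j : is_adjoint E j (@res j) (@res j).
Proof. exact/diagn_adjoint/resolvent_adjoint. Qed.

Lemma Dres_adj j : is_adjoint E j (@Dres j) (@Dres j).
Proof. exact/diagn_adjoint/Dresolvent_adjoint. Qed.

Lemma res_Dres j (x : hpow E j) : res (Dres x) = Dres (res x).
Proof. by rewrite /res /Dres !diagn_comp; apply: diagn_ext => y; exact: resolvent_Dresolvent. Qed.

Lemma diagn_sub (f g : E -> E) j (x : hpow E j) :
  diagn (fun y => f y - g y) x = diagn f x - diagn g x.
Proof. by elim: j x => //= j IH x; rewrite !IH. Qed.

Lemma diagn_id j (x : hpow E j) : diagn id x = x.
Proof. by elim: j x => //= j IH [x y]; rewrite !IH. Qed.

Lemma Dres2 j (x : hpow E j) : Dres (Dres x) = res x - res (res x).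
Proof.
rewrite /res /Dres !diagn_comp -diagn_sub; apply: diagn_ext => y.
exact: Dresolvent2.
Qed.

Lemma D2resE j (x : hpow E j) : diagn (fun y => D (D (resolvent D y))) x = x - res x.
Proof.
rewrite -{2}(diagn_id x) -diagn_sub; apply: diagn_ext => y; exact: D2_resolvent.
Qed.

Lemma res_dom j (x : hpow E j) : domn (pdom D) (res x) /\ diagn D (res x) = Dres x.
Proof.
split; last by rewrite /res diagn_comp.
by apply: domn_diagn => y; case: (resolventP saD regD y).
Qed.

Lemma Dres_dom j (x : hpow E j) : domn (pdom D) (Dres x) /\ diagn D (Dres x) = x - res x.
Proof.
split; last by rewrite /Dres diagn_comp D2resE.
by apply: domn_diagn => y; case: (resolventP saD regD y).
Qed.

Lemma res_D j (x : hpow E j) : domn (pdom D) x -> res (diagn D x) = Dres x.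
Proof.
move=> hx; rewrite /res /Dres diagn_comp; apply: diagn_ext_dom hx => y hy.
exact: resolvent_D.
Qed.

Lemma Dres_D j (x : hpow E j) : domn (pdom D) x -> Dres (diagn D x) = x - res x.
Proof.
move=> hx; rewrite -D2resE /Dres diagn_comp; apply: diagn_ext_dom hx => y hy.
by rewrite /Dresolvent resolvent_D.
Qed.

Lemma res_grn j (x : hpow E j) : res (grn x) = grn (res x).
Proof.
rewrite -[RHS]scale1r; apply: diagn_grn; first exact: resolvent_lin.
by move=> y; rewrite scale1r; exact: resolvent_hgr.
Qed.

Lemma Dres_grn j (x : hpow E j) : Dres (grn x) = - grn (Dres x).
Proof.
rewrite -scaleN1r; apply: diagn_grn; first exact: Dresolvent_lin.
by move=> y; rewrite scaleN1r; exact: Dresolvent_hgr.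
Qed.

Lemma graph_projS j (z : hpow E j.+1) :
  graph_proj D j.+1 z = (res z.1 + Dres z.2, Dres z.1 + (z.2 - res z.2)).
Proof. by rewrite -D2resE. Qed.

Lemma resS j (z : hpow E j.+1) : res z = (res z.1, res z.2).
Proof. by []. Qed.

Lemma DresS j (z : hpow E j.+1) : Dres z = (Dres z.1, Dres z.2).
Proof. by []. Qed.

Lemma graph_projCS j (z : hpow E j.+1) :
  graph_projC D j.+1 z = z - graph_proj D j.+1 z.
Proof. by []. Qed.

(** Common properties of the projections that are functions of [D]: the identity, [p_j] and
    [1 - p_j]. *)
Definition functional j (Q : hpow E j -> hpow E j) :=
  [/\ is_adjoint E j Q Q, forall z, Q (Q z) = Q z,
      forall z, Q (res z) = res (Q z) /\ Q (Dres z) = Dres (Q z),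
      forall z, domn (pdom D) z -> domn (pdom D) (Q z) /\ diagn D (Q z) = Q (diagn D z)
    & forall z, Q (grn z) = grn (Q z)].

Lemma functional_id j : functional (@id (hpow E j)).
Proof. by []. Qed.

(** Idempotence comes from [Dres2]. The grading commutes because the off-diagonal entries are odd
    while the second summand carries the opposite grading, so that the signs cancel. *)
Lemma functional_graph_projS j : functional (graph_proj D j.+1).
Proof.
have lr := @res_lin j; have lb := @Dres_lin j.
have adj : is_adjoint E j.+1 (graph_proj D j.+1) (graph_proj D j.+1).
  move=> x y; rewrite !graph_projS /=.
  rewrite !ipnDl !ipnDr !ipnNl !ipnNr !(@res_adj j) !(@Dres_adj j).
  by module_over R[i] B.
split=> [//|z|z|z|z].
- rewrite !graph_projS /=; congr pair.
    rewrite (linD lr) (linD lb) (linB lb) Dres2 res_Dres; module_over R[i] (hpow E j).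
  rewrite (linD lb) !(linD lr) !(linN lr) Dres2 !res_Dres; module_over R[i] (hpow E j).
- rewrite !resS !DresS !graph_projS /=; split; congr pair;
    by rewrite ?(linD lr) ?(linD lb) ?(linN lr) ?(linN lb) ?Dres2 ?res_Dres.
- move=> hz; have [h1 h2] : domn (pdom D) z.1 /\ domn (pdom D) z.2 := hz.
  rewrite !graph_projS /=.
  have [r1 e1] := res_dom z.1; have [r2 e2] := res_dom z.2.
  have [b1 f1] := Dres_dom z.1; have [b2 f2] := Dres_dom z.2.
  have h3 := domnB regD h2 r2.
  rewrite (diagnDD regD r1 b2) (diagnDD regD b1 h3) (diagnDB regD h2 r2) e1 e2 f1 f2.
  rewrite (res_D h1) (res_D h2) (Dres_D h1) (Dres_D h2).
  by split=> //; split; exact: domnD.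
- rewrite !graph_projS /=; congr pair.
    by rewrite res_grn (linN lb) Dres_grn opprK (linD (@grnP R B E j)).
  rewrite Dres_grn (linN lr) res_grn (linD (@grnP R B E j)) (linB (@grnP R B E j)).
  by rewrite !opprD.
Qed.

Lemma functional_sub j (Q : hpow E j -> hpow E j) : functional Q ->
  functional (fun z => z - Q z).
Proof.
case=> aQ QQ Qr QD Qg; have lQ := is_adjointP aQ; split=> [x y|z|z|z hz|z].
- by rewrite ipnBl ipnBr aQ.
- by rewrite (linB lQ) QQ subrr subr0.
- by rewrite (Qr z).1 (Qr z).2 (linB (@res_lin j)) (linB (@Dres_lin j)).
- have [h Dh] := QD _ hz.
  by rewrite (diagnDB regD)// Dh; split=> //; exact: domnB.
- by rewrite Qg (linB (@grnP R B E j)).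
Qed.

Lemma functional_graph_proj j : functional (graph_proj D j).
Proof. by case: j => [|j]; [exact: functional_id|exact: functional_graph_projS]. Qed.

Lemma functional_graph_projC j : functional (graph_projC D j).
Proof.
case: j => [|j]; first exact: functional_id.
exact: functional_sub (functional_graph_projS j).
Qed.

Lemma graph_proj_dbl j (Q : hpow E j -> hpow E j) z : functional Q ->
  graph_proj D j.+1 (dbl Q z) = dbl Q (graph_proj D j.+1 z).
Proof.
case=> aQ _ Qr _ _; have lQ := is_adjointP aQ.
rewrite !graph_projS /dbl /= !(linD lQ) (linN lQ).
by rewrite !(Qr _).1 !(Qr _).2.
Qed.

Lemma graph_projC_dbl j (Q : hpow E j -> hpow E j) z : functional Q ->
  graph_projC D j.+1 (dbl Q z) = dbl Q (graph_projC D j.+1 z).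
Proof.
move=> fQ; rewrite /graph_projC graph_proj_dbl//.
by case: fQ => aQ _ _ _ _; rewrite /dbl /= !(linB (is_adjointP aQ)).
Qed.

Lemma graph_proj_fix j (x : hpow E j) : domn (pdom D) x ->
  graph_proj D j.+1 (x, diagn D x) = (x, diagn D x).
Proof.
move=> hx; rewrite graph_projS /= (res_D hx) (Dres_D hx).
by rewrite addrC subrK [_ - _]addrC addrA subrr add0r.
Qed.

Lemma graph_proj_range j (z : hpow E j.+1) :
  let x := (graph_proj D j.+1 z).1 in
  domn (pdom D) x /\ graph_proj D j.+1 z = (x, diagn D x).
Proof.
rewrite graph_projS /=; have [r1 e1] := res_dom z.1; have [b2 f2] := Dres_dom z.2.
by rewrite (diagnDD regD)// e1 f2; split=> //; exact: domnD.
Qed.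

(* The matrix [[T, 0], [[D, T], gamma T gamma]], which leaves the graph of [D]
   invariant. *)
Definition graph_mx j (T delta : hpow E j -> hpow E j) : hpow E j.+1 -> hpow E j.+1 :=
  fun z => (T z.1, delta z.1 + twist T z.2).

Lemma graph_mx_adjointable j (T delta : hpow E j -> hpow E j) :
  adjointable E j T -> adjointable E j delta -> adjointable E j.+1 (graph_mx T delta).
Proof.
move=> [T' hT] [d' hd]; exists (fun z => (T' z.1 + d' z.2, twist T' z.2)) => x y /=.
by rewrite ipnDr ipnDl hT hd (is_adjoint_grn hT) addrA.
Qed.

Lemma graph_mx_graph j (T delta : hpow E j -> hpow E j) z : lip D T delta ->
  graph_proj D j.+1 (graph_mx T delta (graph_proj D j.+1 z)) =
  graph_mx T delta (graph_proj D j.+1 z).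
Proof.
move=> hT; have [hx ->] := graph_proj_range z.
set x := (graph_proj D j.+1 z).1 in hx *.
have -> : graph_mx T delta (x, diagn D x) = (T x, diagn D (T x)).
  by rewrite (lip_diagn hT hx) addrC.
by rewrite graph_proj_fix//; case: hT => _ /(_ _ hx).
Qed.

(** As [Q] commutes with [D], the grading and [T], the operators [delta Q] and [Q delta] agree on
    [Dom D], hence everywhere. *)
Lemma graph_mx_dbl j (T delta Q : hpow E j -> hpow E j) z : lip D T delta ->
  functional Q -> (forall x, Q (T x) = T (Q x)) ->
  graph_mx T delta (dbl Q z) = dbl Q (graph_mx T delta z).
Proof.
move=> hT [aQ _ _ QD Qg] QT; have lQ := is_adjointP aQ.
have tQ x : twist T (Q x) = Q (twist T x) by rewrite /twist -Qg -QT -Qg.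
have [aT pT [ad _]] := hT.
have dQ : (fun x => delta (Q x)) = (fun x => Q (delta x)).
  apply: (adjointable_eq_dom regD).
  - by apply: adjointable_comp => //; exists Q.
  - by apply: adjointable_comp => //; exists Q.
  move=> x hx; have [hQ DQ] := QD _ hx; have [_ DT] := QD _ (pT _ hx).
  apply: (addrI (twist T (diagn D (Q x)))); rewrite -(lip_diagn hT)// -QT DT (lip_diagn hT)//.
  by rewrite (linD lQ) DQ tQ.
have dQx x : delta (Q x) = Q (delta x) := congr1 (fun f => f x) dQ.
by rewrite /graph_mx /dbl /= QT dQx tQ (linD lQ).
Qed.

Definition compress j (F : hpow E j.+1 -> hpow E j.+1) : hpow E j.+1 -> hpow E j.+1 :=
  fun z =>
  graph_proj D j.+1 (dbl (graph_proj D j) (F (dbl (graph_proj D j) (graph_proj D j.+1 z)))) +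
  graph_projC D j.+1 (dbl (graph_projC D j) (F (dbl (graph_projC D j) (graph_projC D j.+1 z)))).

Lemma adjointable_functional j (Q : hpow E j -> hpow E j) : functional Q -> adjointable E j Q.
Proof. by case=> aQ _ _ _ _; exists Q. Qed.

Lemma adjointable_dbl j (Q : hpow E j -> hpow E j) : functional Q ->
  adjointable E j.+1 (dbl Q).
Proof. by case=> aQ _ _ _ _; exists (dbl Q) => x y /=; rewrite !aQ. Qed.

Let pP j := functional_graph_proj j.
Let pC j := functional_graph_projC j.

Lemma compress_adjointable j (F : hpow E j.+1 -> hpow E j.+1) :
  adjointable E j.+1 F -> adjointable E j.+1 (compress F).
Proof.
move=> aF; apply: adjointable_add.
- apply: (adjointable_comp (adjointable_functional (pP j.+1))).
  apply: (adjointable_comp (adjointable_dbl (pP j))).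
  apply: (adjointable_comp aF).
  exact: (adjointable_comp (adjointable_dbl (pP j)) (adjointable_functional (pP j.+1))).
- apply: (adjointable_comp (adjointable_functional (pC j.+1))).
  apply: (adjointable_comp (adjointable_dbl (pC j))).
  apply: (adjointable_comp aF).
  exact: (adjointable_comp (adjointable_dbl (pC j)) (adjointable_functional (pC j.+1))).
Qed.

Lemma graph_proj_projC j z : graph_proj D j.+1 (graph_projC D j.+1 z) = 0.
Proof.
have [aP PP _ _ _] := pP j.+1.
by rewrite graph_projCS (linB (is_adjointP aP)) PP subrr.
Qed.

Lemma graph_projC_proj j z : graph_projC D j.+1 (graph_proj D j.+1 z) = 0.
Proof.
have [aP PP _ _ _] := pP j.+1.
by rewrite graph_projCS PP subrr.
Qed.

(** What multiplicativity of [compress] asks of [pi_(j+1)(a)]: triangular for [p_(j+1)], and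
    commuting with the projections of the previous level. *)
Definition graph_compatible j (F : hpow E j.+1 -> hpow E j.+1) :=
  [/\ adjointable E j.+1 F,
      forall z, graph_proj D j.+1 (F (graph_proj D j.+1 z)) = F (graph_proj D j.+1 z),
      forall z, F (dbl (graph_proj D j) z) = dbl (graph_proj D j) (F z)
    & forall z, F (dbl (graph_projC D j) z) = dbl (graph_projC D j) (F z)].

(** The projections [q], [q'] of level [j] commute with everything and are idempotent, so they can
    be collected. What remains is that the diagonal corners of block triangular operators
    multiply. *)
Lemma compress_comp j (F G : hpow E j.+1 -> hpow E j.+1) z :
  graph_compatible F -> graph_compatible G ->
  compress F (compress G z) = compress (fun x => F (G x)) z.
Proof.
move=> [aF Fp Fq Fq'] [aG Gp Gq Gq'].
have [aP PP _ _ _] := pP j.+1; have [aC CC _ _ _] := pC j.+1.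
have [aQ QQ _ _ _] := pP j; have [aQ' QQ' _ _ _] := pC j.
have lP := is_adjointP aP; have lC := is_adjointP aC.
have pq x := graph_proj_dbl x (pP j); have pq' x := graph_projC_dbl x (pC j).
set p := graph_proj D j.+1 in Fp Gp PP aP lP pq *.
set p' := graph_projC D j.+1 in CC aC lC pq' *.
set q := dbl (graph_proj D j) in Fq Gq pq *.
set q' := dbl (graph_projC D j) in Fq' Gq' pq' *.
have qq x : q (q x) = q x by rewrite /q /dbl /= !QQ.
have qq' x : q' (q' x) = q' x by rewrite /q' /dbl /= !QQ'.
have pp' x : p (p' x) = 0 by exact: graph_proj_projC.
have p'p x : p' (p x) = 0 by exact: graph_projC_proj.
have pC' x : p' x = x - p x by [].
(* For the complementary corner the invariance of the range of [p] takes the form [p' F p = 0]. *)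
have QpF x : p' (F (p' x)) = p' (F x).
  have -> : F x = F (p x) + F (p' x).
    by rewrite -(linD (adjointableP aF)) pC' addrC subrK.
  by rewrite (linD lC) -Fp p'p add0r.
rewrite /compress -/p -/p' -/q -/q'.
set a := p (q (G _)); set b := p' (q' (G _)).
have pab : p (a + b) = a by rewrite (linD lP) PP pp' addr0.
have p'ab : p' (a + b) = b by rewrite (linD lC) CC p'p add0r.
have qa : q a = G (q (p z)) by rewrite /a -pq qq -Gq qq -pq Gp.
have q'b : q' b = p' (G (q' (p' z))) by rewrite /b -pq' qq' -Gq' qq'.
by rewrite pab p'ab qa q'b [p' (q' (F _))]pq' QpF -pq'.
Qed.

Lemma compress_lin j l (F G : hpow E j.+1 -> hpow E j.+1) z :
  compress (fun x => l *: F x + G x) z = l *: compress F z + compress G z.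
Proof.
have [aP _ _ _ _] := pP j.+1; have [aC _ _ _ _] := pC j.+1.
have lQ := adjointableP (adjointable_dbl (pP j)).
have lQ' := adjointableP (adjointable_dbl (pC j)).
rewrite /compress lQ lQ' (is_adjointP aP) (is_adjointP aC).
by rewrite [LHS]addrACA [in RHS]scalerDr.
Qed.

(** Block diagonal operators commute with [p_(j+1)]. Thus [theta_(j+1)(a)] commutes with the
    projection that the next level compresses by. *)
Lemma compress_graph_proj j (F : hpow E j.+1 -> hpow E j.+1) z :
  adjointable E j.+1 F ->
  graph_proj D j.+1 (compress F z) = compress F (graph_proj D j.+1 z).
Proof.
move=> aF; have [aP PP _ _ _] := pP j.+1; have [aC _ _ _ _] := pC j.+1.
have lQ' := adjointableP (adjointable_dbl (pC j)).
rewrite /compress (linD (is_adjointP aP)) !PP graph_proj_projC graph_projC_proj.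
by rewrite (lin0 lQ') (lin0 (adjointableP aF)) (lin0 lQ') (lin0 (is_adjointP aC)).
Qed.

End GraphProjection.

(** * Linearity and multiplicativity of the maps [theta] *)

Section SobolevAlgebras.
Context {R : realType} {A B : gradedCStar R} {E : hilbertModule B}.
Variables (phi : A -> E -> E) (D : partialOp E).
Hypothesis phiB : bimodule phi.
Hypotheses (saD : selfadjoint_op D) (regD : regular_op D) (oddD : odd_op D).
Implicit Types (j : nat) (l : R[i]) (a b : A).

Local Notation theta j := (@Defs.theta R A B E phi D j).
Local Notation sobolev := (sobolev phi D).

Lemma comm_lip j (T : hpow E j -> hpow E j) : adjointable E j T ->
  comm_bounded D j T -> lip D T (comm D j T).
Proof.
move=> aT [pT [S hS]]; split=> //; rewrite /comm.
by case: xgetP => [S' _ //|/(_ S)].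
Qed.

Lemma lip_comm_bounded j (T delta : hpow E j -> hpow E j) :
  lip D T delta -> comm_bounded D j T.
Proof. by case=> _ pT hd; split=> //; exists delta. Qed.

(** By uniqueness, the choice made by [comm] can be computed from any explicit formula. *)
Lemma lip_comm j (T delta : hpow E j -> hpow E j) : lip D T delta -> comm D j T = delta.
Proof.
move=> hT; apply: (lip_uniq regD _ hT); apply: comm_lip; first by case: hT.
exact: lip_comm_bounded hT.
Qed.

Lemma thetaS j a : theta j.+1 a = compress D (graph_mx (theta j a) (comm D j (theta j a))).
Proof. by []. Qed.

Lemma theta_adjointable_proj j a : sobolev j a -> adjointable E j (theta j a) /\
  forall z, graph_proj D j (theta j a z) = theta j a (graph_proj D j z).
Proof.
elim: j a => [|j IH] a.
  move=> _; split=> //; case: phiB => _ _ phi_adj _.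
  by exists (phi (cadj a)); exact: phi_adj.
move=> [/IH[aT _] /(comm_lip aT)[_ _ [ad _]]]; rewrite thetaS.
have aF := graph_mx_adjointable aT ad.
by split; [exact: compress_adjointable|move=> z; exact: compress_graph_proj].
Qed.

Lemma sobolev_lip j a : sobolev j.+1 a -> lip D (theta j a) (comm D j (theta j a)).
Proof. by move=> [/theta_adjointable_proj[aT _]]; exact: comm_lip. Qed.

Lemma lip_sobolev j a delta : sobolev j a -> lip D (theta j a) delta -> sobolev j.+1 a.
Proof. by move=> ha /lip_comm_bounded. Qed.

Lemma theta_compatible j a : sobolev j.+1 a ->
  graph_compatible D (graph_mx (theta j a) (comm D j (theta j a))).
Proof.
move=> ha; have hT := sobolev_lip ha; have [aT _ [ad _]] := hT.
have [_ pT] := theta_adjointable_proj ha.1.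
have pC x : graph_projC D j (theta j a x) = theta j a (graph_projC D j x).
  case: j {ha hT ad} aT pT x => [//|j] aT pT x.
  by rewrite !graph_projCS pT (linB (adjointableP aT)).
split.
- exact: graph_mx_adjointable.
- by move=> z; exact: graph_mx_graph.
- by move=> z; rewrite (graph_mx_dbl regD _ hT (functional_graph_proj saD regD oddD j)).
- by move=> z; rewrite (graph_mx_dbl regD _ hT (functional_graph_projC saD regD oddD j)).
Qed.

(** Membership and the formula for [theta] go through one induction, here and in [sobolev_mul]:
    membership at level [j + 1] is a condition on [theta_j] of the combination. *)
Lemma sobolev_lin j l a b : sobolev j a -> sobolev j b -> sobolev j (l *: a + b) /\
  theta j (l *: a + b) = fun x => l *: theta j a x + theta j b x.
Proof.
elim: j => [|j IH].
  by move=> _ _; split=> //; apply/funext => x; case: phiB => phiP _ _ _; exact: phiP.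
move=> ha hb; have [hc Ec] := IH ha.1 hb.1.
have hlip := lip_lin regD l (sobolev_lip ha) (sobolev_lip hb).
have hc' : sobolev j.+1 (l *: a + b) by apply: lip_sobolev hc _; rewrite Ec; exact: hlip.
split=> //; apply/funext => z; rewrite !thetaS -compress_lin//.
congr (compress D _ z); apply/funext => y; rewrite Ec (lip_comm hlip) /graph_mx.
congr pair; rewrite /= /twist grnP scalerDr addrACA//.
Qed.

Lemma sobolev_mul j a b : sobolev j a -> sobolev j b -> sobolev j (cmul a b) /\
  theta j (cmul a b) = fun x => theta j a (theta j b x).
Proof.
elim: j => [|j IH].
  by move=> _ _; split=> //; apply/funext => x; case: phiB => _ phiM _ _; exact: phiM.
move=> ha hb; have [hc Ec] := IH ha.1 hb.1.
have [hTa hTb] := (sobolev_lip ha, sobolev_lip hb).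
have hlip := lip_comp hTa hTb.
have hc' : sobolev j.+1 (cmul a b) by apply: lip_sobolev hc _; rewrite Ec; exact: hlip.
split=> //; apply/funext => z; rewrite !thetaS.
rewrite compress_comp//; try exact: theta_compatible.
congr (compress D _ z); apply/funext => y; rewrite Ec (lip_comm hlip) /graph_mx.
have [aT _ _] := hTa.
congr pair; rewrite /= (linD (twist_lin aT)) addrA; congr (_ + _).
by rewrite /twist grnK.
Qed.

Lemma sobolev_comb j l l' a b : sobolev j a -> sobolev j b ->
  sobolev j (l *: a + l' *: b).
Proof.
(* [l a + l' b = (l' - 1) b + (l a + b)]. *)
move=> ha hb; have := (sobolev_lin l ha hb).1 => /(fun h => sobolev_lin (l' - 1) hb h)[+ _].
congr (sobolev j _); module_over R[i] A.
Qed.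

Lemma sobolevS j a : sobolev j.+1 a -> sobolev j a.
Proof. by case. Qed.

Implicit Types z w : (A * R[i]^o)%type.

(** The extension of [theta_j] to the unitization. The new unit acts as the identity, whose
    commutator with [D] vanishes, so [Theta_j(z)] and [theta_j(z.1)] have the same commutator. *)
Definition Theta j z : hpow E j -> hpow E j := fun x => z.2 *: x + theta j z.1 x.
Arguments Theta : clear implicits.

Lemma Theta_lip j z : sobolev j.+1 z.1 -> lip D (Theta j z) (comm D j (theta j z.1)).
Proof.
move=> /sobolev_lip hz; have := lip_lin regD z.2 (@lip_id _ _ _ D j) hz.
by under [X in lip _ _ X -> _]eq_fun do rewrite scaler0 add0r.
Qed.

Lemma Theta_sobolev j z delta : sobolev j z.1 -> lip D (Theta j z) delta -> sobolev j.+1 z.1.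
Proof.
move=> hz hlip; have := lip_lin regD (- z.2) (@lip_id _ _ _ D j) hlip.
have -> : (fun x => - z.2 *: id x + Theta j z x) = theta j z.1.
  by apply/funext => x; rewrite /Theta scaleNr addKr.
exact: lip_sobolev.
Qed.

Lemma Theta_adjointable j z : sobolev j z.1 -> adjointable E j (Theta j z).
Proof.
move=> /theta_adjointable_proj[aT _]; apply: adjointable_lin => //.
exact: adjointable_id.
Qed.

Lemma Theta_mul j z w : sobolev j z.1 -> sobolev j w.1 ->
  sobolev j (uni_mul z w).1 /\ Theta j (uni_mul z w) = fun x => Theta j z (Theta j w x).
Proof.
move=> hz hw; have [hm Em] := sobolev_mul hz hw.
have [h1 E1] := sobolev_lin z.2 hw hm; have [h2 E2] := sobolev_lin w.2 hz h1.
have Em' : (uni_mul z w).1 = w.2 *: z.1 + (z.2 *: w.1 + cmul z.1 w.1).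
  by rewrite /= addrC [_ + z.2 *: _]addrC.
rewrite /Theta Em'; split=> //; apply/funext => x; rewrite E2 E1 Em /=.
have [aT _] := theta_adjointable_proj hz; rewrite (adjointableP aT).
by rewrite !scalerDr scalerA [z.2 *: theta _ _ _ + _]addrC; module_over R[i] (hpow E j).
Qed.

(** The core of spectral invariance: [Theta_j] carries the three relations to operators, and
    [lip_group_inverse] raises the level of [w] by one. *)
Lemma sobolev_group_inverse j z w : sobolev j.+1 z.1 -> sobolev j w.1 ->
  uni_mul z w = uni_mul w z -> uni_mul z (uni_mul z w) = z ->
  uni_mul w (uni_mul w z) = w -> sobolev j.+1 w.1.
Proof.
move=> hz hw zw zzw wwz; have hz' := sobolevS hz.
have [m1 M1] := Theta_mul hz' hw; have [m2 M2] := Theta_mul hw hz'.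
have [_ M3] := Theta_mul hz' m1; have [_ M4] := Theta_mul hw m2.
have [|||d hd] := lip_group_inverse saD regD oddD (Theta_lip hz) (Theta_adjointable hw).
- by move=> x; have := congr1 (fun u => Theta j u x) zw; rewrite M1 M2.
- by move=> x; have := congr1 (fun u => Theta j u x) zzw; rewrite M3 M1.
- by move=> x; have := congr1 (fun u => Theta j u x) wwz; rewrite M4 M2.
exact: Theta_sobolev hd.
Qed.

End SobolevAlgebras.

(** * Spectra *)

Section Unitization.
Context {R : realType} {A : gradedCStar R}.
Implicit Types (z w : (A * R[i]^o)%type) (x y e a b : A) (l : R[i]).

Lemma uni_mul1 z : uni_mul z (uni_one A) = z.
Proof.
case: z => x k; rewrite /uni_mul /uni_one /= cmul0r scaler0 !add0r scale1r mulr1 //.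
Qed.

Lemma uni_1mul z : uni_mul (uni_one A) z = z.
Proof.
by case: z => x k; rewrite /uni_mul /uni_one /= cmul0l scaler0 addr0 add0r scale1r mul1r.
Qed.

Lemma uni_mul_alg x y : uni_mul (x, 0) (y, 0) = (cmul x y, 0).
Proof. by rewrite /uni_mul /= !scale0r !addr0 mul0r. Qed.

Lemma uni_shift a l : ((a, 0) - l *: uni_one A) = (a, - l) :> (A * R[i]^o)%type.
Proof.
by congr pair => /=; rewrite ?scaler0 ?subr0// sub0r; congr (- _); exact: mulr1.
Qed.

Lemma is_unit_uniq (S : set A) e f : is_unit S e -> is_unit S f -> e = f.
Proof. by move=> [eS _ he] [fS _ hf]; rewrite -(hf e eS).2 (he f fS).1. Qed.

End Unitization.

Section SpectralInvariance.
Context {R : realType} {A B : gradedCStar R} {E : hilbertModule B}.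
Variables (phi : A -> E -> E) (D : partialOp E).
Hypothesis phiB : bimodule phi.
Hypotheses (saD : selfadjoint_op D) (regD : regular_op D) (oddD : odd_op D).
Implicit Types (i j : nat) (l : R[i]) (a b e x y : A).
Local Notation sobolev := (sobolev phi D).

Lemma sobolev_uni_inverse i (z w : (A * R[i]^o)%type) : sobolev i.+1 z.1 -> sobolev i w.1 ->
  inverse_of (@uni_mul R A) (uni_one A) z w -> sobolev i.+1 w.1.
Proof.
move=> hz hw [zw wz]; apply: (sobolev_group_inverse phiB saD regD oddD hz hw).
- by rewrite zw wz.
- by rewrite zw uni_mul1.
- by rewrite wz uni_mul1.
Qed.

Lemma sobolev_alg_group_inverse i x y : sobolev i.+1 x -> sobolev i y ->
  cmul x y = cmul y x -> cmul x (cmul x y) = x -> cmul y (cmul y x) = y ->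
  sobolev i.+1 y.
Proof.
move=> hx hy xy xxy yyx.
apply: (@sobolev_group_inverse _ _ _ _ phi D phiB saD regD oddD i (x, 0) (y, 0) hx hy);
  by rewrite !uni_mul_alg ?xy ?xxy ?yyx// -xy xxy.
Qed.

Lemma spectrum_plus_sobolev i a : sobolev i.+1 a ->
  spectrum_plus (sobolev i.+1) a = spectrum_plus (sobolev i) a.
Proof.
move=> ha; apply/seteqP; split => l /= nb [b [hb inv]]; apply: nb; exists b; split=> //.
  apply: sobolev_uni_inverse inv => //.
  by rewrite uni_shift.
exact: sobolevS hb.
Qed.

Lemma unital_spectrum_sobolev i e a : is_unit (sobolev i.+1) e ->
  is_unit (sobolev i) e -> sobolev i.+1 a ->
  unital_spectrum (@cmul R A) e (sobolev i.+1) a = unital_spectrum (@cmul R A) e (sobolev i) a.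
Proof.
move=> [he _ _] [_ _ ue] ha.
apply/seteqP; split => l /= nb [b [hb [b1 b2]]]; apply: nb; exists b; split=> //.
  have hx : sobolev i.+1 (a - l *: e).
    have := sobolev_comb phiB saD regD oddD 1 (- l) ha he.
    by rewrite scale1r scaleNr.
  apply: (sobolev_alg_group_inverse hx hb); rewrite ?b1 ?b2//.
    by rewrite (ue _ (sobolevS hx)).2.
  by rewrite (ue _ hb).2.
exact: sobolevS hb.
Qed.

(** If [A_(i+1)] has a unit, both algebras share it; if neither has one, both spectra are taken in
    unitizations. In the mixed case, a unit [e] in [A_i] only, 0 lies in both spectra, and for [l]
    nonzero invertibility of [a - l] means the same in [A_i] as in its unitization. *)
Lemma spectrum_sobolev i :
  (forall e, is_unit (sobolev i.+1) e -> is_unit (sobolev i) e) ->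
  forall a, sobolev i.+1 a -> spectrum (sobolev i.+1) a = spectrum (sobolev i) a.
Proof.
move=> units a ha.
have [[e ue1]|nu1] := pselect (exists e, is_unit (sobolev i.+1) e).
  have ue0 := units _ ue1; apply/seteqP; split => l /= [[f [uf sf]]|[nu _]].
  - left; exists e; split=> //.
    by rewrite -unital_spectrum_sobolev// (is_unit_uniq ue1 uf).
  - by case: nu; exists e.
  - left; exists e; split=> //.
    by rewrite unital_spectrum_sobolev// (is_unit_uniq ue0 uf).
  - by case: nu; exists e.
have spE l : spectrum (sobolev i.+1) a l = spectrum_plus (sobolev i) a l.
  rewrite -spectrum_plus_sobolev//; apply/propext; split; last by right.
  by case=> [[e [ue _]]|[]//]; case: nu1; exists e.
apply/funext => l; rewrite spE; apply/propext.
have [[e ue0]|nu0] := pselect (exists e, is_unit (sobolev i) e); last first.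
  by split; [right|case=> [[e [ue _]]|[]//]; case: nu0; exists e].
have [he e0 ue] := ue0; have ha' := sobolevS ha.
have [ea ae] := ue a ha'; have [ee _] := ue e he.
have iff : (exists c : (A * R[i]^o)%type, uni_set (sobolev i) c /\
    inverse_of (@uni_mul R A) (uni_one A) ((a, 0) - l *: uni_one A) c) <->
  (exists b, sobolev i b /\ inverse_of (@cmul R A) e (a - l *: e) b).
  rewrite uni_shift; split=> [[[b k] [/= hb [[i1 i2] [i3 _]]]]|[b [hb [b1 b2]]]].
    have [eb be] := ue b hb.
    (* The map sending [(b, k)] to [b + k e] is the homomorphism from the unitization of [A_i] to
       [A_i]. *)
    exists (b + k *: e); split.
      by have := sobolev_comb phiB saD regD oddD 1 k hb he; rewrite scale1r.
    move: i2; rewrite /= => lk.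
    split.
      rewrite cmulBl !cmulDr !cmulZl !cmulZr ae eb ee.
      rewrite scalerA -[in RHS](scale1r e) -lk -[RHS]add0r -i1.
      by module_over R[i] A.
    rewrite cmulBr !cmulDl !cmulZl !cmulZr ea be ee.
    rewrite scalerA -[in RHS](scale1r e) -lk -[RHS]add0r -i3.
    by module_over R[i] A.
  have [eb be] := ue b hb.
  have [l0|l0] := eqVneq l 0.
    rewrite l0 scale0r subr0 in b1 b2.
    (* At [l = 0] an inverse [b] of [a] would lie in [A_(i+1)], and with it the unit [e = a b],
       contrary to [nu1]. *)
    have hb1 : sobolev i.+1 b.
      apply: (sobolev_alg_group_inverse ha hb); rewrite ?b1 ?b2//.
    case: nu1; exists e; split=> //.
      by rewrite -b1; case: (sobolev_mul phiB saD regD oddD ha hb1).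
    by move=> x hx; apply: ue; exact: sobolevS.
  exists (b + l^-1 *: e, - l^-1); split.
    by have := sobolev_comb phiB saD regD oddD 1 l^-1 hb he; rewrite /uni_set /= scale1r.
  have m : - l * - l^-1 = 1 by rewrite mulrNN mulfV.
  have m' : - l^-1 * - l = 1 by rewrite mulrNN mulVf.
  split; congr pair => //=.
    move: b1; rewrite cmulBl cmulDr cmulZl cmulZr eb ae => /(canRL (subrK _)) ->.
    by module_over R[i] A.
  move: b2; rewrite cmulBr cmulDl cmulZl cmulZr be ea => /(canRL (subrK _)) ->.
  by module_over R[i] A.
split=> [nb|[[f [uf nb]]|[nu _]]].
- left; exists e; split=> //= h; exact/nb/iff.
- by move=> h; apply: nb; rewrite -(is_unit_uniq ue0 uf); exact/iff.
- by case: nu; exists e.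
Qed.

End SpectralInvariance.

(** * Holomorphic functional calculus *)

Section ContinuousPaths.
Context {R : realType} {V : lmodType R[i]}.
Variable N : banach_norm V.
Implicit Types (F : R -> V) (g : R -> R[i]).

Definition ccontinuous01 g := forall t, 0 <= t <= 1 -> forall e : R, 0 < e ->
  exists2 d, 0 < d & forall s, 0 <= s <= 1 -> `|s - t| < d -> normc (g s - g t) < e.

Lemma continuous01_scale g F : ccontinuous01 g -> continuous01 N F ->
  continuous01 N (fun t => g t *: F t).
Proof.
move=> cg cF t t01 e e0.
pose M := normc (g t) + 1; have M0 : 0 < M by rewrite ltr_wpDl ?normc_ge0.
pose K := N (F t) + 1; have K0 : 0 < K by rewrite ltr_wpDl ?bnorm_ge0.
have [d1 d10 h1] := cF t t01 (e / 2 / M) ltac:(by rewrite !divr_gt0).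
have [d2 d20 h2] := cg t t01 (e / 2 / K) ltac:(by rewrite !divr_gt0).
have [d3 d30 h3] := cg t t01 1 ltr01.
exists (Num.min d1 (Num.min d2 d3)); first by rewrite !lt_min d10 d20 d30.
move=> s s01; rewrite !lt_min => /andP[st1 /andP[st2 st3]].
have -> : g s *: F s - g t *: F t = g s *: (F s - F t) + (g s - g t) *: F t.
  by module_over R[i] V.
apply: (le_lt_trans (bnormD N _ _)); rewrite !bnormZ.
have gM : normc (g s) <= M.
  have := le_normcD (g s - g t) (g t); rewrite subrK /M; have := h3 s s01 st3; lra.
have -> : e = e / 2 + e / 2 by lra.
apply: ler_ltD.
  apply: (@le_trans _ _ (M * (e / 2 / M))); last by rewrite mulrC divfK// gt_eqF.
  by apply: ler_pM; rewrite ?normc_ge0 ?bnorm_ge0// ltW// h1.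
apply: (@le_lt_trans _ _ (normc (g s - g t) * K)).
  by rewrite ler_wpM2l ?normc_ge0// lerDl.
by rewrite -ltr_pdivlMr// h2.
Qed.

Lemma continuous01_add F F' : continuous01 N F -> continuous01 N F' ->
  continuous01 N (fun t => F t + F' t).
Proof.
move=> cF cF' t t01 e e0.
have [d1 d10 h1] := cF t t01 (e / 2) ltac:(lra).
have [d2 d20 h2] := cF' t t01 (e / 2) ltac:(lra).
exists (Num.min d1 d2); first by rewrite lt_min d10 d20.
move=> s s01; rewrite lt_min => /andP[st1 st2].
have := h1 s s01 st1; have := h2 s s01 st2.
have := bnormD N (F s - F t) (F' s - F' t); rewrite opprD addrACA; lra.
Qed.

(* Near [t] the resolvent identity bounds [Q_s] by [2 |Q_t|], so that no uniform
   bound on the family is needed. *)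
Lemma resolvent_continuous01 (Q : R -> V -> V) (L : R) x : 0 <= L ->
  (forall t, 0 <= t <= 1 -> exists2 C, 0 <= C & forall y, N (Q t y) <= C * N y) ->
  (forall s t, 0 <= s <= 1 -> 0 <= t <= 1 -> exists2 l, normc l <= L * `|s - t| &
    forall y, Q t y - Q s y = l *: Q t (Q s y)) ->
  continuous01 N (fun t => Q t x).
Proof.
move=> L0 bQ rQ t t01 e e0; have [C C0 hC] := bQ t t01.
pose M := C + 1; have M0 : 0 < M by rewrite /M; lra.
have hM y : N (Q t y) <= M * N y.
  by apply: (le_trans (hC y)); rewrite ler_wpM2r ?bnorm_ge0// /M; lra.
pose K := N x + 1; have K0 : 0 < K by rewrite ltr_wpDl ?bnorm_ge0.
pose L' := L + 1; have L'0 : 0 < L' by rewrite /L'; lra.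
(* Within [d1] of [t] one has [|l| M <= 1/2], which absorbs the error term and yields
   [|Q_s x| <= 2 M |x|]; [d2] then makes [|l| M (2 M |x|)] smaller than [e]. *)
pose d1 := (2 * M * L')^-1; pose d2 := e / (2 * M * M * K * L').
have d10 : 0 < d1 by rewrite invr_gt0 !mulr_gt0.
have d20 : 0 < d2 by rewrite divr_gt0 ?mulr_gt0.
exists (Num.min d1 d2); first by rewrite lt_min d10 d20.
move=> s s01; rewrite lt_min => /andP[st1 st2].
have [l hl E] := rQ s t s01 t01.
have hl' : normc l <= L' * `|s - t|.
  by apply: (le_trans hl); rewrite ler_wpM2r// /L'; lra.
have l1 : normc l * M <= 2^-1.
  have h : L' * `|s - t| <= L' * d1 by rewrite ler_pM2l// ltW.
  have : normc l * M <= L' * d1 * M by rewrite ler_pM2r//; exact: le_trans h.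
  suff -> : L' * d1 * M = 2^-1 by [].
  by rewrite /d1; field; rewrite !gt_eqF.
have l2 : normc l * (M * (2 * M * N x)) < e.
  have h : normc l <= L' * d2 by apply: (le_trans hl'); rewrite ler_pM2l// ltW.
  apply: (@le_lt_trans _ _ (L' * d2 * (M * (2 * M * N x)))).
    by rewrite ler_wpM2r// !mulr_ge0 ?bnorm_ge0// ltW.
  have -> : L' * d2 * (M * (2 * M * N x)) = e * (N x / K).
    by rewrite /d2; field; rewrite !gt_eqF.
  by rewrite gtr_pMr// ltr_pdivrMr// mul1r /K; lra.
have a2 : N (Q s x) <= 2 * M * N x.
  have h1 : Q s x = Q t x - l *: Q t (Q s x) by rewrite -E opprB addrC subrK.
  have h2 : N (Q s x) <= N (Q t x) + normc l * N (Q t (Q s x)).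
    by rewrite {1}h1 -bnormZ; exact: bnormB.
  have h3 : normc l * N (Q t (Q s x)) <= 2^-1 * N (Q s x).
    apply: (@le_trans _ _ (normc l * (M * N (Q s x)))).
      by rewrite ler_wpM2l ?normc_ge0.
    by rewrite mulrA ler_wpM2r ?bnorm_ge0.
  have := hM x; lra.
rewrite bnormC E bnormZ; apply: le_lt_trans l2.
rewrite ler_wpM2l ?normc_ge0//; apply: (le_trans (hM _)).
by rewrite ler_pM2l.
Qed.

End ContinuousPaths.

Section CycleSums.
Context {R : realType} {V : lmodType R[i]}.
Variable m : nat.
Variable G : 'I_m -> R -> R[i].
Implicit Types (F : 'I_m -> R -> V).

Definition cycle_sum F n : V := \sum_(j < m) rsum (G j) (F j) n.

Lemma cycle_sum_add F F' n : cycle_sum (fun j t => F j t + F' j t) n = cycle_sum F n + cycle_sum F' n.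
Proof.
rewrite /cycle_sum -big_split; apply: eq_bigr => j _.
by rewrite /rsum -big_split; apply: eq_bigr => k _; rewrite scalerDr.
Qed.

Lemma eq_cycle_sum F F' n : (forall j t, 0 <= t <= 1 -> F j t = F' j t) -> cycle_sum F n = cycle_sum F' n.
Proof.
move=> h; apply: eq_bigr => j _; apply: eq_bigr => k _; rewrite h//.
by rewrite in01// ltnW.
Qed.

Lemma cycle_sum_ind (P : V -> Prop) F n : P 0 -> (forall l x y, P x -> P y -> P (l *: x + y)) ->
  (forall j t, 0 <= t <= 1 -> P (F j t)) -> P (cycle_sum F n).
Proof.
move=> P0 Pl PF; have PD x y : P x -> P y -> P (x + y).
  by move=> hx hy; rewrite -[x]scale1r; exact: Pl.
apply: big_ind => // j _; apply: big_ind => // k _.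
by rewrite -[X in P X]addr0; apply: Pl => //; apply: PF; rewrite in01// ltnW.
Qed.

Lemma cvs_cycle_sum (N : banach_norm V) F :
  (forall j, exists2 L, 0 <= L & lipschitz01 (G j) L) ->
  (forall j, continuous01 N (F j)) -> exists x, cvs N (cycle_sum F) x.
Proof.
move=> lG cF.
have /choice[x hx] : forall j, exists x, cvs N (rsum (G j) (F j)) x.
  by move=> j; have [L L0 hL] := lG j; exact: rsum_cauchy L0 hL (cF j).
exists (\sum_(j < m) x j); rewrite /cycle_sum.
elim: (index_enum _) => [|j s IH].
  by apply: (@cvs_ext _ _ _ (fun=> 0)) => [n|]; rewrite !big_nil//; exact: cvs_cst.
rewrite big_cons; apply: cvs_ext (cvsD (hx j) IH) => n.
by rewrite big_cons.
Qed.

End CycleSums.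

Lemma cycle_sum_map (R : realType) (V W : lmodType R[i]) m (G : 'I_m -> R -> R[i])
    (f : V -> W) (F : 'I_m -> R -> V) n :
  (forall (l : R[i]) x y, f (l *: x + y) = l *: f x + f y) ->
  f (cycle_sum G F n) = cycle_sum G (fun j t => f (F j t)) n.
Proof.
move=> fP; rewrite /cycle_sum (lin_sum fP); apply: eq_bigr => j _.
by rewrite /rsum (lin_sum fP); apply: eq_bigr => k _; rewrite (linZ fP).
Qed.

(** Adjoints of Riemann sums are Riemann sums along the conjugate curves. If both families converge
    strongly, the limits are adjoint to each other. *)
Lemma cycle_sum_ipn (R : realType) (B : gradedCStar R) (E : hilbertModule B) i m
    (G : 'I_m -> R -> R[i]) (g : 'I_m -> R -> R[i]) (Q Q' : 'I_m -> R -> hpow E i -> hpow E i) n x y :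
  (forall j t, 0 <= t <= 1 -> is_adjoint E i (Q j t) (Q' j t)) ->
  ipn (cycle_sum G (fun j t => g j t *: Q j t x) n) y =
  ipn x (cycle_sum (fun j t => (G j t)^*)%C (fun j t => (g j t)^*%C *: Q' j t y) n).
Proof.
move=> aQ; rewrite /cycle_sum.
have sl (I : finType) (F : I -> hpow E i) z : ipn (\sum_k F k) z = \sum_k ipn (F k) z.
  by elim/big_rec2: _ => [|k u v _ <-]; rewrite ?ipn0l ?ipnDl.
have sr (I : finType) (F : I -> hpow E i) z : ipn z (\sum_k F k) = \sum_k ipn z (F k).
  by elim/big_rec2: _ => [|k u v _ <-]; rewrite ?ipn0r ?ipnDr.
rewrite sl sr; apply: eq_bigr => j _; rewrite /rsum sl sr; apply: eq_bigr => k _.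
rewrite !ipnZl !ipnZr aQ; last by rewrite in01// ltnW.
by congr (_ *: _); exact: rmorphB.
Qed.

(** * Contour integrals of resolvents in the Sobolev algebras *)

Section ResolventIntegrals.
Context {R : realType} {A B : gradedCStar R} {E : hilbertModule B}.
Variables (phi : A -> E -> E) (D : partialOp E).
Hypothesis phiB : bimodule phi.
Hypotheses (saD : selfadjoint_op D) (regD : regular_op D) (oddD : odd_op D).
Local Notation theta j := (@Defs.theta R A B E phi D j).
Local Notation sobolev := (sobolev phi D).
Local Notation Th j := (@Theta R A B E phi D j).
Implicit Types (z w : (A * R[i]^o)%type).

(** The scalar part is included because the resolvent identity holds in the unitization, not for the
    first components alone. *)
Definition Theta_mx j z : hpow E j.+1 -> hpow E j.+1 :=
  graph_mx (Th j z) (comm D j (theta j z.1)).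
Arguments Theta_mx : clear implicits.

Lemma Theta_mxE j z x :
  Theta_mx j z x = z.2 *: x + graph_mx (theta j z.1) (comm D j (theta j z.1)) x.
Proof.
rewrite /Theta_mx /graph_mx; congr pair => /=.
by rewrite /twist /Theta grnP grnK addrCA.
Qed.

Lemma Theta_mx_adjointable j z : sobolev j.+1 z.1 -> adjointable E j.+1 (Theta_mx j z).
Proof.
move=> hz; have [aT _ [ad _]] := Theta_lip phiB saD regD oddD hz.
exact: graph_mx_adjointable.
Qed.

Lemma Theta_mx_resolvent j z w (l : R[i]) : sobolev j.+1 z.1 -> sobolev j.+1 w.1 ->
  z - w = l *: uni_mul z w ->
  forall x, Theta_mx j z x - Theta_mx j w x = l *: Theta_mx j z (Theta_mx j w x).
Proof.
move=> hz hw E1.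
have [hm Em] := Theta_mul phiB saD regD oddD hz.1 hw.1.
have [hm1 _] := Theta_mul phiB saD regD oddD hz hw.
have [Lz Lw] := (Theta_lip phiB saD regD oddD hz, Theta_lip phiB saD regD oddD hw).
have Lm := Theta_lip phiB saD regD oddD hm1.
have Lm' := lip_comp Lz Lw; rewrite -Em in Lm'.
have dm := lip_uniq regD Lm Lm'.
have z1 : z.1 = l *: (uni_mul z w).1 + w.1.
  by have := congr1 fst E1 => /= <-; rewrite subrK.
have z2 : z.2 = l *: (uni_mul z w).2 + w.2.
  by have := congr1 snd E1 => /= <-; rewrite subrK.
have [_ Tl] := sobolev_lin phiB saD regD oddD l hm hw.1.
have Tz : Th j z = fun x => l *: Th j (uni_mul z w) x + Th j w x.
  apply/funext => x; rewrite {1}/Theta z1 Tl z2 /Theta.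
  rewrite -[l *: (uni_mul z w).2]/(l * (uni_mul z w).2).
  by module_over R[i] (hpow E j).
have dz : comm D j (theta j z.1) = fun x => l *: comm D j (theta j (uni_mul z w).1) x + comm D j (theta j w.1) x.
  have Lz' := lip_lin regD l Lm Lw; rewrite -Tz in Lz'.
  exact: (lip_uniq regD Lz Lz').
have comp x : Theta_mx j z (Theta_mx j w x) = Theta_mx j (uni_mul z w) x.
  rewrite /Theta_mx /graph_mx dm Em /=; congr pair.
  have [aT _ _] := Lz; rewrite (linD (twist_lin aT)) addrA; congr (_ + _).
  by rewrite /twist grnK.
move=> x; rewrite comp; apply/eqP; rewrite subr_eq; apply/eqP.
rewrite {1}/Theta_mx /graph_mx Tz dz; congr pair => //=.
by rewrite /twist grnP scalerDr addrACA.
Qed.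

(** The strong convergence of the sums of [theta_i] is part of the induction: at the next level it
    identifies the diagonal corners of the limit [X] of the matrix sums, leaving the lower left
    corner [C] as the candidate for the commutator. *)
Lemma cauchy_integral_sobolev i m (G g : 'I_m -> R -> R[i])
    (r : 'I_m -> R -> (A * R[i]^o)%type) (v : A) :
  (forall j, exists2 L, 0 <= L & lipschitz01 (G j) L) ->
  (forall j, ccontinuous01 (g j)) ->
  (forall j s t, 0 <= s <= 1 -> 0 <= t <= 1 ->
     r j t - r j s = (G j s - G j t) *: uni_mul (r j t) (r j s)) ->
  cvs anorm (cycle_sum G (fun j t => g j t *: (r j t).1)) v ->
  (forall j t, 0 <= t <= 1 -> sobolev i (r j t).1) ->
  sobolev i v /\
  forall x, cvs (hnorm E i) (cycle_sum G (fun j t => g j t *: theta i (r j t).1 x)) (theta i v x).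
Proof.
move=> lG cg res_id rv; elim: i => [|i IH] hr.
  split=> // x; have [phiP _ _ _] := phiB.
  pose f a := phi a x.
  have fP (l : R[i]) a b : f (l *: a + b) = l *: f a + f b by exact: phiP.
  have fZ (l : R[i]) a : f (l *: a) = l *: f a by exact: linZ.
  apply: (@cvs_ext _ _ _ (fun n => f (cycle_sum G (fun j t => g j t *: (r j t).1) n))).
    by move=> n; rewrite (cycle_sum_map _ _ _ fP); apply: eq_cycle_sum => j t _; rewrite fZ.
  apply: (null_le (C := 4 * enorm x)) rv => [|n]; first by rewrite mulr_ge0 ?bnorm_ge0.
  rewrite -[theta 0 v x]/(f v) -(linB fP); apply: (le_trans (bimodule_bounded _ _ phiB)).
  by rewrite mulrAC.
have [hv IHv] := IH (fun j t ht => (hr j t ht).1).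
have [aTv _] := theta_adjointable_proj phiB saD regD oddD hv.
pose del j t := comm D i (theta i (r j t).1).
pose P j t := graph_mx (theta i (r j t).1) (del j t).
(* The integrand is [P], but continuity is available for [Theta_mx] through the resolvent identity;
   the scalars in between are treated by [csig]. *)
have PE j t : P j t = fun x => (- (r j t).2) *: x + Theta_mx i (r j t) x.
  by apply/funext => x; rewrite Theta_mxE scaleNr addKr.
have hlip j t : 0 <= t <= 1 -> lip D (theta i (r j t).1) (del j t).
  by move=> ht; exact: (sobolev_lip phiB saD regD oddD (hr j t ht)).
(* Adjoints are chosen for all parameters at once; outside [[0, 1]] nothing is claimed and [id] is a
   default. *)
have /choice[A' hA'] : forall jt : 'I_m * R, exists T', 0 <= jt.2 <= 1 ->
    is_adjoint E i.+1 (Theta_mx i (r jt.1 jt.2)) T'.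
  move=> [j t] /=; have [ht|nt] := pselect (0 <= t <= 1 : Prop); last by exists id.
  by have [T' hT] := Theta_mx_adjointable (hr j t ht); exists T'.
have hA j t (ht : 0 <= t <= 1) : is_adjoint E i.+1 (Theta_mx i (r j t)) (A' (j, t)) := hA' (j, t) ht.
pose P' j t x := (- (r j t).2)^*%C *: x + A' (j, t) x.
have hP j t : 0 <= t <= 1 -> is_adjoint E i.+1 (P j t) (P' j t).
  by move=> ht; rewrite PE; apply: is_adjoint_lin; [exact: is_adjoint_id|exact: hA].
have bdd (Q Q' : hpow E i.+1 -> hpow E i.+1) : is_adjoint E i.+1 Q Q' ->
    exists2 C, 0 <= C & forall y, hnorm E i.+1 (Q y) <= C * hnorm E i.+1 y.
  by move=> h; apply: adjointable_bounded; exists Q'.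
have cTheta j x : continuous01 (hnorm E i.+1) (fun t => Theta_mx i (r j t) x).
  have [L L0 hL] := lG j.
  apply: (resolvent_continuous01 (Q := fun t => Theta_mx i (r j t)) x L0) => [t ht|s t hs ht]; first exact: bdd (hA j t ht).
  exists (G j s - G j t); first exact: hL.
  by apply: Theta_mx_resolvent => //; [exact: hr|exact: hr|exact: res_id].
have cA j x : continuous01 (hnorm E i.+1) (fun t => A' (j, t) x).
  have [L L0 hL] := lG j.
  apply: (resolvent_continuous01 (Q := fun t => A' (j, t)) x L0) => [t ht|s t hs ht].
    exact: bdd (is_adjoint_sym (hA j t ht)).
  exists ((G j s - G j t)^*)%C; first by rewrite normc_conj; exact: hL.
  move=> y; apply: (@ipn_injr _ _ _ i.+1) => x'.
  rewrite ipnBr ipnZr -!(hA j) // -ipnBl.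
  (* Taking adjoints reverses products, hence the resolvent identity is used with [s] and [t]
     exchanged. *)
  have := Theta_mx_resolvent (hr j s hs) (hr j t ht) (res_id j t s ht hs) x'.
  move=> E1; have -> : Theta_mx i (r j t) x' - Theta_mx i (r j s) x' =
    (G j s - G j t) *: Theta_mx i (r j s) (Theta_mx i (r j t) x').
    by rewrite -opprB E1 -scaleNr opprB.
  by rewrite ipnZl.
(* The scalar parts satisfy the resolvent identity in the complex numbers, so the same lemma
   applies. *)
have csig j x : continuous01 (hnorm E i.+1) (fun t => (r j t).2 *: x).
  have [L L0 hL] := lG j.
  apply: (resolvent_continuous01 (Q := fun t y => (r j t).2 *: y) x L0) => [t ht|s t hs ht].
    by exists (normc (r j t).2) => [|y]; [exact: normc_ge0|rewrite bnormZ].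
  exists (G j s - G j t); first exact: hL.
  move=> y; rewrite -scalerBl !scalerA; congr (_ *: _).
  by have := congr1 snd (res_id j s t hs ht) => /= ->.
have cP j x : continuous01 (hnorm E i.+1) (fun t => P j t x).
  have -> : (fun t => P j t x) = (fun t => - (r j t).2 *: x + Theta_mx i (r j t) x).
    by apply/funext => t; rewrite PE.
  apply: continuous01_add (cTheta j x) => t ht e e0.
  have [d d0 hd] := csig j x t ht e e0; exists d => // s hs st.
  by rewrite !scaleNr -opprD bnormN; exact: hd.
have cP' j x : continuous01 (hnorm E i.+1) (fun t => P' j t x).
  apply: continuous01_add (cA j x) => t ht e e0.
  have [d d0 hd] := csig j x t ht e e0; exists d => // s hs st.
  have := hd s hs st; rewrite -!scalerBl !bnormZ -conjcB normc_conj.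
  by rewrite -opprD normcN.
have lGc j : exists2 L, 0 <= L & lipschitz01 (fun t => (G j t)^*%C) L.
  have [L L0 hL] := lG j; exists L => // s t hs ht.
  by rewrite -conjcB normc_conj; exact: hL.
have cgc j : ccontinuous01 (fun t => (g j t)^*%C).
  move=> t ht e e0; have [d d0 hd] := cg j t ht e e0; exists d => // s hs st.
  by rewrite -conjcB normc_conj; exact: hd.
have /choice[X hX] : forall x, exists y,
    cvs (hnorm E i.+1) (cycle_sum G (fun j t => g j t *: P j t x)) y.
  by move=> x; apply: cvs_cycle_sum => // j; exact: continuous01_scale.
have /choice[X' hX'] : forall x, exists y, cvs (hnorm E i.+1)
    (cycle_sum (fun j t => (G j t)^*%C) (fun j t => (g j t)^*%C *: P' j t x)) y.
  move=> x; apply: cvs_cycle_sum => // j.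
  exact: (@continuous01_scale _ _ _ (fun t => (g j t)^*%C)).
have adjX : is_adjoint E i.+1 X X'.
  move=> x y; apply: (cvs_unique (cvs_ipnl y (hX x))).
  apply: cvs_ext (cvs_ipnr x (hX' y)) => n.
  by rewrite (cycle_sum_ipn _ _ _ _ _ hP).
have c1 (z : hpow E i.+1) : cvs (hnorm E i) (cycle_sum G (fun j t => g j t *: theta i (r j t).1 z.1)) (X z).1.
  have [h _] := (cvs_pair _ _ _ _).1 (hX z); apply: cvs_ext h => n.
  by rewrite (@cycle_sum_map _ (hpow E i.+1) (hpow E i) _ _ fst).
have c2 (z : hpow E i.+1) : cvs (hnorm E i) (cycle_sum G (fun j t =>
    g j t *: (del j t z.1 + twist (theta i (r j t).1) z.2))) (X z).2.
  have [_ h] := (cvs_pair _ _ _ _).1 (hX z); apply: cvs_ext h => n.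
  by rewrite (@cycle_sum_map _ (hpow E i.+1) (hpow E i) _ _ snd).
pose C x := (X (x, 0)).2.
have aC : adjointable E i C.
  exists (fun y => (X' (0, y)).1) => x y; have := adjX (x, 0) (0, y).
  by rewrite /= ipn0r ipn0l !addr0 add0r.
have cC x : cvs (hnorm E i) (cycle_sum G (fun j t => g j t *: del j t x)) (C x).
  apply: cvs_ext (c2 (x, 0)) => n; apply: eq_cycle_sum => j t ht /=.
  have [aT _ _] := hlip j t ht.
  by rewrite (lin0 (twist_lin aT)) addr0.
have ctw x : cvs (hnorm E i) (cycle_sum G (fun j t => g j t *: twist (theta i (r j t).1) x))
    (twist (theta i v) x).
  apply: cvs_ext (cvs_grn (IHv (grn x))) => n.
  rewrite (cycle_sum_map _ _ _ (@grnP R B E i)); apply: eq_cycle_sum => j t ht.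
  by rewrite (linZ (@grnP R B E i)).
have XE (z : hpow E i.+1) : X z = graph_mx (theta i v) C z.
  rewrite [LHS]surjective_pairing; congr pair.
    exact: cvs_unique (c1 z) (IHv z.1).
  apply: (cvs_unique (c2 z)); apply: cvs_ext (cvsD (cC z.1) (ctw z.2)) => n.
  by rewrite -cycle_sum_add; apply: eq_cycle_sum => j t _; rewrite scalerDr.
have lipv : lip D (theta i v) C.
  apply: lip_intro => // x hx.
  (* Each [P j t] preserves the graph of [D], a closed subspace; so it contains the sums applied to
     [(x, D x)], and then their limit [(theta_i(v) x, C x + twist (theta_i(v)) (D x))]. *)
  have gr n : domn (pdom D) (cycle_sum G (fun j t => g j t *: P j t (x, diagn D x)) n).1 /\
      diagn D (cycle_sum G (fun j t => g j t *: P j t (x, diagn D x)) n).1 =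
      (cycle_sum G (fun j t => g j t *: P j t (x, diagn D x)) n).2.
    apply: (@cycle_sum_ind _ (hpow E i.+1) _ _ (fun z : hpow E i.+1 => domn (pdom D) z.1 /\ diagn D z.1 = z.2)).
    - by split; [exact: domn0|exact: diagnD0].
    - move=> l y z [hy Ey] [hz Ez]; have [h ->] := domn_lin regD l hy hz.
      by rewrite Ey Ez.
    move=> j t ht; have hT := hlip j t ht; have [_ pT _] := hT.
    split; first by apply: domnZ => //; exact: pT.
    by rewrite /= (diagnDZ regD) ?(lip_diagn hT)// 1?addrC//; exact: pT.
  have [l1 l2] := (cvs_pair _ _ _ _).1 (hX (x, diagn D x)).
  have l2' : cvs (hnorm E i) (fun n => diagn D
     (cycle_sum G (fun j t => g j t *: P j t (x, diagn D x)) n).1) (X (x, diagn D x)).2.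
    by apply: cvs_ext l2 => n; rewrite (gr n).2.
  have := diagnD_closed saD regD (fun n => (gr n).1) l1 l2'.
  by rewrite XE /graph_mx /= addrC.
have hv1 := lip_sobolev hv lipv.
split=> // x.
have fp := adjointable_functional (functional_graph_proj saD regD oddD i.+1).
have fp' := adjointable_functional (functional_graph_projC saD regD oddD i.+1).
have fq := adjointable_dbl (functional_graph_proj saD regD oddD i).
have fq' := adjointable_dbl (functional_graph_projC saD regD oddD i).
have K1 := adjointable_comp fp fq; have K2 := adjointable_comp fp' fq'.
rewrite thetaS (lip_comm regD lipv) /compress -!XE.
apply: cvs_ext (cvsD (cvs_adjointable K1 (hX _)) (cvs_adjointable K2 (hX _))) => n.
rewrite (cycle_sum_map _ _ _ (adjointableP K1)) (cycle_sum_map _ _ _ (adjointableP K2)).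
rewrite -cycle_sum_add; apply: eq_cycle_sum => j t ht.
by rewrite (linZ (adjointableP K1)) (linZ (adjointableP K2)) -scalerDr.
Qed.

End ResolventIntegrals.

Lemma derivable_normc_continuous (R : realType) (f : R[i] -> R[i]) (z : R[i]) :
  derivable (f : R[i]^o -> R[i]^o) z 1 -> forall e : R, 0 < e ->
  exists2 d, 0 < d & forall w, normc (w - z) < d -> normc (f w - f z) < e.
Proof.
move=> /derivable1_diffP/differentiable_continuous cf e e0.
have eC : 0 < e%:C%C by rewrite ltcR.
have /cvgrPdist_lt/(_ _ eC)/nbhs_ballP[d /posC_real[r [r0 ->]] hd] := cf.
exists r => // w wz; have := hd w; rewrite -ball_normE /= !normr_normc !ltcR => h.
by rewrite -normcN opprB; apply: h; rewrite -normcN opprB.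
Qed.

Section HolomorphicStability.
Context {R : realType} {A B : gradedCStar R} {E : hilbertModule B}.
Variables (phi : A -> E -> E) (D : partialOp E).
Hypothesis phiB : bimodule phi.
Hypotheses (saD : selfadjoint_op D) (regD : regular_op D) (oddD : odd_op D).
Local Notation sobolev := (sobolev phi D).
Implicit Types (a b e : A).

Lemma sobolev_scale i (l : R[i]) a : sobolev i a -> sobolev i (l *: a).
Proof.
move=> ha; have := sobolev_comb phiB saD regD oddD l 0 ha ha.
by rewrite scale0r addr0.
Qed.

Lemma two_pi_i_neq0 : @two_pi_i R != 0.
Proof.
rewrite /two_pi_i eq_complex /= eqxx /= mulf_neq0//.
by rewrite gt_eqF// pi_gt0.
Qed.

(** Resolvents with values in the unitization cover both forms of [holo_calc]: for a unit of [A]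
    itself their scalar part is 0. *)
Lemma contour_sobolev i m (G : 'I_m -> R -> R[i]) (U : set R[i]) (K : set R[i])
    (f : R[i] -> R[i]) (r : R[i] -> (A * R[i]^o)%type) (b : A) :
  surrounds G K U -> (forall z, U z -> derivable (f : R[i]^o -> R[i]^o) z 1) ->
  (forall j s t, 0 <= s <= 1 -> 0 <= t <= 1 ->
     r (G j t) - r (G j s) = (G j s - G j t) *: uni_mul (r (G j t)) (r (G j s))) ->
  (forall j t, 0 <= t <= 1 -> sobolev i (r (G j t)).1) ->
  contour_integral G (fun w => f w *: (r w).1) (@two_pi_i R *: b) -> sobolev i b.
Proof.
move=> [lG _ GU _ _] df res_id hr /cnorm_cvg cb.
have [|||||h _] := cauchy_integral_sobolev phiB saD regD oddD (i := i) (G := G)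
    (g := fun j t => f (G j t)) (r := fun j t => r (G j t)) (v := @two_pi_i R *: b).
- move=> j; have [L hL] := lG j; exists `|L| => // s t hs ht.
  have := hL s t hs ht; rewrite normr_normc lecR => /le_trans; apply.
  by rewrite ler_wpM2r// ler_norm.
- move=> j t ht ep ep0.
  have [d d0 hd] := derivable_normc_continuous (df _ (GU j t ht).1) ep0.
  have [L hL] := lG j; pose L' := `|L| + 1.
  have L'0 : 0 < L' by rewrite ltr_wpDl.
  exists (d / L'); first by rewrite divr_gt0.
  move=> s hs st; apply: hd; have := hL s t hs ht; rewrite normr_normc lecR => h.
  apply: (le_lt_trans h); apply: (@le_lt_trans _ _ (L' * `|s - t|)).
    by rewrite ler_wpM2r// /L'; have := ler_norm L; lra.
  by rewrite mulrC -ltr_pdivlMr.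
- exact: res_id.
- exact: cb.
- exact: hr.
have := sobolev_scale (@two_pi_i R)^-1 h.
by rewrite scalerA mulVf ?two_pi_i_neq0// scale1r.
Qed.

Lemma uni_mulA (x y z : (A * R[i]^o)%type) : uni_mul x (uni_mul y z) = uni_mul (uni_mul x y) z.
Proof.
case: x y z => [x k] [y l] [z n]; rewrite /uni_mul /=; congr pair; last exact: mulrA.
rewrite !cmulDl !cmulDr !cmulZl !cmulZr !scalerDr !scalerA cmulA.
by module_over R[i] A.
Qed.

(** The resolvent identity before cancellation: for [x] and [y] the resolvents at [G] and [G'], the
    left hand side is [x - y]. *)
Lemma uni_mul_shift (G G' : R[i]) a (x y : (A * R[i]^o)%type) :
  uni_mul x (uni_mul (G' *: uni_one A - (a, 0)) y) - uni_mul x (uni_mul (G *: uni_one A - (a, 0)) y)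
  = (G' - G) *: uni_mul x y.
Proof.
case: x y => [x k] [y n]; rewrite /uni_mul /uni_one /=; congr pair => /=.
  rewrite !scaler0 !sub0r !subr0 -[G' *: 1]/(G' * 1) -[G *: 1]/(G * 1) !mulr1.
  rewrite !(cmulDr, cmulNl, cmulZr).
  by module_over R[i] A.
rewrite !subr0 -[G' *: 1]/(G' * 1) -[G *: 1]/(G * 1) !mulr1.
by rewrite -[RHS]/((G' - G) * (k * n)); ring.
Qed.

(** Spectral invariance climbs from [A_0 = A], where there is no condition on [z], up to [A_i]. *)
Lemma resolvent_sobolev i (G : R[i]) a (z : (A * R[i]^o)%type) : sobolev i a ->
  inverse_of (@uni_mul R A) (uni_one A) (G *: uni_one A - (a, 0)) z -> sobolev i z.1.
Proof.
move=> ha inv; elim: i ha => [//|i IH] ha.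
apply: (sobolev_uni_inverse phiB saD regD oddD _ (IH ha.1) inv).
have -> : (G *: uni_one A - (a, 0)).1 = -1 *: a by rewrite /= scaler0 sub0r scaleN1r.
exact: sobolev_scale.
Qed.

(** The unit [e] may act on the module as a proper projection, so [b] acts as a group inverse rather
    than an inverse. *)
Lemma resolvent_unital_sobolev i (G : R[i]) e a b : is_unit setT e -> sobolev i e ->
  sobolev i a -> inverse_of (@cmul R A) e (G *: e - a) b -> sobolev i b.
Proof.
move=> [_ _ ue] he ha [b1 b2]; elim: i he ha => [//|i IH] he ha.
have hx : sobolev i.+1 (G *: e - a).
  by have := sobolev_comb phiB saD regD oddD G (-1) he ha; rewrite scaleN1r.
apply: (sobolev_alg_group_inverse phiB saD regD oddD hx (IH he.1 ha.1)).
- by rewrite b1 b2.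
- by rewrite b1 (ue _ _).2.
- by rewrite b2 (ue _ _).2.
Qed.

Lemma holo_stable_sobolev i : holo_stable (sobolev i).
Proof.
split=> [a f b ha|e a f b ue he ha] [U [m [G [r [_ df sG inv cb]]]]].
- apply: (contour_sobolev sG df (r := r)) => [j s t hs ht|j t ht|].
  + have [z1 z2] := inv j t ht; have [w1 w2] := inv j s hs.
    rewrite -(uni_mul_shift _ _ a) w1 uni_mul1 uni_mulA z2 uni_1mul//.
  + exact: resolvent_sobolev ha (inv j t ht).
  + rewrite /contour_integral.
    pose F w := f w *: r w.
    (* The integral in the unitization is projected to its [A]-component, the only one that
       [uni_set] restricts. *)
    have fstE : (fun n : nat => \sum_(j < m) \sum_(k < n)
        (G j (k.+1%:R / n%:R) - G j (k%:R / n%:R)) *: (F (G j (k%:R / n%:R))).1) =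
      fst \o (fun n : nat => \sum_(j < m) \sum_(k < n)
        (G j (k.+1%:R / n%:R) - G j (k%:R / n%:R)) *: F (G j (k%:R / n%:R))).
      apply/funext => n /=; rewrite (@lin_sum _ (A * R[i]^o)%type A fst)//.
      by apply: eq_bigr => j _; rewrite (@lin_sum _ (A * R[i]^o)%type A fst).
    rewrite [X in X @ _]fstE; apply: cvg_comp cb _; exact: cvg_fst.
- have [_ _ uE] := ue.
  apply: (contour_sobolev sG df (r := fun w => (r w, 0))) => [j s t hs ht|j t ht|//].
  + have [z1 z2] := inv j t ht; have [w1 w2] := inv j s hs.
    rewrite uni_mul_alg; congr pair => /=; last by rewrite subr0 scaler0.
    have E1 : r (G j t) = cmul (r (G j t)) (cmul (G j s *: e - a) (r (G j s))).
      by rewrite w1 (uE _ _).2.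
    have E2 : r (G j s) = cmul (r (G j t)) (cmul (G j t *: e - a) (r (G j s))).
      by rewrite cmulA z2 (uE _ _).1.
    rewrite {1}E1 {2}E2 -cmulBr -cmulBl -cmulZr; congr (cmul _ _).
    have -> : G j s *: e - a - (G j t *: e - a) = (G j s - G j t) *: e.
      by module_over R[i] A.
    by rewrite cmulZl (uE _ _).1.
  + exact: resolvent_unital_sobolev ue he ha (inv j t ht).
Qed.

End HolomorphicStability.

Theorem theorem4p2p4 (R : realType) (A B : gradedCStar R)
    (E : hilbertModule B) (phi : A -> E -> E) (D : partialOp E)
    (sepA : separable A) (sepB : separable B) (cgE : countably_generated E)
    (hD : unbounded_bimodule phi D) :
  (forall i : nat,
     (forall a : A, sobolev phi D i.+1 a ->
        spectrum_plus (sobolev phi D i.+1) a = spectrum_plus (sobolev phi D i) a)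
     /\
     ((forall e : A, is_unit (sobolev phi D i.+1) e -> is_unit (sobolev phi D i) e) ->
      forall a : A, sobolev phi D i.+1 a ->
        spectrum (sobolev phi D i.+1) a = spectrum (sobolev phi D i) a))
  /\ (forall i : nat, holo_stable (sobolev phi D i)).
Proof.
case: hD => phiB oddD saD regD _; split=> i; last exact: holo_stable_sobolev.
split; first exact: spectrum_plus_sobolev.
exact: spectrum_sobolev.
Qed.
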